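(* Let $(\vartheta_0,k)$ be one of the pairs $(0.729,2)$, $(0.616,3)$, $(0.554,4)$, $(0.515,5)$, and suppose that some $\vartheta>\vartheta_0$ satisfies both conditions (A) and (B) below. Let $\mathcal H=\{h_i\}_{i=1}^k$ be an admissible $k$-tuple and let $r\ne 0$ be a fixed integer with $r\notin\mathcal H$. Then there are infinitely many integers $n$ such that either (i) $n+\mathcal H=\{n+h_i\}_{i=1}^k$ contains at least two primes, or (ii) $n+h_i$ is prime for some $h_i\in\mathcal H$ and $\lambda(n+r)=-1$.
   Context: A $k$-tuple $\mathcal H=\{h_i\}_{i=1}^k$ of integers $0\le h_1<\dots<h_k$ is admissible if for every prime $p$ its elements do not occupy all residue classes modulo $p$. $\Omega(n)$ is the number of prime factors of $n$ counted with multiplicity and $\lambda(n)=(-1)^{\Omega(n)}$. Condition (A) (level of distribution $\vartheta$ of primes): for every $\varepsilon>0$, $A>0$, $\sum_{q\le N^{\vartheta-\varepsilon}}\max_{a:(a,q)=1}\bigl|\sum_{p\le N,\,p\equiv a\ (\mathrm{mod}\ q)}\log p-\frac{N}{\varphi(q)}\bigr|\ll_{\varepsilon,A}\frac{N}{(\log N)^A}$ ($p$ ranging over primes). Condition (B): for every $\varepsilon>0$, $A>0$, $\sum_{q\le N^{\vartheta-\varepsilon}}\max_{y\le N}\max_a\bigl|\sum_{n\le y,\,n\equiv a\ (\mathrm{mod}\ q)}\lambda(n)\bigr|\ll_{\varepsilon,A}\frac{N}{(\log N)^A}$. *)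

(* Defs.v *)
From Stdlib Require Import Reals.
From mathcomp Require Import all_boot all_order all_algebra.
From mathcomp Require Import Rstruct.
Set Implicit Arguments. Unset Strict Implicit. Unset Printing Implicit Defensive.

(* Omega(n): number of prime factors of n counted with multiplicity
   (Omega 0 = 0 by convention; only used for n >= 1 in the paper). *)
Definition bigOmega (n : nat) : nat := (\sum_(p <- primes n) logn p n)%N.

Definition liouville (n : nat) : R := ((-1) ^ bigOmega n)%R.

Definition admissible (H : seq nat) : Prop :=
  forall p : nat, prime.prime p -> exists a : 'I_p, forall h, h \in H -> h %% p != a.

Definition qbound (N : nat) (e : R) : nat :=
  Z.to_nat (Int_part (Rpower (INR N) e)).

Definition theta_ap (N q a : nat) : R :=
  (\sum_(0 <= p < N.+1 | prime.prime p && ((p %% q)%N == a)) ln (INR p))%R.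

Definition primeDev (N q : nat) : R :=
  (\big[Rmax/0%R]_(a < q | coprime a q)
     Rabs (theta_ap N q a - INR N / INR (totient q)))%R.

Definition condA (theta : R) : Prop :=
  forall eps A : R, (0 < eps)%R -> (0 < A)%R ->
  exists C : R, exists N0 : nat, forall N : nat, (N0 <= N)%N -> (2 <= N)%N ->
    (\sum_(1 <= q < (qbound N (theta - eps)).+1) primeDev N q
       <= C * INR N / Rpower (ln (INR N)) A)%R.

Definition lambda_ap (y q a : nat) : R :=
  (\sum_(1 <= n < y.+1 | (n %% q)%N == a) liouville n)%R.

Definition liouvDev (N q : nat) : R :=
  (\big[Rmax/0%R]_(y < N.+1) \big[Rmax/0%R]_(a < q) Rabs (lambda_ap y q a))%R.

Definition condB (theta : R) : Prop :=
  forall eps A : R, (0 < eps)%R -> (0 < A)%R ->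
  exists C : R, exists N0 : nat, forall N : nat, (N0 <= N)%N -> (2 <= N)%N ->
    (\sum_(1 <= q < (qbound N (theta - eps)).+1) liouvDev N q
       <= C * INR N / Rpower (ln (INR N)) A)%R.

Definition primez (z : int) : bool := (0 < z)%R && prime.prime (absz z).

(* Main.v *)
(** A GPY sieve with elementary asymptotics.  For [n] in [(N, 2N]], [n = v mod W] with
    [W] the product of the primes up to a large constant, weigh [n] by
    [w(n) = (sum of lambda_d over squarefree d | (n+h_1)...(n+h_k))^2].  By (B), the
    function [lambda(n+r)] has negligible correlation with [w], so that
    [sum of w(n) (1 + lambda(n+r)) / 2] is only half of the total mass of [w].  By (A),
    [sum of w(n) theta(n+h_i)] is computed, and with the weights below it makes
      [sum of w(n) (sum_i theta(n+h_i) - log(3N) (1 + lambda(n+r)) / 2)]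
    positive.  A single [n] with positive bracket has a prime among the [n+h_i] if
    [lambda(n+r) = -1], and two primes if [lambda(n+r) = 1].

    After Selberg's diagonalisation, with [y_d = L + 2 be log(R/d)], [L = log R], both main
    terms are sums of nonnegative terms decreasing in [d].  Hence only one-sided bounds for
    sums of multiplicative functions are needed: the lower ones are exact inequalities in
    the style of Selberg, the upper ones come from the count of integers prime to [W], and
    both are raised to higher dimension by a convolution and a discrete integration. *)

Require Import Defs.
From Stdlib Require Import Reals.
From mathcomp Require Import all_boot all_order all_algebra.
From mathcomp Require Import Rstruct.
From mathcomp Require Import ring lra zify.
Set Implicit Arguments. Unset Strict Implicit. Unset Printing Implicit Defensive.
Import Order.TTheory GRing.Theory Num.Theory.
Local Open Scope ring_scope.

(** * Sums over squarefree integers *)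

(* A squarefree integer is a finite set of primes [A]: [lg A] is its logarithm, [wt a A] the
   value at it of the multiplicative function with values [a] at the primes, and [mom a n t]
   the sum of [wt a A * (t - lg A)^n] over the [A] with [lg A <= t]. *)
Section SetSums.
Variables (R : archiRealFieldType) (T : finType) (l : T -> R).

(** In the scaled variable x = log d / L, put F(x) = 1 + 2 be (1 - x). The mass of w is governed by
    I, the integral over [0, 1] of x^(k-1)/(k-1)! F(x)^2, and each prime sum by J, the integral of
    x^(k-2)/(k-2)! ((1-x) + be (1-x)^2)^2. As 2L is theta0 log N up to a constant, log(3N)/2 is
    about L/theta0, and positivity comes down to I/theta0 < k J, a rational inequality with a little
    slack for each of the four pairs. The obstacle is to reach these exact constants while W stays
    bounded. Each dimension brings a factor phi(W)/W into the upper and the lower bounds alike, and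
    these factors cancel exactly: N/W comes with the k-th power, N/phi(W) with the (k+1)-st. What is
    left over is an Euler product of factors 1 + O(1/p^2) over p > D0, brought close to 1 by fixing
    D0 large, and shifts of L by constants depending on D0, which are harmless once N grows. *)

Definition lg (A : {set T}) : R := \sum_(p in A) l p.
Definition wt (a : T -> R) (A : {set T}) : R := \prod_(p in A) a p.
(** The cut-off is closed: [ramp 0] is the indicator of [0 <= x], so sets with [lg A = t] count in
    [mom a 0 t]. *)
Definition ramp (n : nat) (x : R) : R := if 0 <= x then x ^+ n else 0.
Definition mom (a : T -> R) (n : nat) (t : R) : R :=
  \sum_(A : {set T}) wt a A * ramp n (t - lg A).
(** Moves a coprimality condition into the weight: a set meeting [V] gets weight 0, so a sum over
    sets disjoint from [V] is again a moment. *)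
Definition off (a : T -> R) (V : {set T}) (p : T) : R := if p \in V then 0 else a p.

Lemma wt_set0 a : wt a set0 = 1.
Proof. by rewrite /wt big_set0. Qed.

Lemma lg_set0 : lg set0 = 0.
Proof. by rewrite /lg big_set0. Qed.

Lemma eq_wt a b : a =1 b -> wt a =1 wt b.
Proof. by move=> ab A; apply: eq_bigr => p _; rewrite ab. Qed.

Lemma eq_in_wt a b (A : {set T}) : {in A, a =1 b} -> wt a A = wt b A.
Proof. by move=> ab; apply: eq_bigr => p /ab. Qed.

Lemma wtM a b A : wt (fun p => a p * b p) A = wt a A * wt b A.
Proof. by rewrite /wt big_split. Qed.

Lemma wt_ge0 a A : (forall p, 0 <= a p) -> 0 <= wt a A.
Proof. by move=> a0; apply: prodr_ge0. Qed.

Lemma wt_le a b A : (forall p, 0 <= a p <= b p) -> wt a A <= wt b A.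
Proof. by move=> ab; apply: ler_prod => p _; apply: ab. Qed.

Lemma wtU a (A B : {set T}) : [disjoint A & B] -> wt a (A :|: B) = wt a A * wt a B.
Proof.
by move=> dAB; rewrite /wt (eq_bigl [predU A & B]) ?bigU // => p; rewrite !inE.
Qed.

Lemma disjoint_setDr (A B : {set T}) : [disjoint A & B :\: A].
Proof. by apply/pred0P => p /=; rewrite !inE; case: (p \in A). Qed.

Lemma wtUI a (A B : {set T}) : wt a (A :|: B) * wt a (A :&: B) = wt a A * wt a B.
Proof.
have -> : A :|: B = A :|: (B :\: A).
  by apply/setP => p; rewrite !inE; case: (p \in A).
rewrite wtU ?disjoint_setDr //.
have {3}-> : B = (A :&: B) :|: (B :\: A).
  by apply/setP => p; rewrite !inE; case: (p \in A); case: (p \in B).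
rewrite [wt a (_ :|: _)]wtU; first by rewrite -mulrA [X in _ * X]mulrC.
by apply/pred0P => p /=; rewrite !inE; case: (p \in A); case: (p \in B).
Qed.

Lemma lgU (A B : {set T}) : [disjoint A & B] -> lg (A :|: B) = lg A + lg B.
Proof.
by move=> dAB; rewrite /lg (eq_bigl [predU A & B]) ?bigU // => p; rewrite !inE.
Qed.

Lemma wt_off a (V A : {set T}) :
  wt (off a V) A = if [disjoint V & A] then wt a A else 0.
Proof.
case: ifPn => [dVA | /pred0Pn[p /andP[/= pV pA]]].
  apply: eq_in_wt => p pA; rewrite /off; case: ifP => // pV.
  by move: dVA => /pred0P /(_ p) /=; rewrite pV pA.
by rewrite /wt (bigD1 p) //= /off pV mul0r.
Qed.

Lemma sum_superset (V : {set T}) (F : {set T} -> {set T} -> R) :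
  \sum_(U : {set T} | V \subset U) F (U :\: V) U =
  \sum_(A : {set T} | [disjoint V & A]) F A (V :|: A).
Proof.
rewrite (reindex_onto (fun A => V :|: A) (fun U => U :\: V)) /=; last first.
  by move=> U VU; rewrite -[X in X :|: _](setIidPr VU) setID.
apply: eq_big => A.
  rewrite subsetUl /= setDUl setDv set0U eq_sym eqEsubset subsetDl andbT.
  by rewrite subsetD subxx /= disjoint_sym.
by case/andP=> _ /eqP ->.
Qed.

Lemma wtD a b (U : {set T}) :
  wt (fun p => a p + b p) U = \sum_(V : {set T} | V \subset U) wt a V * wt b (U :\: V).
Proof.
pose F p := if p \in U then a p else 0; pose G p := if p \in U then b p else 1.
have -> : wt (fun p => a p + b p) U = \prod_p (F p + G p).
  rewrite /wt big_mkcond; apply: eq_bigr => p _; rewrite /F /G.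
  by case: ifP; rewrite // add0r.
rewrite bigA_distr [in RHS]big_mkcond /=; apply: eq_bigr => V _.
case: ifPn => [VU | /subsetPn[p pV pU]]; last first.
  by rewrite (bigD1 p) //= pV /F (negPf pU) mul0r.
rewrite (bigID (mem V)) /=; congr (_ * _).
  by apply: eq_bigr => p pV; rewrite pV /F (subsetP VU).
rewrite /wt [RHS]big_mkcond [LHS]big_mkcond; apply: eq_bigr => p _ /=.
by rewrite inE /G; case: (p \in V).
Qed.

(** Convolution of functions on squarefree integers: expanding the product splits [U] into a part
    [V] weighted by [a] and a disjoint part [A] weighted by [b]. *)
Lemma sum_wtD a b (F : {set T} -> R) :
  \sum_(U : {set T}) wt (fun p => a p + b p) U * F U =
  \sum_(V : {set T}) wt a V * \sum_(A : {set T}) wt (off b V) A * F (V :|: A).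
Proof.
under eq_bigr => U _ do rewrite wtD big_distrl big_mkcond /=.
rewrite exchange_big /=; apply: eq_bigr => V _.
rewrite -big_mkcond /=.
rewrite (sum_superset V (fun A U => wt a V * wt b A * F U)) big_mkcond big_distrr /=.
apply: eq_bigr => A _; rewrite wt_off; case: ifP => _; first by rewrite mulrA.
by rewrite mul0r mulr0.
Qed.

Lemma sum_wt_subset a (S : {set T}) :
  \sum_(A : {set T} | A \subset S) wt a A = \prod_(p in S) (1 + a p).
Proof.
under [RHS]eq_bigr => p _ do rewrite addrC.
rewrite -/(wt (fun p => a p + 1) S) wtD; apply: eq_bigr => A _.
by rewrite [X in _ * X]/wt big1 ?mulr1.
Qed.

Lemma sum_wt a : \sum_(A : {set T}) wt a A = \prod_p (1 + a p).
Proof.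
transitivity (\prod_(p in [set: T]) (1 + a p)); last by apply: eq_bigl => p; rewrite inE.
by rewrite -sum_wt_subset; apply: eq_bigl => A; rewrite subsetT.
Qed.

Lemma ramp_ge0 n x : 0 <= ramp n x.
Proof. by rewrite /ramp; case: ifP => // x0; rewrite exprn_ge0. Qed.

Lemma ramp_le n x y : x <= y -> ramp n x <= ramp n y.
Proof.
move=> xy; rewrite /ramp; case: ifP => x0; last by case: ifP => // ?; rewrite exprn_ge0.
by rewrite (le_trans x0 xy) lerXn2r // nnegrE // (le_trans x0).
Qed.

Lemma mom_ge0 a n t : (forall p, 0 <= a p) -> 0 <= mom a n t.
Proof. by move=> a0; apply: sumr_ge0 => A _; rewrite mulr_ge0 ?ramp_ge0 ?wt_ge0. Qed.

Lemma mom_le a b n t : (forall p, 0 <= a p <= b p) -> mom a n t <= mom b n t.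
Proof.
by move=> ab; apply: ler_sum => A _; rewrite ler_wpM2r ?ramp_ge0 ?wt_le.
Qed.

Lemma mom_le_arg a n s t : (forall p, 0 <= a p) -> s <= t -> mom a n s <= mom a n t.
Proof.
move=> a0 st; apply: ler_sum => A _; rewrite ler_wpM2l ?wt_ge0 ?ramp_le //.
by rewrite lerD2r.
Qed.

Lemma eq_mom a b n t : a =1 b -> mom a n t = mom b n t.
Proof. by move=> ab; apply: eq_bigr => A _; rewrite (eq_wt ab). Qed.

Lemma off_ge0 a V : (forall p, 0 <= a p) -> forall p, 0 <= off a V p.
Proof. by move=> a0 p; rewrite /off; case: ifP. Qed.

Lemma off_le a V : (forall p, 0 <= a p) -> forall p, 0 <= off a V p <= a p.
Proof. by move=> a0 p; rewrite off_ge0 //= /off; case: ifP. Qed.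

Lemma mom0D a b t :
  mom (fun p => a p + b p) 0 t =
  \sum_(V : {set T}) wt a V * mom (off b V) 0 (t - lg V).
Proof.
rewrite /mom sum_wtD; apply: eq_bigr => V _; congr (_ * _).
apply: eq_bigr => A _; rewrite wt_off; case: ifP => [dVA|_]; last by rewrite !mul0r.
by rewrite lgU // opprD addrA.
Qed.

Hypothesis l_ge0 : forall p, 0 <= l p.

Lemma lg_ge0 A : 0 <= lg A.
Proof. by apply: sumr_ge0 => p _. Qed.

Lemma lg_subset (A B : {set T}) : A \subset B -> lg A <= lg B.
Proof.
move=> AB; rewrite /lg [leLHS]big_mkcond [leRHS]big_mkcond; apply: ler_sum => p _.
by case: ifP => [/(subsetP AB) -> // |_]; case: ifP.
Qed.

Lemma lgU_le (A B : {set T}) : lg (A :|: B) <= lg A + lg B.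
Proof.
have -> : A :|: B = A :|: (B :\: A).
  by apply/setP => p; rewrite !inE; case: (p \in A).
by rewrite lgU ?disjoint_setDr // lerD2l lg_subset // subsetDl.
Qed.

Lemma mom_lt0 a n t : t < 0 -> mom a n t = 0.
Proof.
move=> t0; apply: big1 => A _; rewrite /ramp ifF ?mulr0 //; apply/negbTE.
by rewrite -ltNge; have := lg_ge0 A; lra.
Qed.

(* Sieving out one set of primes: both the inequality of Selberg and the upper bound in
   higher dimension are instances. *)
Lemma mom_removal a b t : (forall p, 0 <= a p) -> (forall p, 0 <= b p) ->
  mom (fun p => a p + b p) 0 t <= (\prod_p (1 + a p)) * mom b 0 t.
Proof.
move=> a0 b0; rewrite mom0D -sum_wt big_distrl /=; apply: ler_sum => V _.
rewrite ler_wpM2l ?wt_ge0 //; apply: le_trans (mom_le _ _ (off_le V b0)) _.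
by rewrite mom_le_arg // gerBl lg_ge0.
Qed.

(** Selberg's inequality: forbidding the primes of [V] loses at most their Euler factor. It is a
    removal in which [a] is the restriction of [b] to [V]. *)
Lemma mom_off_ge b V t : (forall p, 0 <= b p) ->
  mom b 0 t <= wt (fun p => 1 + b p) V * mom (off b V) 0 t.
Proof.
move=> b0; pose a p := if p \in V then b p else 0.
have -> : mom b 0 t = mom (fun p => a p + off b V p) 0 t.
  by apply: eq_mom => p; rewrite /a /off; case: ifP; rewrite ?addr0 ?add0r.
apply: le_trans (mom_removal _ _ (off_ge0 V b0)) _.
  by move=> p; rewrite /a; case: ifP.
suff -> : \prod_p (1 + a p) = wt (fun p => 1 + b p) V by [].
rewrite /wt [RHS]big_mkcond; apply: eq_bigr => p _; rewrite /a.
by case: ifP; rewrite ?addr0.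
Qed.

Lemma mom0D_le a b t : (forall p, 0 <= a p) -> (forall p, 0 <= b p) ->
  mom (fun p => a p + b p) 0 t <= \sum_(V : {set T}) wt a V * mom b 0 (t - lg V).
Proof.
move=> a0 b0; rewrite mom0D; apply: ler_sum => V _.
by rewrite ler_wpM2l ?wt_ge0 ?mom_le //; apply: off_le.
Qed.

(** Mean value theorem for a power with the derivative at the left end of the step; [exprDn_le] has
    it at the right end. The pair replaces calculus in the integrations below. *)
Lemma exprDn_ge (n : nat) (x h : R) : 0 <= x -> 0 <= h ->
  n.+1%:R * h * x ^+ n <= (x + h) ^+ n.+1 - x ^+ n.+1.
Proof.
move=> x0 h0; elim: n => [|n IH]; first by rewrite !expr1 expr0; lra.
have xn : 0 <= x ^+ n.+1 by rewrite exprn_ge0.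
have : (x + h) * (n.+1%:R * h * x ^+ n) <= (x + h) * ((x + h) ^+ n.+1 - x ^+ n.+1).
  by rewrite ler_wpM2l // addr_ge0.
rewrite [(x + h) ^+ n.+2]exprS [x ^+ n.+2]exprS -[n.+2%:R]natr1 => H.
have : 0 <= h * (n.+1%:R * h * x ^+ n) by rewrite !mulr_ge0 ?exprn_ge0.
move: H; rewrite mulrDl; have -> : x * (n.+1%:R * h * x ^+ n) = n.+1%:R * h * x ^+ n.+1.
  by rewrite exprS; ring.
move: (n.+1%:R * h * x ^+ n.+1) (h * _) ((x + h) ^+ n.+1) (x ^+ n.+1) xn => A B Z Y *.
nra.
Qed.

Lemma exprDn_le (n : nat) (x h : R) : 0 <= x -> 0 <= h ->
  (x + h) ^+ n.+1 - x ^+ n.+1 <= n.+1%:R * h * (x + h) ^+ n.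
Proof.
move=> x0 h0; elim: n => [|n IH]; first by rewrite !expr1 expr0; lra.
have xh0 : 0 <= x + h by rewrite addr_ge0.
have le : x ^+ n.+1 <= (x + h) ^+ n.+1 by rewrite lerXn2r ?nnegrE //; lra.
have : (x + h) * ((x + h) ^+ n.+1 - x ^+ n.+1) <= (x + h) * (n.+1%:R * h * (x + h) ^+ n).
  by rewrite ler_wpM2l.
have -> : (x + h) * (n.+1%:R * h * (x + h) ^+ n) = n.+1%:R * h * (x + h) ^+ n.+1.
  by rewrite [(x + h) ^+ n.+1]exprS; ring.
rewrite [(x + h) ^+ n.+2]exprS [x ^+ n.+2]exprS -[n.+2%:R]natr1.
move: ((x + h) ^+ n.+1) (x ^+ n.+1) le => Z Y le.
have -> : (n.+1%:R + 1) * h * Z = n.+1%:R * h * Z + h * Z by ring.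
move: (n.+1%:R * h * Z) => A; nra.
Qed.

Lemma ramp_step_ge n x h : 0 <= h ->
  n.+1%:R * h * ramp n x <= ramp n.+1 (x + h) - ramp n.+1 x.
Proof.
move=> h0; rewrite {1 3}/ramp; case: ifP => x0; last by rewrite mulr0 subr0 ramp_ge0.
by rewrite /ramp (addr_ge0 x0 h0) exprDn_ge.
Qed.

Lemma ramp_step_le n x h : 0 <= h ->
  ramp n.+1 (x + h) - ramp n.+1 x <= n.+1%:R * h * ramp n (x + h).
Proof.
move=> h0; rewrite /ramp; case: (leP 0 (x + h)) => xh; case: (leP 0 x) => x0.
- by rewrite exprDn_le.
(* The step crosses 0: since [x < 0], one factor [x + h] is at most [h]. *)
- rewrite subr0 exprS ler_wpM2r ?exprn_ge0 //.
  have : h <= n.+1%:R * h by rewrite ler_peMl // ler1n.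
  lra.
- by exfalso; lra.
- by rewrite subr0 mulr0.
Qed.

Lemma mom_step_ge a n t h : (forall p, 0 <= a p) -> 0 <= h ->
  n.+1%:R * h * mom a n t <= mom a n.+1 (t + h) - mom a n.+1 t.
Proof.
move=> a0 h0; rewrite /mom -sumrB big_distrr /=; apply: ler_sum => A _.
rewrite mulrCA -mulrBr ler_wpM2l ?wt_ge0 //.
by rewrite (addrAC t h) ramp_step_ge.
Qed.

Lemma mom_step_le a n t h : (forall p, 0 <= a p) -> 0 <= h ->
  mom a n.+1 (t + h) - mom a n.+1 t <= n.+1%:R * h * mom a n (t + h).
Proof.
move=> a0 h0; rewrite /mom -sumrB big_distrr /=; apply: ler_sum => A _.
rewrite mulrCA -mulrBr ler_wpM2l ?wt_ge0 //.
by rewrite (addrAC t h) ramp_step_le.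
Qed.

Lemma momS0 a n : mom a n.+1 0 = 0.
Proof.
apply: big1 => A _; rewrite /ramp sub0r oppr_ge0; case: ifP => [lA|]; rewrite ?mulr0 //.
have -> : lg A = 0 by apply/le_anti; rewrite lA lg_ge0.
by rewrite oppr0 expr0n mulr0.
Qed.

(* [mom a n.+1] is [n.+1] times the integral of [mom a n]; the next two lemmas bound it
   by comparing increments on a mesh. *)
Lemma mom_integrate_le a n m (K C t : R) : (forall p, 0 <= a p) ->
  0 <= K -> 0 <= C -> 0 <= t ->
  (forall s, 0 <= s -> mom a n s <= K * (s + C) ^+ m) ->
  mom a n.+1 t <= n.+1%:R / m.+1%:R * K * (t + (C + 1)) ^+ m.+1.
Proof.
move=> a0 K0 C0 t0 H; set c := n.+1%:R / m.+1%:R * K.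
have c0 : 0 <= c by rewrite !mulr_ge0 ?invr_ge0 ?ler0n.
pose M := (Num.bound t).+1; pose h := t / M%:R.
have M0 : 0 < M%:R :> R by rewrite ltr0n.
have h0 : 0 <= h by rewrite divr_ge0 // ltW.
have h1 : h <= 1.
  rewrite ler_pdivrMr // mul1r; apply: ltW; apply: lt_le_trans (archi_boundP t0) _.
  by rewrite ler_nat leqnSn.
(* Right endpoints overestimate the increments; advancing the argument by one more mesh length [h]
   absorbs this, and [h <= 1] turns [C] into [C + 1]. *)
have step (i : nat) : mom a n.+1 (i%:R * h) <= c * (i%:R * h + C + h) ^+ m.+1.
  elim: i => [|i IH].
    by rewrite mul0r momS0 mulr_ge0 // exprn_ge0 // add0r addr_ge0.
  have ih0 : 0 <= i%:R * h by rewrite mulr_ge0 ?ler0n.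
  have -> : i.+1%:R * h = i%:R * h + h by rewrite -natr1 mulrDl mul1r.
  have := mom_step_le n (i%:R * h) a0 h0.
  have : n.+1%:R * h * mom a n (i%:R * h + h) <=
         n.+1%:R * h * (K * (i%:R * h + h + C) ^+ m).
    by apply: ler_wpM2l; [rewrite mulr_ge0 ?ler0n | apply: H; rewrite addr_ge0].
  have x0 : 0 <= i%:R * h + h + C by rewrite !addr_ge0.
  have := exprDn_ge m x0 h0.
  move=> /(ler_wpM2l c0).
  have -> : c * (m.+1%:R * h * (i%:R * h + h + C) ^+ m) =
            n.+1%:R * h * (K * (i%:R * h + h + C) ^+ m).
    have m0 : m.+1%:R != 0 :> R by rewrite pnatr_eq0.
    by rewrite /c; move: (m.+1%:R) m0 => q q0; field.
  move: IH; have -> : i%:R * h + C + h = i%:R * h + h + C by ring.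
  rewrite mulrBr; lra.
have := step M; have -> : M%:R * h = t by rewrite /h mulrC divfK // gt_eqF.
move=> /le_trans; apply; rewrite ler_wpM2l // lerXn2r ?nnegrE //; lra.
Qed.

Lemma bernoulli_le (z : R) i : 0 <= z <= 1 -> 1 - i%:R * z <= (1 - z) ^+ i.
Proof.
move=> /andP[z0 z1]; elim: i => [|i IH]; first by rewrite expr0; lra.
rewrite exprS -natr1; have : (1 - z) * (1 - i%:R * z) <= (1 - z) * (1 - z) ^+ i.
  by rewrite ler_wpM2l //; lra.
have : 0 <= z * (i%:R * z) by rewrite !mulr_ge0 ?ler0n.
by lra.
Qed.

(** Passage to the limit over finer and finer meshes, without limits: by Bernoulli the factor is at
    least [1 - m / M], and [M] beyond [m y / (y - x)] would contradict [x < y]. *)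
Lemma le_of_le_mesh (x y : R) (m : nat) : 0 <= y ->
  (forall M : nat, (0 < M)%N -> y * (1 - M%:R^-1) ^+ m <= x) -> y <= x.
Proof.
move=> y0 H; rewrite leNgt; apply/negP => xy.
pose M := (Num.bound ((m%:R * y) / (y - x))).+1.
have d0 : 0 < y - x by lra.
have M0 : 0 < M%:R :> R by rewrite ltr0n.
have := H M isT; apply/negP; rewrite -ltNge.
apply: (@lt_le_trans _ _ (y * (1 - m%:R * M%:R^-1))); last first.
  rewrite ler_wpM2l // bernoulli_le // invr_ge0 ltW //= invf_le1 // ler1n //.
have : m%:R * y / (y - x) < M%:R.
  apply: lt_le_trans (archi_boundP _) _; last by rewrite ler_nat leqnSn.
  by rewrite divr_ge0 ?mulr_ge0 ?ler0n // ltW.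
rewrite ltr_pdivrMr // => H2.
have : m%:R * y / M%:R < y - x by rewrite ltr_pdivrMr // [ltRHS]mulrC.
have -> : y * (1 - m%:R * M%:R^-1) = y - m%:R * y / M%:R by ring.
lra.
Qed.

Lemma mom_integrate_ge a n m (K t : R) : (forall p, 0 <= a p) ->
  0 <= K -> 0 <= t ->
  (forall s, 0 <= s <= t -> K * s ^+ m <= mom a n s) ->
  n.+1%:R / m.+1%:R * K * t ^+ m.+1 <= mom a n.+1 t.
Proof.
move=> a0 K0 t0 H; set c := n.+1%:R / m.+1%:R * K.
have c0 : 0 <= c by rewrite !mulr_ge0 ?invr_ge0 ?ler0n.
apply: (@le_of_le_mesh _ _ m.+1); first by rewrite mulr_ge0 // exprn_ge0.
case=> // M _; set M1 := M.+1; pose h := t / M1%:R.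
have M0 : 0 < M1%:R :> R by rewrite ltr0n.
have h0 : 0 <= h by rewrite divr_ge0 // ltW.
have Mh : M1%:R * h = t by rewrite /h mulrC divfK // gt_eqF.
(* The bound lags one mesh behind the moment. At the last step this costs only the factor
   [(1 - 1/M)^(m+1)], so that, unlike the upper bound, the result carries no shift. *)
have step (i : nat) : (i <= M)%N -> c * (i%:R * h) ^+ m.+1 <= mom a n.+1 (i.+1%:R * h).
  elim: i => [_|i IH iM].
    by rewrite mul0r expr0n mulr0 mom_ge0.
  have ih0 : 0 <= i%:R * h by rewrite mulr_ge0 ?ler0n.
  have e1 : i.+1%:R * h = i%:R * h + h by rewrite -natr1 mulrDl mul1r.
  have e2 : i.+2%:R * h = i.+1%:R * h + h by rewrite -[i.+2%:R]natr1 mulrDl mul1r.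
  have := mom_step_ge n (i.+1%:R * h) a0 h0.
  have : n.+1%:R * h * (K * (i.+1%:R * h) ^+ m) <= n.+1%:R * h * mom a n (i.+1%:R * h).
    apply: ler_wpM2l; [by rewrite mulr_ge0 ?ler0n | apply: H].
    rewrite -Mh mulr_ge0 ?ler0n //=.
    by rewrite ler_wpM2r // ler_nat ltnS ltnW.
  have := exprDn_le m ih0 h0; rewrite -e1.
  move=> /(ler_wpM2l c0).
  have -> : c * (m.+1%:R * h * (i.+1%:R * h) ^+ m) =
            n.+1%:R * h * (K * (i.+1%:R * h) ^+ m).
    have m0 : m.+1%:R != 0 :> R by rewrite pnatr_eq0.
    by rewrite /c; move: (m.+1%:R) m0 => q q0; field.
  have := IH (ltnW iM); rewrite e2 mulrBr; lra.
have := step M (leqnn _); rewrite Mh => /(le_trans _); apply.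
rewrite -mulrA -exprMn.
have -> : t * (1 - M1%:R^-1) = M%:R * h.
  have -> : M%:R = M1%:R - 1 :> R by rewrite /M1 -natr1 addrK.
  by rewrite /h; field; rewrite gt_eqF.
by [].
Qed.

End SetSums.

(** * Diagonalisation of the quadratic form *)

Section Diagonalisation.
Variables (R : archiRealFieldType) (T : finType).

Lemma sum_interval (c : T -> R) (A U : {set T}) : A \subset U ->
  \sum_(D : {set T} | (A \subset D) && (D \subset U)) wt c D =
  wt c A * wt (fun p => 1 + c p) (U :\: A).
Proof.
move=> AU; rewrite [wt (fun p => 1 + c p) _]/wt -sum_wt_subset big_distrr /= big_mkcondr /=.
rewrite (sum_superset A (fun B D => if D \subset U then wt c D else 0)).
rewrite big_mkcond [RHS]big_mkcond /=; apply: eq_bigr => B _.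
rewrite subUset AU /= subsetD disjoint_sym andbC.
by case: ifP => // dAB /=; case: ifP => // _; rewrite wtU // disjoint_sym.
Qed.

(** Selberg's diagonalisation: [wt g (D :|: E)] is [wt g D * wt g E] divided by [wt g (D :&: E)],
    and expanding 1/g = 1 + (1/g - 1) writes the reciprocal as a sum over the common subsets [A],
    which separates [D] from [E]. *)
Lemma quad_diag (g : T -> R) (x : {set T} -> R) : (forall p, g p != 0) ->
  \sum_(D : {set T}) \sum_(E : {set T}) x D * x E * wt g (D :|: E) =
  \sum_(A : {set T}) wt (fun p => (g p)^-1 - 1) A *
     (\sum_(D : {set T} | A \subset D) wt g D * x D) ^+ 2.
Proof.
move=> g0; have wg0 A : wt g A != 0 by apply/prodf_neq0 => p _.
have key D E : wt g (D :|: E) = wt g D * wt g E *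
    \sum_(A : {set T} | A \subset D :&: E) wt (fun p => (g p)^-1 - 1) A.
  apply: (mulIf (wg0 (D :&: E))); rewrite wtUI -[RHS]mulrA sum_wt_subset -[LHS]mulr1.
  congr (_ * _); rewrite mulrC /wt -big_split /= big1 // => p _.
  by rewrite addrC subrK mulfV.
transitivity (\sum_(D : {set T}) \sum_(E : {set T}) \sum_(A : {set T})
   if (A \subset D) && (A \subset E) then
     wt (fun p => (g p)^-1 - 1) A * ((wt g D * x D) * (wt g E * x E)) else 0).
  apply: eq_bigr => D _; apply: eq_bigr => E _.
  rewrite key !big_distrr big_mkcond /=; apply: eq_bigr => A _.
  by rewrite subsetI; case: ifP => // _; ring.
under eq_bigr => D _ do rewrite exchange_big /=.
rewrite exchange_big /=; apply: eq_bigr => A _.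
rewrite expr2 big_distrlr big_distrr [RHS]big_mkcond /=; apply: eq_bigr => D _.
case: ifP => AD; last by rewrite big1.
by rewrite big_distrr [RHS]big_mkcond /=; apply: eq_bigr => E _; case: ifP.
Qed.

(** For [c = -1] only [V = set0] survives on the right and this is Möbius inversion. General [c] is
    needed when coefficients adapted to one density are put into the form of another. *)
Lemma sum_above (c h : T -> R) (y : {set T} -> R) (A : {set T}) :
  \sum_(D : {set T} | A \subset D) wt c D * \sum_(U : {set T} | D \subset U) y U * wt h U =
  wt c A * wt h A *
  \sum_(V : {set T}) wt (off (fun p => h p * (1 + c p)) A) V * y (A :|: V).
Proof.
transitivity (\sum_(U : {set T} | A \subset U) y U * wt h U *
    \sum_(D : {set T} | (A \subset D) && (D \subset U)) wt c D).
  rewrite (eq_bigr (fun D : {set T} => \sum_(U : {set T} | D \subset U) wt c D * (y U * wt h U)));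
    last by move=> D _; rewrite big_distrr.
  rewrite (exchange_big_dep (fun U : {set T} => A \subset U)) /=; last first.
    by move=> D U AD DU; apply: subset_trans DU.
  by apply: eq_bigr => U AU; rewrite big_distrr; apply: eq_bigr => D _; rewrite mulrC.
transitivity (\sum_(U : {set T} | A \subset U)
   y U * wt h U * (wt c A * wt (fun p => 1 + c p) (U :\: A))).
  by apply: eq_bigr => U AU; rewrite sum_interval.
rewrite (sum_superset A
  (fun V U => y U * wt h U * (wt c A * wt (fun p => 1 + c p) V))).
rewrite big_mkcond big_distrr /=; apply: eq_bigr => V _.
rewrite wt_off; case: ifP => [dAV|_]; last by rewrite mul0r mulr0.
rewrite wtU // wtM; ring.
Qed.

(* The sieve coefficients as functions of the diagonal variables [y]. *)
Definition selberg (g h : T -> R) (y : {set T} -> R) (D : {set T}) : R :=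
  wt (fun p => - (g p)^-1) D * \sum_(U : {set T} | D \subset U) y U * wt h U.

(** Coefficients built for the density [g1] are evaluated in the form of the density [g2]. The
    diagonal variable at [A] becomes a weighted sum of [y] over the supersets of [A]: this is how
    the prime sums see the weights. *)
Lemma selberg_form (g1 g2 h : T -> R) (y : {set T} -> R) :
  (forall p, g1 p != 0) -> (forall p, g2 p != 0) ->
  \sum_(D : {set T}) \sum_(E : {set T})
     selberg g1 h y D * selberg g1 h y E * wt g2 (D :|: E) =
  \sum_(A : {set T}) wt (fun p => ((g2 p)^-1 - 1) * (g2 p / g1 p * h p) ^+ 2) A *
     (\sum_(V : {set T}) wt (off (fun p => h p * (1 - g2 p / g1 p)) A) V * y (A :|: V)) ^+ 2.
Proof.
move=> g10 g20; rewrite quad_diag //; apply: eq_bigr => A _.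
have -> : \sum_(D : {set T} | A \subset D) wt g2 D * selberg g1 h y D =
  \sum_(D : {set T} | A \subset D) wt (fun p => - (g2 p / g1 p)) D *
     \sum_(U : {set T} | D \subset U) y U * wt h U.
  apply: eq_bigr => D _; rewrite /selberg mulrA -wtM; congr (_ * _).
  by apply: eq_wt => p; rewrite mulrN.
rewrite sum_above exprMn mulrA; congr (_ * _).
by rewrite expr2 -!wtM; apply: eq_wt => p; ring.
Qed.

(** With equal densities the weight of every nonempty [V] is 0, so the variables [y] themselves are
    diagonal. The condition on [h] says that [h] is [g / (1 - g)] or 0. *)
Lemma selberg_form_diag (g h : T -> R) (y : {set T} -> R) :
  (forall p, g p != 0) -> (forall p, ((g p)^-1 - 1) * h p ^+ 2 = h p) ->
  \sum_(D : {set T}) \sum_(E : {set T})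
     selberg g h y D * selberg g h y E * wt g (D :|: E) =
  \sum_(A : {set T}) wt h A * y A ^+ 2.
Proof.
move=> g0 gh; rewrite selberg_form //; apply: eq_bigr => A _; congr (_ * _).
  by apply: eq_wt => p; rewrite divff // mul1r.
congr (_ ^+ 2); rewrite (bigD1 set0) //= wt_set0 mul1r setU0 big1 ?addr0 // => V V0.
have /set0Pn[p pV] := V0.
by rewrite /wt (bigD1 p) //= /off divff // subrr mulr0; case: ifP; rewrite !mul0r.
Qed.

End Diagonalisation.

(** * Moments in higher dimension *)

Section Moments.
Variables (R : archiRealFieldType) (T : finType) (l : T -> R).
Hypothesis l_ge0 : forall p, 0 <= l p.
Local Notation lg := (lg l).
Local Notation mom := (mom l).

Lemma mom0_ge1 (a : T -> R) t : (forall p, 0 <= a p) -> 0 <= t -> 1 <= mom a 0 t.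
Proof.
move=> a0 t0; rewrite /mom (bigD1 set0) //= wt_set0 lg_set0 subr0 mul1r {1}/ramp t0 expr0.
by rewrite lerDl; apply: sumr_ge0 => A _; rewrite mulr_ge0 ?ramp_ge0 ?wt_ge0.
Qed.

(* The weight [(1 + b)^j - 1] at [p] belongs to the [j]-th power of the Dirichlet series with
   local factors [1 + b]. *)
Lemma mom_pow_ge (b : T -> R) (kap L : R) : (forall p, 0 <= b p) -> 0 <= kap ->
  (forall s, 0 <= s <= L -> kap * s <= mom b 0 s) ->
  forall (j : nat) t, 0 <= t <= L ->
  kap ^+ j / (j`!)%:R * t ^+ j <= mom (fun p => (1 + b p) ^+ j - 1) 0 t.
Proof.
move=> b0 k0 H; have aj0 j p : 0 <= (1 + b p) ^+ j - 1.
  by rewrite subr_ge0 exprn_ege1 // lerDl.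
elim=> [|j IH] t /andP[t0 tL].
  by rewrite !expr0 fact0 divr1 mulr1 mom0_ge1 // => p; rewrite subrr.
(* (1+b)^(j+1) - 1 = ((1+b)^j - 1)(1+b) + b. The factor [1 + b p] pays exactly for the Euler factor
   lost in [mom_off_ge], so the induction loses no constant; this is why the weight is not simply
   [j * b]. *)
pose a p := ((1 + b p) ^+ j - 1) * (1 + b p).
have a0 p : 0 <= a p by rewrite mulr_ge0 // addr_ge0.
have -> : mom (fun p => (1 + b p) ^+ j.+1 - 1) 0 t = mom (fun p => a p + b p) 0 t.
  by apply: eq_mom => p; rewrite /a exprSr; ring.
rewrite mom0D.
apply: (@le_trans _ _ (kap * mom (fun p => (1 + b p) ^+ j - 1) 1 t)).
  have K0 : 0 <= kap ^+ j / (j`!)%:R by rewrite divr_ge0 ?exprn_ge0 ?ler0n.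
  have IH' s : 0 <= s <= t -> kap ^+ j / (j`!)%:R * s ^+ j <=
      mom (fun p => (1 + b p) ^+ j - 1) 0 s.
    by move=> /andP[s0 st]; apply: IH; rewrite s0 (le_trans st).
  have := mom_integrate_ge (aj0 j) K0 t0 IH'.
  move=> /(ler_wpM2l k0); apply: le_trans.
  rewrite factS natrM exprS.
  have j0 : j.+1%:R != 0 :> R by rewrite pnatr_eq0.
  have f0 : (j`!)%:R != 0 :> R by rewrite pnatr_eq0 -lt0n fact_gt0.
  move: (j.+1%:R) (j`!%:R) (t ^+ j.+1) j0 f0 => u v w u0 v0.
  suff -> : kap * kap ^+ j / (u * v) * w = kap * (1 / u * (kap ^+ j / v) * w) by [].
  by field; rewrite ?u0 ?v0.
rewrite /mom big_distrr /=; apply: ler_sum => V _.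
have w0 : 0 < wt (fun p => 1 + b p) V.
  by apply: prodr_gt0 => p _; rewrite ltr_pwDl.
rewrite wtM mulrCA -mulrA ler_wpM2l ?wt_ge0 //.
rewrite {1}/ramp; case: ifP => s0; last by rewrite mulr0 mulr_ge0 ?mom_ge0 // ?ltW //; exact: off_ge0.
apply: le_trans (mom_off_ge l_ge0 V _ b0); rewrite expr1 H // s0 /=.
by have := lg_ge0 l_ge0 V; lra.
Qed.

(** Repeated integration of s^j/j!, which gives t^(n+j)/(n+j)!; the factor [n!] comes from the
    normalisation of [mom]. *)
Lemma mom_raise_ge (a : T -> R) (j : nat) (K L : R) : (forall p, 0 <= a p) -> 0 <= K ->
  (forall s, 0 <= s <= L -> K / (j`!)%:R * s ^+ j <= mom a 0 s) ->
  forall (n : nat) t, 0 <= t <= L ->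
  K * (n`!)%:R / ((n + j)`!)%:R * t ^+ (n + j) <= mom a n t.
Proof.
move=> a0 K0 H; elim=> [|n IH] t /andP[t0 tL].
  by rewrite fact0 mulr1 add0n H // t0.
have K1 : 0 <= K * (n`!)%:R / ((n + j)`!)%:R by rewrite !mulr_ge0 ?invr_ge0 ?ler0n.
have IH' s : 0 <= s <= t -> K * (n`!)%:R / ((n + j)`!)%:R * s ^+ (n + j) <= mom a n s.
  by move=> /andP[s0 st]; apply: IH; rewrite s0 (le_trans st).
have := mom_integrate_ge a0 K1 t0 IH'; apply: le_trans.
rewrite addSn !factS !natrM.
have f0 : ((n + j)`!)%:R != 0 :> R by rewrite pnatr_eq0 -lt0n fact_gt0.
have n0 : (n + j).+1%:R != 0 :> R by rewrite pnatr_eq0.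
move: ((n + j).+1%:R) ((n + j)`!%:R) (t ^+ _) (n.+1%:R) n0 f0 => u v w z u0 v0.
suff -> : K * (z * (n`!)%:R) / (u * v) * w = z / u * (K * (n`!)%:R / v) * w by [].
by field; rewrite ?u0 ?v0.
Qed.

(** Here every integration enlarges the shift by 1, hence [C + n]. *)
Lemma mom_raise_le (a : T -> R) (j : nat) (K C : R) : (forall p, 0 <= a p) -> 0 <= K ->
  0 <= C -> (forall s, 0 <= s -> mom a 0 s <= K / (j`!)%:R * (s + C) ^+ j) ->
  forall (n : nat) t, 0 <= t ->
  mom a n t <= K * (n`!)%:R / ((n + j)`!)%:R * (t + (C + n%:R)) ^+ (n + j).
Proof.
move=> a0 K0 C0 H; elim=> [|n IH] t t0.
  by rewrite fact0 mulr1 add0n addr0 H.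
have K1 : 0 <= K * (n`!)%:R / ((n + j)`!)%:R by rewrite !mulr_ge0 ?invr_ge0 ?ler0n.
have C1 : 0 <= C + n%:R by rewrite addr_ge0 ?ler0n.
have := mom_integrate_le l_ge0 a0 K1 C1 t0 IH => /le_trans; apply.
rewrite addSn !factS !natrM.
have -> : t + (C + n.+1%:R) = t + (C + n%:R + 1) by rewrite -natr1 (addrA C).
have f0 : ((n + j)`!)%:R != 0 :> R by rewrite pnatr_eq0 -lt0n fact_gt0.
have n0 : (n + j).+1%:R != 0 :> R by rewrite pnatr_eq0.
move: ((n + j).+1%:R) ((n + j)`!%:R) (_ ^+ (n + j).+1) (n.+1%:R) n0 f0 => u v w z u0 v0.
suff -> : K * (z * (n`!)%:R) / (u * v) * w = z / u * (K * (n`!)%:R / v) * w by [].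
by field; rewrite ?u0 ?v0.
Qed.

(** Adding one copy of [b] and forgetting disjointness integrates the previous bound. Each dimension
    shifts the argument by [C] from the hypothesis and by 1 from the mesh. *)
Lemma mom_mul_le (b : T -> R) (kap C : R) : (forall p, 0 <= b p) -> 0 <= kap -> 0 <= C ->
  (forall s, 0 <= s -> mom b 0 s <= kap * (s + C)) ->
  forall (j : nat) t, 0 <= t ->
  mom (fun p => j%:R * b p) 0 t <= kap ^+ j / (j`!)%:R * (t + j%:R * (C + 1)) ^+ j.
Proof.
move=> b0 k0 C0 H; elim=> [|j IH] t t0.
  rewrite !expr0 fact0 divr1 mulr1 /mom (bigD1 set0) //= wt_set0 lg_set0 subr0 mul1r.
  rewrite /ramp t0 expr0 big1 ?addr0 // => A /set0Pn[p pA].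
  by rewrite /wt (bigD1 p) //= mul0r !mul0r.
have jb0 p : 0 <= j%:R * b p by rewrite mulr_ge0 ?ler0n.
have -> : mom (fun p => j.+1%:R * b p) 0 t = mom (fun p => j%:R * b p + b p) 0 t.
  by apply: eq_mom => p; rewrite -natr1 mulrDl mul1r.
apply: le_trans (mom0D_le _ _ jb0 b0) _.
set Cj := j%:R * (C + 1); have Cj0 : 0 <= Cj by rewrite mulr_ge0 ?ler0n // addr_ge0.
set K := kap ^+ j / (j`!)%:R.
have K0 : 0 <= K by rewrite divr_ge0 ?exprn_ge0 ?ler0n.
apply: (@le_trans _ _ (kap * (mom (fun p => j%:R * b p) 1 t +
                              C * mom (fun p => j%:R * b p) 0 t))).
  have momE n : mom (fun p => j%:R * b p) n t =
      \sum_(V : {set T}) wt (fun p => j%:R * b p) V * ramp n (t - lg V) by [].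
  rewrite !momE !big_distrr -big_split big_distrr /=; apply: ler_sum => V _.
  have -> : kap * (wt (fun p => j%:R * b p) V * ramp 1 (t - lg V) +
      C * (wt (fun p => j%:R * b p) V * ramp 0 (t - lg V))) =
      wt (fun p => j%:R * b p) V * (kap * (ramp 1 (t - lg V) + C * ramp 0 (t - lg V))).
    by ring.
  apply: ler_wpM2l; first by rewrite wt_ge0.
  rewrite /ramp; case: (leP 0 (t - lg V)) => s0; last by rewrite (mom_lt0 l_ge0) // mulr0 addr0 mulr0.
  by rewrite expr1 expr0 mulr1 H.
have M1 := mom_integrate_le l_ge0 jb0 K0 Cj0 t0 IH.
have M0 := IH t t0.
apply: (@le_trans _ _ (kap * (1 / j.+1%:R * K * (t + (Cj + 1)) ^+ j.+1 +
                              C * (K * (t + Cj) ^+ j)))).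
  by rewrite ler_wpM2l // lerD // ler_wpM2l.
have x0 : 0 <= t + (Cj + 1) by rewrite !addr_ge0.
have := exprDn_ge j x0 C0.
have -> : t + (Cj + 1) + C = t + j.+1%:R * (C + 1) by rewrite /Cj -natr1; ring.
have le : (t + Cj) ^+ j <= (t + (Cj + 1)) ^+ j.
  by rewrite lerXn2r ?nnegrE ?addr_ge0 // addrA lerDl.
move: (t + (Cj + 1)) (t + j.+1%:R * (C + 1)) ((t + Cj) ^+ j) le => X Y Z le H1.
have j0 : j.+1%:R != 0 :> R by rewrite pnatr_eq0.
have jp : 0 < j.+1%:R :> R by rewrite ltr0n.
have -> : kap ^+ j.+1 / (j.+1`!)%:R * Y ^+ j.+1 = kap * (1 / j.+1%:R * K * Y ^+ j.+1).
  rewrite /K factS natrM exprS.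
  have f0 : (j`!)%:R != 0 :> R by rewrite pnatr_eq0 -lt0n fact_gt0.
  by move: (j.+1%:R) (j`!%:R) (Y ^+ j.+1) j0 f0 => u v w u0 v0; field; rewrite ?u0 ?v0.
rewrite ler_wpM2l //.
have -> : C * (K * Z) = 1 / j.+1%:R * K * (j.+1%:R * C * Z).
  by move: (j.+1%:R) j0 => u u0; field.
rewrite -mulrDr; apply: ler_wpM2l; first by rewrite mulr_ge0 // divr_ge0 ?ler01 ?ler0n.
have : j.+1%:R * C * Z <= j.+1%:R * C * X ^+ j by rewrite ler_wpM2l // mulr_ge0 // ltW.
lra.
Qed.

(** The variables y_d, cut off beyond R. The 2 is there because [y] enters the prime sums integrated
    once, as [L x + be x^2]. *)
Definition gpy (L be : R) (U : {set T}) : R :=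
  L * ramp 0 (L - lg U) + 2 * be * ramp 1 (L - lg U).

Lemma sum_gpy_sq (h : T -> R) L be :
  \sum_(A : {set T}) wt h A * gpy L be A ^+ 2 =
  L ^+ 2 * mom h 0 L + 4 * be * L * mom h 1 L + 4 * be ^+ 2 * mom h 2 L.
Proof.
rewrite /mom !big_distrr -!big_split /=; apply: eq_bigr => A _.
rewrite /gpy /ramp; case: ifP => _; rewrite ?expr0; ring.
Qed.

(** With [q] the product of [1 + b] over [A] and [x = L - lg A], Selberg's inequality and one
    integration bound the inner sum below by [kap / q * (L x + be x^2)]. The [(1 + b)^2] in the
    diagonal coefficient cancels [q^2], and the square of [L x + be x^2] yields the moments of order
    2, 3 and 4. *)
Lemma selberg_form_ge (g1 g2 h b w : T -> R) (kap L be : R) :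
  (forall p, g1 p != 0) -> (forall p, g2 p != 0) ->
  (forall p, h p * (1 - g2 p / g1 p) = b p) -> (forall p, 0 <= b p) ->
  (forall p, 0 <= w p) -> 0 <= kap -> 0 <= L -> 0 <= be ->
  (forall p, ((g2 p)^-1 - 1) * (g2 p / g1 p * h p) ^+ 2 = w p * (1 + b p) ^+ 2) ->
  (forall s, 0 <= s <= L -> kap * s <= mom b 0 s) ->
  kap ^+ 2 * (L ^+ 2 * mom w 2 L + 2 * be * L * mom w 3 L + be ^+ 2 * mom w 4 L) <=
  \sum_(D : {set T}) \sum_(E : {set T})
     selberg g1 h (gpy L be) D * selberg g1 h (gpy L be) E * wt g2 (D :|: E).
Proof.
move=> g10 g20 hb b0 w0 k0 L0 be0 hw H; rewrite selberg_form //.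
rewrite /mom !big_distrr -!big_split big_distrr /=; apply: ler_sum => A _.
rewrite (eq_wt hw) wtM -(mulrA (wt w A)).
set x := L - lg A.
have -> : kap ^+ 2 * (L ^+ 2 * (wt w A * ramp 2 x) + 2 * be * L * (wt w A * ramp 3 x) +
    be ^+ 2 * (wt w A * ramp 4 x)) = wt w A * (kap * (L * ramp 1 x + be * ramp 2 x)) ^+ 2.
  by rewrite /ramp; case: ifP => _; ring.
apply: ler_wpM2l; first by rewrite wt_ge0.
set q := wt (fun p => 1 + b p) A.
have -> : wt (fun p => (1 + b p) ^+ 2) A = q ^+ 2.
  by rewrite expr2 -wtM; apply: eq_wt => p; rewrite expr2.
have q0 : 0 < q by apply: prodr_gt0 => p _; rewrite ltr_pwDl.
set S := \sum_V _.
have -> : S = L * mom (off b A) 0 x + 2 * be * mom (off b A) 1 x.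
  rewrite /S /mom !big_distrr -big_split /=; apply: eq_bigr => V _.
  have -> : wt (off (fun p => h p * (1 - g2 p / g1 p)) A) V = wt (off b A) V.
    by apply: eq_wt => p; rewrite /off hb.
  rewrite wt_off; case: ifP => dAV; last by rewrite !mul0r !mulr0 addr0.
  rewrite /gpy lgU // opprD addrA -/x; ring.
have m0 n : 0 <= mom (off b A) n x by apply: mom_ge0; apply: off_ge0.
rewrite -exprMn; apply: lerXn2r.
- by rewrite nnegrE mulr_ge0 // addr_ge0 // mulr_ge0 // ramp_ge0.
- by rewrite nnegrE mulr_ge0 ?(ltW q0) // addr_ge0 // !mulr_ge0.
rewrite {1 2}/ramp; case: (leP 0 x) => x0; last first.
  by rewrite !mulr0 addr0 mulr0 mulr_ge0 ?(ltW q0) // addr_ge0 // !mulr_ge0.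
have xL : x <= L by rewrite /x gerBl lg_ge0.
have lo s : 0 <= s <= x -> kap / q * s ^+ 1 <= mom (off b A) 0 s.
  move=> /andP[s0 sx]; rewrite expr1 mulrAC ler_pdivrMr // [leRHS]mulrC.
  by apply: le_trans (mom_off_ge l_ge0 A s b0); apply: H; rewrite s0 (le_trans sx).
have kq0 : 0 <= kap / q by rewrite divr_ge0 // ltW.
have l1 := mom_integrate_ge (off_ge0 A b0) kq0 x0 lo.
have l0 : kap / q * x ^+ 1 <= mom (off b A) 0 x by apply: lo; rewrite x0 lexx.
have : q * (L * (kap / q * x ^+ 1) + 2 * be * (1 / 2 * (kap / q) * x ^+ 2)) <=
       q * (L * mom (off b A) 0 x + 2 * be * mom (off b A) 1 x).
  by rewrite ler_wpM2l ?(ltW q0) // lerD // ler_wpM2l // mulr_ge0.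
apply: le_trans; rewrite le_eqVlt; apply/orP; left; apply/eqP.
by field; rewrite gt_eqF.
Qed.

(** A crude bound, for error terms only: writing the supersets of [D] as [D :|: V] leaves [wt h D]
    times a full moment, and each prime of [D] costs [h / g <= 2]. *)
Lemma selberg_abs (g h : T -> R) (L be : R) (D : {set T}) :
  (forall p, 0 < g p) -> (forall p, 0 <= h p) -> (forall p, h p / g p <= 2) ->
  0 <= L -> 0 <= be ->
  `|selberg g h (gpy L be) D| <= 2 ^+ #|D| * ((1 + 2 * be) * L * mom h 0 L).
Proof.
move=> g0 h0 hg L0 be0.
have gp0 U : 0 <= gpy L be U by rewrite addr_ge0 // !mulr_ge0 // ramp_ge0.
have gpu U : gpy L be U <= (1 + 2 * be) * L * ramp 0 (L - lg U).
  rewrite /gpy /ramp; case: ifP => H; rewrite ?mulr0 ?addr0 // expr0 expr1 !mulr1.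
  have : be * (L - lg U) <= be * L by rewrite ler_wpM2l // gerBl lg_ge0.
  by lra.
rewrite /selberg normrM /wt normr_prod.
under eq_bigr => p _ do rewrite normrN normfV (gtr0_norm (g0 p)).
rewrite -/(wt (fun p => (g p)^-1) D) ger0_norm; last first.
  by apply: sumr_ge0 => U _; rewrite mulr_ge0 // wt_ge0.
rewrite (sum_superset D (fun V U => gpy L be U * wt h U)).
apply: (@le_trans _ _ (wt (fun p => h p / g p) D * ((1 + 2 * be) * L * mom h 0 L))).
  have -> : wt (fun p => h p / g p) D = wt (fun p => (g p)^-1) D * wt h D.
    by rewrite -wtM; apply: eq_wt => p; rewrite mulrC.
  rewrite -mulrA ler_wpM2l ?wt_ge0 // => [p|]; first by rewrite invr_ge0 ltW.
  rewrite big_mkcond /mom !big_distrr /=; apply: ler_sum => V _.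
  case: ifP => dDV; last by rewrite !mulr_ge0 ?addr_ge0 ?mulr_ge0 ?wt_ge0 ?ramp_ge0.
  rewrite wtU // mulrCA ler_wpM2l ?wt_ge0 // mulrC.
  rewrite -[leRHS]mulrCA ler_wpM2l ?wt_ge0 //.
  apply: le_trans (gpu _) _; rewrite ler_wpM2l ?mulr_ge0 ?addr_ge0 ?mulr_ge0 //.
  by rewrite ramp_le // lerD2l lerN2 lg_subset // subsetUr.
rewrite ler_wpM2r ?mulr_ge0 ?addr_ge0 ?mulr_ge0 ?mom_ge0 //.
rewrite -prodr_const; apply: ler_prod => p _; rewrite hg andbT.
by rewrite divr_ge0 // ltW.
Qed.

Lemma selberg_eq0 (g h : T -> R) (L be : R) (D : {set T}) :
  (L < lg D) || [exists p in D, h p == 0] -> selberg g h (gpy L be) D = 0.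
Proof.
move=> H; rewrite /selberg big1 ?mulr0 // => U DU; case/orP: H => [LD|/exists_inP[p pD /eqP hp]].
  have LU : L - lg U < 0 by have := lg_subset l_ge0 DU; lra.
  by rewrite /gpy /ramp leNgt LU /= !mulr0 addr0 mul0r.
by rewrite [wt _ U]/wt (bigD1 p) ?(subsetP DU) //= hp mul0r mulr0.
Qed.

End Moments.

(** * Logarithms and primes *)

(* Real arguments are otherwise parsed with the operations of the standard library. *)
Bind Scope ring_scope with Rdefinitions.R.
Arguments ln _%_R.
Arguments exp _%_R.

Section RealLog.
Implicit Types x y : R.

Lemma lnM x y : 0 < x -> 0 < y -> ln (x * y) = ln x + ln y.
Proof. by move=> /RltP x0 /RltP y0; apply: ln_mult. Qed.

Lemma ler_ln x y : 0 < x -> x <= y -> ln x <= ln y.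
Proof.
move=> x0; rewrite le_eqVlt => /orP[/eqP -> //|xy].
by apply/ltW/RltP/ln_increasing; apply/RltP.
Qed.

Lemma ln_R1 : ln 1 = 0. Proof. exact: ln_1. Qed.

Lemma ln_ge0 x : 1 <= x -> 0 <= ln x.
Proof. by move=> x1; rewrite -ln_R1 ler_ln. Qed.

Lemma expK x : ln (exp x) = x. Proof. exact: ln_exp. Qed.

Lemma lnK x : 0 < x -> exp (ln x) = x. Proof. by move=> /RltP; apply: exp_ln. Qed.

Lemma expR_gt0 x : 0 < exp x. Proof. by apply/RltP; apply: exp_pos. Qed.

Lemma ler_exp x y : x <= y -> exp x <= exp y.
Proof.
rewrite le_eqVlt => /orP[/eqP -> //|xy].
by apply/ltW/RltP/exp_increasing; apply/RltP.
Qed.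

Lemma expD x y : exp (x + y) = exp x * exp y. Proof. exact: exp_plus. Qed.

Lemma exp_ge1 x : 0 <= x -> 1 <= exp x.
Proof. by move=> x0; rewrite -[leLHS]exp_0; apply: ler_exp. Qed.

Lemma ln_le_sub1 x : 0 < x -> ln x <= x - 1.
Proof.
move=> x0; rewrite lerBrDl -[leRHS]lnK //.
by apply/RleP; apply: exp_ineq1_le.
Qed.

Lemma ln_succ_le n : (0 < n)%N -> ln n.+1%:R - ln n%:R <= (n%:R : R)^-1.
Proof.
move=> n0; have np : 0 < n%:R :> R by rewrite ltr0n.
have -> : n.+1%:R = n%:R * (1 + n%:R^-1) :> R by rewrite mulrDr mulr1 mulfV ?gt_eqF // natr1.
rewrite lnM ?addr_gt0 ?invr_gt0 //.
have : 0 < 1 + n%:R^-1 :> R by rewrite addr_gt0 ?invr_gt0.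
by move=> /ln_le_sub1; lra.
Qed.

Lemma ln_succ_ge n : (0 < n)%N -> (n.+1%:R : R)^-1 <= ln n.+1%:R - ln n%:R.
Proof.
move=> n0; have np : 0 < n%:R :> R by rewrite ltr0n.
have sp : 0 < n.+1%:R :> R by rewrite ltr0n.
have e : n%:R = n.+1%:R * (1 - n.+1%:R^-1) :> R.
  by rewrite mulrBr mulr1 mulfV ?gt_eqF // -natr1 addrK.
have e0 : 0 < 1 - n.+1%:R^-1 :> R by move: np; rewrite e pmulr_rgt0.
rewrite {1}e lnM //; move: (n.+1%:R^-1) e0 => z /ln_le_sub1.
by move: (ln (1 - z)) (ln _) => u v; lra.
Qed.

Lemma harmonic_ge n : ln n.+1%:R <= \sum_(1 <= i < n.+1) (i%:R : R)^-1.
Proof.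
elim: n => [|n IH]; first by rewrite big_geq // ln_R1.
rewrite big_nat_recr //= -[leLHS](subrK (ln n.+1%:R)) [leRHS]addrC.
exact: lerD (ln_succ_le _) IH.
Qed.

Lemma harmonic_le n : (0 < n)%N -> \sum_(1 <= i < n.+1) (i%:R : R)^-1 <= 1 + ln n%:R.
Proof.
case: n => // n _; elim: n => [|n IH]; first by rewrite big_nat1 invr1 ln_R1 addr0.
rewrite big_nat_recr //= -[ln n.+2%:R](subrK (ln n.+1%:R)) [_ - _ + _]addrC addrA.
exact: lerD IH (ln_succ_ge _).
Qed.

Lemma nat_floor x : 0 <= x -> exists n : nat, n%:R <= x < n.+1%:R.
Proof.
move=> x0; exists (Num.trunc x); apply: Num.Theory.truncn_itv => //.
Qed.

End RealLog.

Lemma ler_sum_inj (R : numDomainType) (I J : finType) (P : pred I) (Q : pred J)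
    (f : I -> J) (G : J -> R) :
  {in P &, injective f} -> (forall i, P i -> Q (f i)) ->
  (forall j, Q j -> 0 <= G j) ->
  \sum_(i | P i) G (f i) <= \sum_(j | Q j) G j.
Proof.
move=> f_inj PQ G0; rewrite -(big_imset G f_inj) /=.
rewrite [leRHS](bigID (mem (f @: P))) /=.
rewrite (eq_bigl (fun j => Q j && (j \in f @: P))).
  by rewrite lerDl sumr_ge0 // => j /andP[/G0].
move=> j; case: (boolP (j \in f @: P)); rewrite ?andbF // => /imsetP[i Pi ->].
by rewrite PQ.
Qed.

(** An elementary substitute for the exponential bound of a product: it gives [1 / (1 - sum)] as
    soon as the sum of the [c i] is below 1. *)
Lemma prod_1D_bound (R : realDomainType) (I : Type) (s : seq I) (P : pred I) (c : I -> R) :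
  (forall i, 0 <= c i) ->
  (\prod_(i <- s | P i) (1 + c i)) * (1 - \sum_(i <- s | P i) c i) <= 1.
Proof.
move=> c0; have : 0 <= \sum_(i <- s | P i) c i /\ 1 <= \prod_(i <- s | P i) (1 + c i) /\
  (\prod_(i <- s | P i) (1 + c i)) * (1 - \sum_(i <- s | P i) c i) <= 1.
  elim/big_ind2: _ => [|x X y Y|i _].
  - by rewrite subr0 mulr1; split; [|split].
  - move=> [x0 [X1 Xx]] [y0 [Y1 Yy]]; split; [lra|split; [nra|]].
    (* Beyond 1 the left side is nonpositive; otherwise (1-x)(1-y) exceeds 1-(x+y) by xy. *)
    case: (lerP (x + y) 1) => xy; last by nra.
    have : (X * (1 - x)) * (Y * (1 - y)) <= 1 by rewrite mulr_ile1 ?mulr_ge0 //; lra.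
    have : 0 <= (X * Y) * (x * y) by rewrite !mulr_ge0 //; lra.
    by lra.
  - by have := c0 i; split; [lra|split; [lra|nra]].
by case=> _ [].
Qed.

Section Primes.
Variables (N D0 : nat).
Implicit Types (p : 'I_N) (U V : {set 'I_N}).

Definition sifted p : bool := prime p && (D0 < p)%N.
(** Sets range over all of ['I_N], so non-primes need a value. Their logarithm is 0, and the weights
    whose moments are taken below vanish at them. *)
Definition logp p : R := if prime p then ln (p : nat)%:R else 0.
Definition qprod U : nat := (\prod_(p in U) p)%N.
Definition primorial : nat := (\prod_(p < D0.+1 | prime p) p)%N.
Definition dens : R := (totient primorial)%:R / primorial%:R.
Definition prime_set U : bool := [forall p in U, prime p].
Definition sifted_set U : bool := [forall p in U, sifted p].

Lemma logp_ge0 p : 0 <= logp p.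
Proof. by rewrite /logp; case: ifP => // /prime_gt0 p0; rewrite ln_ge0 // ler1n. Qed.

Lemma sifted_prime_set U : sifted_set U -> prime_set U.
Proof. by move/forall_inP=> H; apply/forall_inP => p /H /andP[]. Qed.

Lemma qprod_gt0 U : prime_set U -> (0 < qprod U)%N.
Proof. by move/forall_inP=> H; rewrite prodn_cond_gt0 // => p /H /prime_gt0. Qed.

Lemma lg_qprod U : prime_set U -> lg logp U = ln (qprod U)%:R.
Proof.
move=> /forall_inP H; rewrite /lg /qprod.
have [_ ->] // : (0 < \prod_(p in U) p)%N /\
  \sum_(p in U) logp p = ln (\prod_(p in U) (p : nat))%N%:R.
elim/big_ind2: _ => [|x X y Y [X0 ->] [Y0 ->]|p pU].
- by rewrite ln_R1.
- by rewrite muln_gt0 X0 Y0 natrM lnM ?ltr0n.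
- by rewrite /logp H // prime_gt0 // H.
Qed.

Lemma lg_le_qprod U t : prime_set U -> (lg logp U <= t) = ((qprod U)%:R <= exp t).
Proof.
move=> PU; have q0 : 0 < (qprod U)%:R :> R by rewrite ltr0n qprod_gt0.
rewrite lg_qprod //; apply/idP/idP => H.
  by rewrite -(lnK q0) ler_exp.
by rewrite -(expK t) ler_ln.
Qed.

Lemma dvdn_qprod U p : prime_set U -> prime p -> (p %| qprod U)%N = (p \in U).
Proof.
move=> /forall_inP H pp; rewrite /qprod; apply/idP/idP => [|pU]; last first.
  by rewrite (bigD1 p) //= dvdn_mulr.
rewrite Euclid_dvd_prod // big_has_cond => /hasP[r _ /andP[rU]].
by rewrite dvdn_prime2 ?(H r rU) // => /eqP /val_inj ->.
Qed.

Lemma qprod_inj U V : prime_set U -> prime_set V -> qprod U = qprod V -> U = V.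
Proof.
move=> PU PV e; apply/setP => p; apply/idP/idP => pU.
  by rewrite -(dvdn_qprod PV) -?e ?dvdn_qprod // (forall_inP PU).
by rewrite -(dvdn_qprod PU) ?e ?dvdn_qprod // (forall_inP PV).
Qed.

Lemma qprod_dvd U m : prime_set U -> (forall p, p \in U -> (p %| m)%N) -> (qprod U %| m)%N.
Proof.
move=> /forall_inP PU Um; rewrite /qprod -big_enum /=.
have : {subset enum U <= U} by move=> p; rewrite mem_enum.
elim: (enum U) (enum_uniq (mem U)) => [|p s IH] /=; first by rewrite big_nil dvd1n.
move=> /andP[ps us] sub; rewrite big_cons Gauss_dvd.
  by rewrite Um ?sub ?mem_head // IH // => r rs; rewrite sub // inE rs orbT.
rewrite prime_coprime ?PU ?sub ?mem_head //.
rewrite Euclid_dvd_prod ?PU ?sub ?mem_head // big_has; apply/hasPn => r rs.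
rewrite dvdn_prime2 ?PU ?sub ?mem_head ?inE ?rs ?orbT //.
by apply: contra ps => /eqP /val_inj ->.
Qed.

Lemma coprime_qprod U m : (forall p, p \in U -> coprime p m) -> coprime (qprod U) m.
Proof.
by move=> H; rewrite /qprod; elim/big_ind: _ => [|x y|p /H //]; rewrite ?coprime1n // coprimeMl => -> ->.
Qed.

End Primes.

Lemma primorialS D : primorial D.+1 = (primorial D * (if prime D.+1 then D.+1 else 1))%N.
Proof. by rewrite /primorial big_mkcond big_ord_recr -big_mkcond /=. Qed.

Lemma primorial_gt0 D : (0 < primorial D)%N.
Proof. by rewrite prodn_cond_gt0 // => p /prime_gt0. Qed.

Lemma prime_dvd_primorial D r : prime r -> (r %| primorial D)%N = (r <= D)%N.
Proof.
move=> pr; apply/idP/idP => [|rD].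
  rewrite /primorial Euclid_dvd_prod // big_has_cond => /hasP[q _ /andP[pq]].
  by rewrite dvdn_prime2 // => /eqP ->; rewrite -ltnS.
have rD1 : (r < D.+1)%N by [].
by rewrite /primorial (bigD1 (Ordinal rD1)) //= dvdn_mulr.
Qed.

Lemma coprime_primorial D r : prime r -> coprime r (primorial D) = (D < r)%N.
Proof. by move=> pr; rewrite prime_coprime // prime_dvd_primorial // -ltnNge. Qed.

Lemma dens_prod D : dens D = \prod_(p < D.+1 | prime p) (1 - (p%:R)^-1 : R).
Proof.
elim: D => [|D IH].
  rewrite /dens (_ : primorial 0 = 1%N) ?divr1 //; last by rewrite /primorial big_mkcond big_ord1.
  by rewrite big_mkcond big_ord1.
rewrite [RHS]big_mkcond big_ord_recr -big_mkcond /= -IH /dens primorialS.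
case: ifP => pD; last by rewrite muln1 mulr1.
rewrite totient_coprime; last by rewrite coprime_sym coprime_primorial.
rewrite (totient_prime pD) !natrM.
have W0 : (primorial D)%:R != 0 :> R by rewrite pnatr_eq0 -lt0n primorial_gt0.
have D0 : D.+1%:R != 0 :> R by rewrite pnatr_eq0.
rewrite /= -[in D%:R](addrK 1 D%:R) natr1.
move: ((D.+1)%:R : R) ((primorial D)%:R : R) ((totient _)%:R : R) W0 D0 => x y z y0 x0.
by field; rewrite ?x0 ?y0.
Qed.

Lemma dens_gt0 D : 0 < dens D.
Proof. by rewrite divr_gt0 // ltr0n ?totient_gt0 primorial_gt0. Qed.

Section PrimeSums.
Variables (N D0 : nat).
Implicit Types (p : 'I_N) (U V : {set 'I_N}).
Local Notation mom := (mom (@logp N)).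

Definition supp (n : nat) : {set 'I_N} := [set p : 'I_N | prime p && (p %| n)%N].

Definition inv_pred p : R := if prime p then (p%:R - 1)^-1 else 0.
Definition sift_inv_pred p : R := if sifted D0 p then (p%:R - 1)^-1 else 0.
Definition sift_inv p : R := if sifted D0 p then (p%:R)^-1 else 0.

Lemma inv_pred_ge0 p : 0 <= inv_pred p.
Proof.
by rewrite /inv_pred; case: ifP => // /prime_gt1 p1; rewrite invr_ge0 subr_ge0 ler1n ltnW.
Qed.

Lemma sift_inv_pred_ge0 p : 0 <= sift_inv_pred p.
Proof.
rewrite /sift_inv_pred; case: ifP => // /andP[/prime_gt1 p1 _].
by rewrite invr_ge0 subr_ge0 ler1n ltnW.
Qed.

Lemma sift_inv_ge0 p : 0 <= sift_inv p.
Proof. by rewrite /sift_inv; case: ifP => // _; rewrite invr_ge0 ler0n. Qed.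

Lemma supp_eq0 n : (0 < n < N)%N -> supp n = set0 -> n = 1%N.
Proof.
move=> /andP[n0 nN] s0; apply/eqP; rewrite eqn_leq n0 andbT leqNgt; apply/negP => n1.
have pN : (pdiv n < N)%N by apply: leq_ltn_trans nN; rewrite pdiv_leq.
have : Ordinal pN \in supp n by rewrite inE /= pdiv_prime // pdiv_dvd.
by rewrite s0 inE.
Qed.

(* Grouping [n <= X] by their prime divisors: each group is dominated by a geometric series. *)
Lemma supp_sum_le (X : nat) U : (X < N)%N ->
  \sum_(n < X.+1 | (0 < n)%N && (supp n == U)) (n%:R : R)^-1 <= wt inv_pred U.
Proof.
move=> XN; move: {2}#|U| (erefl #|U|) => c; elim: c U => [|c IH] U cU.
  move/eqP: cU; rewrite cards_eq0 => /eqP ->; rewrite wt_set0.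
  case: X XN => [|X] XN.
    by rewrite big1 // => n /andP[]; rewrite (ord1 n).
  rewrite (bigD1 (inord 1)) /=; last first.
    rewrite inordK //= -subset0; apply/subsetP => p; rewrite !inE dvdn1.
    by case/andP=> pp /eqP p1; rewrite p1 in pp.
  rewrite inordK // invr1 big1 ?addr0 // => n /andP[/andP[n0 /eqP sn] n1].
  case/eqP: n1; apply: val_inj; rewrite /= inordK //; apply: supp_eq0 => //.
  by rewrite n0 (leq_trans (ltn_ord n)).
have /card_gt0P[p pU] : (0 < #|U|)%N by rewrite cU.
case: (boolP (prime p)) => pp; last first.
  rewrite big1 ?wt_ge0 // => [|n /andP[_ /eqP sU]]; first exact: inv_pred_ge0.
  by move: pU; rewrite -sU inE (negPf pp).
have cU' : #|U :\ p| = c by move: cU; rewrite (cardsD1 p) pU => -[].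
set s := fun V : {set 'I_N} => \sum_(n < X.+1 | (0 < n)%N && (supp n == V)) (n%:R : R)^-1.
have p1 : 1 < (p : nat)%:R :> R by rewrite ltr1n prime_gt1.
have p0 : 0 < (p : nat)%:R :> R by lra.
(* Dividing by [p] is injective on the group of [U] and lands in the group of [U] or of [U :\ p].
   Solving for [s U] sums the geometric series and produces the factor 1/(p-1). *)
have main : s U <= (p%:R)^-1 * (s U + s (U :\ p)).
  pose f (n : 'I_X.+1) : 'I_X.+1 := inord (n %/ p).
  have fE n : f n = (n %/ p)%N :> nat.
    by rewrite inordK // ltnS (leq_trans (leq_div _ _)) // -ltnS.
  pose Q (m : 'I_X.+1) := (0 < m)%N && ((supp m == U) || (supp m == U :\ p)).
  have -> : s U + s (U :\ p) = \sum_(m | Q m) ((m : nat)%:R : R)^-1.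
    rewrite /Q (bigID (fun m : 'I_X.+1 => supp m == U)) /=; congr (_ + _); apply: eq_bigl => m.
      by case: eqP; rewrite ?andbT ?andbF.
    have ne : (U :\ p == U) = false.
      by apply/eqP => /setP /(_ p); rewrite !inE eqxx pU.
    case: (supp m =P U :\ p) => [->|_]; rewrite ?ne ?andbT ?andbF //=.
    by case: (supp m == U); rewrite ?andbF ?orbF.
  rewrite big_distrr /=.
  have dvd (n : 'I_X.+1) : supp n == U -> (p %| n)%N.
    by move=> /eqP sU; move: pU; rewrite -sU inE => /andP[].
  apply: le_trans (ler_sum_inj (P := fun n : 'I_X.+1 => (0 < n)%N && (supp n == U))
     (f := f) (G := fun m : 'I_X.+1 => (p%:R)^-1 * ((m : nat)%:R)^-1) _ _ _).
  - apply: ler_sum => n /andP[n0 /dvd pn]; rewrite -invfM -natrM fE.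
    by rewrite [(p * _)%N]mulnC divnK.
  - move=> n m /andP[_ /dvd pn] /andP[_ /dvd pm] /(congr1 (@nat_of_ord _)); rewrite !fE => e.
    by apply: val_inj; rewrite /= -(divnK pn) -(divnK pm) e.
  - move=> n /andP[n0 sU]; have pn := dvd _ sU; rewrite /Q fE divn_gt0 ?prime_gt0 //.
    rewrite dvdn_leq //=; move/eqP: sU => <-.
    have sE r : r \in supp n = (r == p) || (r \in supp (n %/ p)).
      rewrite !inE -{1}(divnK pn); case: (boolP (prime r)) => pr /=.
        by rewrite Euclid_dvdM // orbC dvdn_prime2.
      by apply/esym/negbTE; apply: contra pr => /orP[/eqP -> //|].
    case: (boolP (p \in supp (n %/ p))) => ps; apply/orP; [left|right]; apply/eqP/setP => r.
      by rewrite sE; case: (eqVneq r p) => [-> //|].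
    by rewrite in_setD1 sE; case: (eqVneq r p) => [->|] //=; apply/negbTE.
  - by move=> m _; rewrite mulr_ge0 // invr_ge0 ?ler0n.
have := IH _ cU'; rewrite -/(s _) -/(s _) => IHp.
have -> : wt inv_pred U = (p%:R - 1)^-1 * wt inv_pred (U :\ p).
  by rewrite /wt (big_setD1 p) //= {1}/inv_pred pp.
rewrite mulrC ler_pdivlMr ?subr_gt0 //.
move: main; rewrite mulrC ler_pdivlMr // mulrBr mulr1; lra.
Qed.

(** The classical lower bound for the sum of 1/phi(d) over squarefree d up to e^s: every integer up
    to e^s has its radical among these d, so the sum dominates a harmonic sum. [exp s < N] puts all
    the primes involved into ['I_N]. *)
Lemma mom_inv_pred_ge s : 0 <= s -> exp s < N%:R -> s <= mom inv_pred 0 s.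
Proof.
move=> s0 sN; have [X /andP[Xs sX]] := nat_floor (ltW (expR_gt0 s)).
have XN : (X < N)%N by rewrite -(ltr_nat R) (le_lt_trans Xs).
apply: (@le_trans _ _ (\sum_(1 <= i < X.+1) (i%:R : R)^-1)).
  apply: le_trans (harmonic_ge X); rewrite -[leLHS]expK ler_ln ?expR_gt0 // ltW //.
rewrite big_geq_mkord (partition_big (fun n : 'I_X.+1 => supp n) xpredT) //=.
rewrite /mom; apply: ler_sum => U _.
case: (pickP (fun n : 'I_X.+1 => (0 < n)%N && (supp n == U))) => [n /andP[n0 /eqP sU]|no].
  have PU : prime_set U by rewrite -sU; apply/forall_inP => p; rewrite inE => /andP[].
  have -> : ramp 0 (s - lg (@logp N) U) = 1.
    rewrite /ramp subr_ge0 lg_le_qprod // ifT // (le_trans _ Xs) // ler_nat.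
    have : (qprod U %| n)%N by apply: qprod_dvd => // p; rewrite -sU inE => /andP[].
    by move=> /(dvdn_leq n0) /leq_trans; apply; rewrite -ltnS.
  by rewrite mulr1; apply: supp_sum_le.
by rewrite big_pred0 // mulr_ge0 ?ramp_ge0 ?wt_ge0 // => p; apply: inv_pred_ge0.
Qed.

(** Removing the primes up to [D0] costs the product of 1 + 1/(p-1) over them, which is exactly
    1/[dens D0]. *)
Lemma mom_sift_inv_pred_ge s : (D0 < N)%N -> 0 <= s -> exp s < N%:R ->
  dens D0 * s <= mom sift_inv_pred 0 s.
Proof.
move=> DN s0 sN; pose a p : R := if prime p && (p < D0.+1)%N then (p%:R - 1)^-1 else 0.
have a0 p : 0 <= a p.
  by rewrite /a; case: ifP => // /andP[/prime_gt1 p1 _]; rewrite invr_ge0 subr_ge0 ler1n ltnW.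
have e : mom inv_pred 0 s = mom (fun p => a p + sift_inv_pred p) 0 s.
  apply: eq_mom => p; rewrite /inv_pred /a /sift_inv_pred /sifted ltnS.
  by case: (prime p) => //=; rewrite ?addr0 //; case: leqP => _; rewrite ?addr0 ?add0r.
have := mom_inv_pred_ge s0 sN; rewrite e => H.
have := mom_removal (@logp_ge0 N) s a0 sift_inv_pred_ge0 => /(le_trans H).
move=> /(ler_wpM2l (ltW (dens_gt0 D0))); rewrite mulrA.
suff -> : dens D0 * \prod_p (1 + a p) = 1 by rewrite mul1r.
rewrite dens_prod (big_ord_widen_cond N (fun p : nat => prime p) (fun p : nat => 1 - (p%:R)^-1 : R)) //.
rewrite big_mkcond -big_split /= big1 // => p _; rewrite /a; case: ifP => [/andP[pp _]|_].
  have p1 : 1 < (p : nat)%:R :> R by rewrite ltr1n prime_gt1.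
  by field; rewrite !gt_eqF //; lra.
by rewrite addr0 mulr1.
Qed.

(** A product of sifted primes is an integer prime to [W], and distinct sets give distinct integers;
    so the sum of 1/n over all n prime to [W] is an upper bound. *)
Lemma mom_sift_inv_le t : 0 <= t ->
  mom sift_inv 0 t <= dens D0 * (t + ((primorial D0)%:R + 1)).
Proof.
move=> t0; have [X /andP[Xt tX]] := nat_floor (ltW (expR_gt0 t)).
have X0 : (0 < X)%N.
  by rewrite -ltnS -(ltr_nat R) (le_lt_trans _ tX) // exp_ge1.
apply: (@le_trans _ _ (\sum_(n < X.+1 | (0 < n)%N && coprime n (primorial D0)) ((n : nat)%:R : R)^-1)).
  pose P U := sifted_set D0 U && (lg (@logp N) U <= t).
  have qX U : P U -> (qprod U < X.+1)%N.
    case/andP=> SU; rewrite lg_le_qprod ?(sifted_prime_set SU) // => H.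
    by rewrite -(ltr_nat R) (le_lt_trans H).
  apply: le_trans (ler_sum_inj (P := P) (f := fun U => inord (qprod U) : 'I_X.+1)
     (G := fun n : 'I_X.+1 => ((n : nat)%:R)^-1) _ _ _).
  - rewrite [leRHS]big_mkcond; apply: ler_sum => U _; rewrite /P.
    case: (boolP (sifted_set D0 U)) => SU /=; last first.
      case/forall_inPn: SU => p pU np.
      by rewrite /wt (bigD1 p) //= /sift_inv (negPf np) !mul0r.
    rewrite /ramp subr_ge0; case: ifP => lU; last by rewrite mulr0.
    rewrite mulr1 inordK; last by apply: qX; rewrite /P SU.
    rewrite /qprod natr_prod -prodfV /wt le_eqVlt; apply/orP; left; apply/eqP.
    by apply: eq_bigr => p /(forall_inP SU) sp; rewrite /sift_inv sp.
  - move=> U V PU PV /(congr1 (@nat_of_ord _)); rewrite !inordK ?qX //.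
    by apply: qprod_inj; apply: (@sifted_prime_set _ D0); [case/andP: PU|case/andP: PV].
  - move=> U PU; rewrite inordK ?qX //; case/andP: PU => SU _.
    rewrite qprod_gt0 ?(sifted_prime_set SU) //=; apply: coprime_qprod => p /(forall_inP SU).
    by case/andP=> pp; rewrite coprime_primorial.
  - by move=> n _; rewrite invr_ge0 ler0n.
set W := primorial D0; have W0 : (0 < W)%N by apply: primorial_gt0.
have Wp : 0 < W%:R :> R by rewrite ltr0n.
(* With n = mW + a, 1/n is at most 1/(mW) for m > 0 and at most 1 for m = 0. Each block has phi(W)
   admissible [a], so block 0 contributes the [W] in the shift. *)
pose G (x : 'I_X.+1 * 'I_W) : R := if (x.1 : nat) == 0%N then 1 else ((x.1 : nat)%:R)^-1 / W%:R.
have dX (n : 'I_X.+1) : (n %/ W < X.+1)%N.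
  by rewrite (leq_ltn_trans (leq_div _ _)).
have mW (n : 'I_X.+1) : (n %% W < W)%N by rewrite ltn_pmod.
apply: (@le_trans _ _ (\sum_(x : 'I_X.+1 * 'I_W | coprime W x.2) G x)).
  apply: le_trans (ler_sum_inj (P := fun n : 'I_X.+1 => (0 < n)%N && coprime n W)
     (f := fun n : 'I_X.+1 => (Ordinal (dX n), Ordinal (mW n))) (G := G) _ _ _).
  - apply: ler_sum => n /andP[n0 _]; rewrite /G /=.
    case: eqP => [_|/eqP d0]; first by rewrite invf_le1 ?ler1n // ltr0n.
    rewrite -invfM -natrM lef_pV2 ?posrE ?ltr0n ?muln_gt0 ?n0 ?W0 ?lt0n ?d0 //.
    by rewrite ler_nat leq_trunc_div.
  - move=> n m _ _ [dnm mnm]; apply: val_inj => /=.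
    by rewrite (divn_eq n W) (divn_eq m W) dnm mnm.
  - by move=> n /andP[_]; rewrite /= coprime_modr coprime_sym.
  - by move=> x _; rewrite /G; case: ifP => // _; rewrite divr_ge0 ?invr_ge0 ?ler0n.
rewrite -(pair_big xpredT (fun a : 'I_W => coprime W a) (fun m a => G (m, a))) /=.
have phiE : \sum_(a < W | coprime W a) 1 = (totient W)%:R :> R.
  rewrite totient_count_coprime big_mkord natr_sum big_mkcond; apply: eq_bigr => a _.
  by case: coprime.
have GE (m : 'I_X.+1) : \sum_(a < W | coprime W a) G (m, a) =
    (totient W)%:R * (if (m : nat) == 0%N then 1 else ((m : nat)%:R)^-1 / W%:R).
  by rewrite -phiE big_distrl; apply: eq_bigr => a _; rewrite /= mul1r.
rewrite (eq_bigr _ (fun m _ => GE m)) -big_distrr /= big_ord_recl /=.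
have -> : \sum_(i < X) (if lift ord0 i == 0%N :> nat then 1 else ((lift ord0 i : nat)%:R)^-1 / W%:R) =
   W%:R^-1 * \sum_(1 <= i < X.+1) (i%:R : R)^-1.
  rewrite big_add1 big_mkord big_distrr; apply: eq_bigr => i _ /=.
  by rewrite mulrC.
have H := harmonic_le X0.
have lnX : ln X%:R <= t by rewrite -[leRHS]expK ler_ln // ltr0n.
rewrite /dens -/W -mulrA ler_wpM2l ?ler0n //.
have : W%:R^-1 * (\sum_(1 <= i < X.+1) (i%:R : R)^-1) <= W%:R^-1 * (1 + t).
  by rewrite ler_wpM2l ?invr_ge0 ?ler0n //; lra.
rewrite [_ * (t + _)]mulrDr mulrDr mulrDr mulVf ?gt_eqF //; lra.
Qed.

(** Extended to all integers above [D0], the sum telescopes: the term at n is at most e(n-1) - e(n)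
    with e(n) = k^2/(n-k). *)
Lemma sum_sift_corr_le (k : nat) : (k < D0)%N ->
  \sum_(p : 'I_N) (if sifted D0 p then k%:R ^+ 2 / (p%:R * (p%:R - k%:R)) else 0) <=
  k%:R ^+ 2 / (D0%:R - k%:R) :> R.
Proof.
move=> kD; rewrite big_mkcond -(big_mkord xpredT (fun p : nat => if prime p && (D0 < p)%N
  then k%:R ^+ 2 / (p%:R * (p%:R - k%:R)) else 0 : R)).
pose e (n : nat) : R := k%:R ^+ 2 / (n%:R - k%:R).
have pos n : (k < n)%N -> 0 < n%:R - k%:R :> R by move=> kn; rewrite subr_gt0 ltr_nat.
suff H M : \sum_(0 <= p < M) (if prime p && (D0 < p)%N
   then k%:R ^+ 2 / (p%:R * (p%:R - k%:R)) else 0 : R) <=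
   if (D0 < M)%N then e D0 - e M.-1 else 0.
  apply: le_trans (H N) _; have eD : 0 <= e D0 by rewrite divr_ge0 ?exprn_ge0 ?ler0n // ltW // pos.
  case: ifP => // DN; rewrite -/(e D0) gerBl divr_ge0 ?exprn_ge0 ?ler0n // ltW // pos //.
  by rewrite (leq_trans kD) // -ltnS prednK // (leq_trans _ DN).
elim: M => [|M IH]; first by rewrite big_geq.
rewrite big_nat_recr //=; case: (ltnP D0 M) IH => DM IH; last first.
  rewrite andbF addr0; apply: le_trans IH _; case: ifP => //.
  rewrite ltnS => MD; have -> : M = D0 by apply/eqP; rewrite eqn_leq DM MD.
  by rewrite subrr.
rewrite ltnS (ltnW DM) andbT.
have M0 : (0 < M)%N by apply: leq_trans DM.
have kM1 : (k < M.-1)%N by rewrite (leq_trans kD) // -ltnS prednK.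
have step : k%:R ^+ 2 / (M%:R * (M%:R - k%:R)) <= e M.-1 - e M.
  have m1 : M.-1%:R = M%:R - 1 :> R by rewrite -[in RHS](prednK M0) -natr1 addrK.
  have a1 := pos _ kM1; have k0 : 0 <= k%:R :> R by rewrite ler0n.
  rewrite /e m1 in a1 *; move: (M%:R) (k%:R) a1 k0 => x y a1 y0.
  have -> : y ^+ 2 / (x - 1 - y) - y ^+ 2 / (x - y) = y ^+ 2 / ((x - 1 - y) * (x - y)).
    by field; rewrite !gt_eqF //; lra.
  rewrite ler_wpM2l ?exprn_ge0 // lef_pV2 ?posrE ?mulr_gt0 //; try lra.
  by rewrite ler_wpM2r //; lra.
case: ifP => _; first by move: IH step; lra.
rewrite addr0; apply: le_trans IH _; apply: lerB => //.
move: step; have : 0 <= k%:R ^+ 2 / (M%:R * (M%:R - k%:R)) :> R.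
  by rewrite divr_ge0 ?exprn_ge0 ?mulr_ge0 ?ler0n // ltW // pos // (ltn_trans kD).
lra.
Qed.

End PrimeSums.

(** * Residue classes and error terms *)

Section Classes.
Local Open Scope nat_scope.

Lemma crt_count (m p : nat) (P Z : pred nat) : coprime m p -> 0 < m -> 0 < p ->
  (forall c, P (c %% m) = P c) -> (forall c, Z (c %% p) = Z c) ->
  \sum_(c < m * p) (P c && Z c : nat) = (\sum_(c < m) P c) * (\sum_(c < p) Z c).
Proof.
move=> cop m0 p0 Pm Zp; rewrite big_distrlr /=.
rewrite (pair_big xpredT xpredT (fun (i : 'I_m) (j : 'I_p) => P i * Z j)) /=.
have mm (c : 'I_(m * p)) : c %% m < m by rewrite ltn_pmod.
have mp (c : 'I_(m * p)) : c %% p < p by rewrite ltn_pmod.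
pose f (c : 'I_(m * p)) := (Ordinal (mm c), Ordinal (mp c)).
have f_inj : injective f.
  move=> c d [em ep]; apply: val_inj => /=.
  have /eqP : c == d %[mod m * p] by rewrite chinese_remainder // em ep !eqxx.
  by rewrite !modn_small.
have f_bij : bijective f.
  by apply: inj_card_bij => //; rewrite card_prod !card_ord.
rewrite (reindex f) /=; last exact: onW_bij.
by apply: eq_bigr => c _; rewrite Pm Zp mulnb.
Qed.

Lemma dvdn_modD d m c h : d %| m -> (d %| c %% m + h) = (d %| c + h).
Proof. by move=> dm; rewrite /dvdn -modnDml modn_dvdm // modnDml. Qed.

(** Elements of [H] below [p] are distinct modulo [p], so their negatives are [size H] distinct
    roots. *)
Lemma root_count (p : nat) (H : seq nat) : prime p -> uniq H ->
  (forall h, h \in H -> h < p) ->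
  \sum_(z < p) (has (fun h => p %| z + h) H : nat) = size H.
Proof.
case: p => // p pp uH Hp.
pose f h : 'I_p.+1 := inord ((p.+1 - h) %% p.+1).
have fE h : f h = (p.+1 - h) %% p.+1 :> nat by rewrite inordK // ltn_pmod.
have root (z : 'I_p.+1) h : h < p.+1 -> (p.+1 %| z + h) = (z == f h).
  move=> hp; rewrite -val_eqE /= fE; apply/idP/eqP => [dv|->].
    rewrite -[LHS](modn_small (ltn_ord z)); apply/eqP; rewrite -(eqn_modDr h).
    by rewrite subnK ?(ltnW hp) // modnn; apply: dv.
  by rewrite /dvdn modnDml subnK ?(ltnW hp) // modnn.
have uf : uniq (map f H).
  rewrite map_inj_in_uniq // => x y /Hp xp /Hp yp exy.
  have := root (f x) x xp; have := root (f x) y yp; rewrite exy eqxx => d1 d2.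
  have : x == y %[mod p.+1].
    rewrite -(eqn_modDl (f y)); move: d1 d2; rewrite /dvdn => /eqP -> /eqP -> //.
  by rewrite !modn_small // => /eqP.
rewrite -(size_map f) -(card_uniqP uf) -sum1_card big_mkcond [RHS]big_mkcond /=.
apply: eq_bigr => z _.
have -> : has (fun h => p.+1 %| z + h) H = (z \in map f H).
  apply/hasP/mapP => [[h hH]|[h hH zE]].
    by rewrite root ?Hp // => /eqP ->; exists h.
  by exists h => //; rewrite root ?Hp // zE.
by case: ifP.
Qed.

Lemma class_count_seq (W v : nat) (s H : seq nat) : 0 < W -> v < W ->
  uniq s -> all prime s -> all (fun p => coprime W p) s -> uniq H ->
  (forall p h, p \in s -> h \in H -> h < p) ->
  \sum_(c < W * \prod_(p <- s) p)
     ((c %% W == v) && all (fun p => has (fun h => p %| c + h) H) s : nat) = size H ^ size s.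
Proof.
move=> W0 vW; elim: s => [|p s IH] /=.
  rewrite big_nil muln1 expn0 => *; rewrite (bigD1 (Ordinal vW)) //= modn_small // eqxx.
  rewrite big1 // => c; rewrite modn_small // -val_eqE /= => /negPf ->; by [].
case/andP=> ps us /andP[pp sp] /andP[cp cs] uH Hp.
have copr : coprime (W * \prod_(q <- s) q) p.
  rewrite coprimeMl cp /= coprime_sym prime_coprime // Euclid_dvd_prod // big_has.
  apply/hasPn => q qs; rewrite dvdn_prime2 ?(allP sp q qs) //.
  by apply: contra ps => /eqP ->.
have s0 : 0 < \prod_(q <- s) q.
  by rewrite big_seq prodn_cond_gt0 // => q /(allP sp) /prime_gt0.
rewrite big_cons [p * _]mulnC mulnA.
set m := W * _ in copr *.
pose P c := (c %% W == v) && all (fun q => has (fun h => q %| c + h) H) s.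
pose Z c := has (fun h => p %| c + h) H.
have m0 : 0 < m by rewrite muln_gt0 W0 s0.
have Pm c : P (c %% m) = P c.
  rewrite /P modn_dvdm ?dvdn_mulr //; congr (_ && _).
  apply: eq_in_all => q qs; apply: eq_has => h; rewrite dvdn_modD //.
  by rewrite dvdn_mull // (big_rem q) //= dvdn_mulr.
have Zp c : Z (c %% p) = Z c by apply: eq_has => h; rewrite dvdn_modD.
transitivity (\sum_(c < m * p) (P c && Z c : nat)).
  by apply: eq_bigr => c _; rewrite /P /Z -andbA [has _ _ && _]andbC.
rewrite (crt_count copr m0 (prime_gt0 pp) Pm Zp) /P /m IH // => [|q h qs]; last first.
  by apply: Hp; rewrite inE qs orbT.
by rewrite root_count ?expnS 1?mulnC // => h; apply: Hp; rewrite mem_head.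
Qed.

End Classes.

Section Sieve.
Variables (N D0 : nat).
Implicit Types (U V D E : {set 'I_N}) (H : seq nat).
Local Notation W := (primorial D0).

(** For a set of primes, this says that [qprod U] divides the product of the [n + h], expressed
    prime by prime. *)
Definition hits H U (n : nat) : bool := [forall p in U, has (fun h => (p %| n + h)%N) H].

Lemma hitsU H U V n : hits H (U :|: V) n = hits H U n && hits H V n.
Proof.
apply/forall_inP/andP => [hUV|[/forall_inP hU /forall_inP hV] p].
  by split; apply/forall_inP => p pU; apply: hUV; rewrite inE pU ?orbT.
by rewrite inE => /orP[/hU|/hV].
Qed.

Lemma hits_mod H U n m : (qprod U %| m)%N -> hits H U (n %% m) = hits H U n.
Proof.
move=> Um; apply: eq_forallb_in => p pU; apply: eq_has => h; rewrite dvdn_modD //.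
by apply: dvdn_trans Um; rewrite /qprod (bigD1 p) //= dvdn_mulr.
Qed.

Lemma class_count H U (v : nat) : sifted_set D0 U -> (v < W)%N -> uniq H ->
  (forall h, h \in H -> (h <= D0)%N) ->
  (\sum_(c < W * qprod U) ((c %% W == v) && hits H U c : nat) = size H ^ #|U|)%N.
Proof.
move=> SU vW uH HD; pose s := map (@nat_of_ord N) (enum U).
have sE : \prod_(p <- s) p = qprod U by rewrite /s big_map big_enum.
have := @class_count_seq W v s H; rewrite sE size_map -cardE => <- //.
- apply: eq_bigr => c _; congr (nat_of_bool (_ && _)).
  rewrite all_map; apply/forall_inP/allP => [h p|h p pU].
    by rewrite mem_enum; apply: h.
  by apply: h; rewrite mem_enum.
- exact: primorial_gt0.
- by rewrite map_inj_uniq ?enum_uniq //; apply: val_inj.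
- by apply/allP => _ /mapP[p pU ->]; move: pU; rewrite mem_enum => /(forall_inP SU) /andP[].
- apply/allP => _ /mapP[p pU ->]; move: pU; rewrite mem_enum => /(forall_inP SU) /andP[pp Dp].
  by rewrite coprime_sym coprime_primorial.
- move=> _ h /mapP[p pU ->] /HD hD; move: pU; rewrite mem_enum => /(forall_inP SU) /andP[pp Dp].
  exact: leq_ltn_trans Dp.
Qed.

(** By the Chinese remainder theorem the conditions select exactly [size H ^ #|U|] classes modulo
    [W * qprod U]; main term and error are those of one class times this number. *)
Lemma class_sum H U (v lo hi : nat) (a : nat -> R) (Y e : R) :
  sifted_set D0 U -> (v < W)%N -> uniq H -> (forall h, h \in H -> (h <= D0)%N) ->
  (forall c : nat, (c < W * qprod U)%N -> (c %% W = v)%N -> hits H U c ->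
     `|\sum_(lo <= n < hi | (n %% (W * qprod U))%N == c) a n - Y| <= e) ->
  `|\sum_(lo <= n < hi | ((n %% W)%N == v) && hits H U n) a n - (size H)%:R ^+ #|U| * Y|
    <= (size H)%:R ^+ #|U| * e.
Proof.
move=> SU vW uH HD Hc; set m := (W * qprod U)%N.
have m0 : (0 < m)%N by rewrite muln_gt0 primorial_gt0 qprod_gt0 ?(sifted_prime_set SU).
have mm n : (n %% m < m)%N by rewrite ltn_pmod.
pose Q (c : 'I_m) := ((c %% W)%N == v) && hits H U c.
rewrite (partition_big (fun n => Ordinal (mm n)) Q) /=; last first.
  by move=> n /andP[nv hn]; rewrite /Q /= modn_dvdm ?dvdn_mulr // nv hits_mod ?dvdn_mull.
have cnt : \sum_(c | Q c) 1 = (size H)%:R ^+ #|U| :> R.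
  rewrite -natrX -(class_count SU vW uH HD) natr_sum big_mkcond; apply: eq_bigr => c _.
  by rewrite /Q; case: ifP.
rewrite -cnt !big_distrl -sumrB /=; apply: le_trans (ler_norm_sum _ _ _) _.
apply: ler_sum => c /andP[/eqP cv hc]; rewrite !mul1r.
apply: le_trans (Hc c (ltn_ord c) cv hc).
rewrite le_eqVlt; apply/orP; left; apply/eqP; congr (`|_ - _|).
apply: eq_bigl => n; rewrite -val_eqE /=.
rewrite -/m; case: (@eqP _ (n %% m)%N c) => nc; rewrite ?andbF // andbT.
by rewrite -(@modn_dvdm m n W) ?dvdn_mulr // nc cv eqxx -(@hits_mod H U n m) ?dvdn_mull // nc hc.
Qed.

(** Opening the square: [D] and [E] both divide exactly when their least common multiple [D :|: E]
    does. *)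
Lemma sieve_expand H (lam : {set 'I_N} -> R) (a : nat -> R) (P : pred nat) lo hi :
  \sum_(lo <= n < hi | P n) a n * (\sum_(D : {set 'I_N} | hits H D n) lam D) ^+ 2 =
  \sum_(D : {set 'I_N}) \sum_(E : {set 'I_N}) lam D * lam E *
     \sum_(lo <= n < hi | P n && hits H (D :|: E) n) a n.
Proof.
transitivity (\sum_(lo <= n < hi | P n) \sum_(D : {set 'I_N}) \sum_(E : {set 'I_N})
   if hits H (D :|: E) n then lam D * lam E * a n else 0).
  apply: eq_bigr => n _; rewrite expr2 big_distrlr big_distrr big_mkcond /=.
  apply: eq_bigr => D _; case: ifP => hD; last by rewrite big1 // => E _; rewrite hitsU hD.
  rewrite big_distrr big_mkcond /=; apply: eq_bigr => E _; rewrite hitsU hD /=.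
  by case: ifP => // _; rewrite mulrC.
rewrite exchange_big /=; apply: eq_bigr => D _; rewrite exchange_big /=; apply: eq_bigr => E _.
by rewrite big_distrr /= big_mkcondr.
Qed.

(* The constant 16 is [2 * 2] from the bounds on [lam D] and [lam E], times the [4 ^ #|U|] pairs
   of subsets of [U]. *)
Lemma sieve_error (lam : {set 'I_N} -> R) (A : {set 'I_N} -> R) (g : 'I_N -> R)
    (X L Lam : R) (e : {set 'I_N} -> R) (k : nat) :
  (forall D, `|lam D| <= 2 ^+ #|D| * Lam) ->
  (forall D, ~~ (sifted_set D0 D && (lg (@logp N) D <= L)) -> lam D = 0) ->
  (forall U, 0 <= e U) ->
  (forall U, sifted_set D0 U -> lg (@logp N) U <= 2 * L ->
     `|A U - X * wt g U| <= k%:R ^+ #|U| * e U) ->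
  `|\sum_D \sum_E lam D * lam E * A (D :|: E) -
    X * \sum_D \sum_E lam D * lam E * wt g (D :|: E)| <=
  Lam ^+ 2 * \sum_(U : {set 'I_N} | sifted_set D0 U && (lg (@logp N) U <= 2 * L))
     (16 * k)%:R ^+ #|U| * e U.
Proof.
move=> lamB lam0 e0 AB.
have Lam0 : 0 <= Lam.
  by have := lamB set0; rewrite cards0 expr0 mul1r; apply: le_trans.
rewrite big_distrr -sumrB /=.
pose Q U := sifted_set D0 U && (lg (@logp N) U <= 2 * L).
apply: (@le_trans _ _ (\sum_D \sum_E if Q (D :|: E) then
   Lam ^+ 2 * ((4 * k)%:R ^+ #|D :|: E| * e (D :|: E)) else 0)).
  apply: le_trans (ler_norm_sum _ _ _) _; apply: ler_sum => D _.
  rewrite big_distrr -sumrB /=.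
  apply: le_trans (ler_norm_sum _ _ _) _; apply: ler_sum => E _.
  rewrite mulrCA -mulrBr normrM.
  case: (boolP (sifted_set D0 D && (lg (@logp N) D <= L))) => [/andP[SD LD]|/lam0 ->]; last first.
    rewrite mul0r normr0 mul0r; case: ifP => // _; rewrite mulr_ge0 ?exprn_ge0 //.
    by rewrite mulr_ge0 ?exprn_ge0 ?ler0n.
  case: (boolP (sifted_set D0 E && (lg (@logp N) E <= L))) => [/andP[SE LE]|/lam0 ->]; last first.
    rewrite mulr0 normr0 mul0r; case: ifP => // _; rewrite mulr_ge0 ?exprn_ge0 //.
    by rewrite mulr_ge0 ?exprn_ge0 ?ler0n.
  have SU : sifted_set D0 (D :|: E).
    apply/forall_inP => p; rewrite inE => /orP[pD|pE].
      exact: (forall_inP SD).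
    exact: (forall_inP SE).
  have LU : lg (@logp N) (D :|: E) <= 2 * L.
    by have := lgU_le (@logp_ge0 N) D E; lra.
  rewrite /Q SU LU /= natrM exprMn normrM.
  apply: (@le_trans _ _ ((2 ^+ #|D| * Lam) * (2 ^+ #|E| * Lam) *
     (k%:R ^+ #|D :|: E| * e (D :|: E)))).
    by rewrite ler_pM ?mulr_ge0 ?AB // ler_pM.
  have -> : 4%:R ^+ #|D :|: E| = 2 ^+ #|D :|: E| * 2 ^+ #|D :|: E| :> R.
    by rewrite -exprMn -natrM.
  have -> : Lam ^+ 2 * (2 ^+ #|D :|: E| * 2 ^+ #|D :|: E| * k%:R ^+ #|D :|: E| * e (D :|: E)) =
    (2 ^+ #|D :|: E| * Lam) * (2 ^+ #|D :|: E| * Lam) * (k%:R ^+ #|D :|: E| * e (D :|: E)).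
    by ring.
  apply: ler_wpM2r; first by rewrite mulr_ge0 ?exprn_ge0 ?ler0n.
  have mono V : V \subset D :|: E -> 2 ^+ #|V| * Lam <= 2 ^+ #|D :|: E| * Lam.
    by move=> /subset_leq_card c; rewrite ler_wpM2r // ler_eXn2l // ltr1n.
  by rewrite ler_pM ?mulr_ge0 ?exprn_ge0 // mono ?subsetUl ?subsetUr.
rewrite pair_big /= -big_mkcond /=.
rewrite (partition_big (fun DE : {set 'I_N} * {set 'I_N} => DE.1 :|: DE.2) Q) //=.
rewrite big_distrr /=; apply: ler_sum => U QU.
apply: (@le_trans _ _ (\sum_(DE : {set 'I_N} * {set 'I_N} |
     (DE.1 \subset U) && (DE.2 \subset U)) Lam ^+ 2 * ((4 * k)%:R ^+ #|U| * e U))).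
  rewrite big_mkcond [leRHS]big_mkcond; apply: ler_sum => -[D E] _ /=.
  case: ifP => [/andP[_ /eqP <-]|_]; first by rewrite subsetUl subsetUr.
  by case: ifP => // _; rewrite mulr_ge0 ?exprn_ge0 // mulr_ge0 ?exprn_ge0 ?ler0n.
rewrite -(pair_big (fun D : {set 'I_N} => D \subset U) (fun E : {set 'I_N} => E \subset U)
  (fun _ _ => Lam ^+ 2 * ((4 * k)%:R ^+ #|U| * e U))) /=.
have cU : #|[pred D : {set 'I_N} | D \subset U]| = (2 ^ #|U|)%N.
  by rewrite -card_powerset; apply: eq_card => D; rewrite !inE.
set x := Lam ^+ 2 * ((4 * k)%:R ^+ #|U| * e U).
rewrite !sumr_const cU -mulrnA -[x *+ _]mulr_natl natrM natrX /x.
have -> : (16 * k)%:R ^+ #|U| = 2 ^+ #|U| * 2 ^+ #|U| * (4 * k)%:R ^+ #|U| :> R.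
  by rewrite -!exprMn -!natrM mulnA.
rewrite le_eqVlt; apply/orP; left; apply/eqP; ring.
Qed.

Lemma mom_sift_inv_set (m : nat) t :
  \sum_(U : {set 'I_N} | sifted_set D0 U && (lg (@logp N) U <= t)) m%:R ^+ #|U| / (qprod U)%:R =
  mom (@logp N) (fun p => m%:R * sift_inv D0 p) 0 t.
Proof.
rewrite /mom big_mkcond; apply: eq_bigr => U _; rewrite wtM.
case: (boolP (sifted_set D0 U)) => SU /=; last first.
  by case/forall_inPn: SU => p pU np; rewrite [wt (sift_inv D0) U]/wt (bigD1 p) //= {1}/sift_inv (negPf np) mul0r mulr0 mul0r.
rewrite /ramp subr_ge0; case: ifP => _; rewrite ?mulr0 // mulr1 [wt (fun=> _) U]prodr_const.
congr (_ * _); rewrite /qprod natr_prod -prodfV; apply: eq_bigr => p /(forall_inP SU) sp.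
by rewrite /sift_inv sp.
Qed.

(* Pointwise [c <= Lp + c^2 / Lp] replaces the Cauchy-Schwarz inequality. *)
Lemma weighted_error_le (e : {set 'I_N} -> R) (c d : nat) (t Lp Z1 Z2 : R) :
  0 < Lp -> 0 <= Z2 -> (forall U, 0 <= e U) ->
  \sum_(U : {set 'I_N} | sifted_set D0 U && (lg (@logp N) U <= t)) e U <= Z1 ->
  (forall U, sifted_set D0 U -> lg (@logp N) U <= t ->
     e U <= d%:R ^+ #|U| * Z2 / (qprod U)%:R) ->
  \sum_(U : {set 'I_N} | sifted_set D0 U && (lg (@logp N) U <= t)) c%:R ^+ #|U| * e U <=
  Lp * Z1 + Z2 / Lp * mom (@logp N) (fun p => (c ^ 2 * d)%:R * sift_inv D0 p) 0 t.
Proof.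
move=> Lp0 Z20 e0 S1 S2.
apply: le_trans (lerD (ler_wpM2l (ltW Lp0) S1) (lexx _)).
rewrite -mom_sift_inv_set !big_distrr -big_split /=; apply: ler_sum => U /andP[SU LU].
have cp : 0 <= c%:R ^+ #|U| :> R by rewrite exprn_ge0 ?ler0n.
have : c%:R ^+ #|U| <= Lp + (c%:R ^+ #|U|) ^+ 2 / Lp :> R.
  move: (c%:R ^+ #|U|) cp => x x0; case: (lerP x Lp) => xL.
    by apply: (le_trans xL); rewrite lerDl divr_ge0 ?exprn_ge0 // ltW.
  apply: (@le_trans _ _ (x ^+ 2 / Lp)); last by rewrite lerDr ltW.
  by rewrite ler_pdivlMr // expr2 ler_wpM2l // ltW.
move=> /(ler_wpM2r (e0 U)) /le_trans; apply; rewrite mulrDl lerD2l.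
apply: le_trans (ler_wpM2l _ (S2 U SU LU)) _; first by rewrite divr_ge0 ?exprn_ge0 // ltW.
have -> : (c ^ 2 * d)%:R ^+ #|U| = (c%:R ^+ #|U|) ^+ 2 * d%:R ^+ #|U| :> R.
  by rewrite natrM natrX exprMn exprAC.
rewrite le_eqVlt; apply/orP; left; apply/eqP; ring.
Qed.

End Sieve.

(** * The weights for a tuple of size [k] *)

Section Weights.
Variables (N D0 k : nat).
Hypotheses (k_gt1 : (1 < k)%N) (kD : (2 * k <= D0)%N).
Implicit Types (p : 'I_N) (U D : {set 'I_N}).

(* [sel_g] and [sel_g'] are the local densities of [n] with [p | prod (n+h_j)], for all [n] and
   for [n] with [n+h_i] prime; outside the sifted primes they are set to 1, where the
   coefficients vanish. *)
Definition sel_h p : R := if sifted D0 p then k%:R / (p%:R - k%:R) else 0.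
Definition sel_g p : R := if sifted D0 p then k%:R / p%:R else 1.
Definition sel_g' p : R := if sifted D0 p then (k%:R - 1) / (p%:R - 1) else 1.
(** What is left of the diagonal coefficient of the prime form after (1 + 1/(p-1))^2 is set aside.
    It is close to (k-1)/p, hence of dimension k-1. *)
Definition sel_w p : R := if sifted D0 p then (k%:R - 1) / (p%:R - k%:R) else 0.
Definition sel_lam (L be : R) : {set 'I_N} -> R := selberg sel_g sel_h (gpy (@logp N) L be).

Lemma k_gt1R : 1 < k%:R :> R. Proof. by rewrite ltr1n. Qed.

Lemma sifted_gt p : sifted D0 p -> 2 * k%:R < p%:R :> R.
Proof. by case/andP=> _ Dp; rewrite -natrM ltr_nat (leq_ltn_trans kD). Qed.

Lemma sel_g_gt0 p : 0 < sel_g p.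
Proof.
rewrite /sel_g; case: ifP => // /sifted_gt; have := k_gt1R => *.
by rewrite divr_gt0 //; lra.
Qed.

Lemma sel_g'_gt0 p : 0 < sel_g' p.
Proof.
rewrite /sel_g'; case: ifP => // /sifted_gt; have := k_gt1R => *.
by rewrite divr_gt0 //; lra.
Qed.

Lemma sel_h_ge0 p : 0 <= sel_h p.
Proof.
rewrite /sel_h; case: ifP => // /sifted_gt; have := k_gt1R => *.
by rewrite divr_ge0 //; lra.
Qed.

Lemma sel_w_ge0 p : 0 <= sel_w p.
Proof.
rewrite /sel_w; case: ifP => // /sifted_gt; have := k_gt1R => *.
by rewrite divr_ge0 //; lra.
Qed.

Lemma sel_h_g p : ((sel_g p)^-1 - 1) * sel_h p ^+ 2 = sel_h p.
Proof.
rewrite /sel_h /sel_g; case: ifP => [/sifted_gt|_]; last by rewrite expr0n mulr0.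
have := k_gt1R; move: (k%:R) (p%:R) => x y *; field.
by rewrite !gt_eqF //; lra.
Qed.

(** The passage from all integers to primes sums [y] with weight 1/(p-1), a sum of dimension 1
    covered by [mom_sift_inv_pred_ge]. *)
Lemma sel_h_g' p : sel_h p * (1 - sel_g' p / sel_g p) = sift_inv_pred D0 p.
Proof.
rewrite /sel_h /sel_g /sel_g' /sift_inv_pred; case: ifP => [/sifted_gt|_]; last by rewrite mul0r.
have := k_gt1R; move: (k%:R) (p%:R) => x y *; field.
by rewrite !gt_eqF //; lra.
Qed.

Lemma sel_w_g' p : ((sel_g' p)^-1 - 1) * (sel_g' p / sel_g p * sel_h p) ^+ 2 =
  sel_w p * (1 + sift_inv_pred D0 p) ^+ 2.
Proof.
rewrite /sel_h /sel_g /sel_g' /sel_w /sift_inv_pred.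
case: ifP => [/sifted_gt|_]; last by rewrite mulr0 expr0n mulr0 mul0r.
have := k_gt1R; move: (k%:R) (p%:R) => x y *; field.
by rewrite !gt_eqF //; lra.
Qed.

Lemma sel_hg_le2 p : sel_h p / sel_g p <= 2.
Proof.
rewrite /sel_h /sel_g; case: ifP => [/sifted_gt|_]; last by rewrite mul0r.
have := k_gt1R; move: (k%:R) (p%:R) => x y x1 yx.
have -> : x / (y - x) / (x / y) = y / (y - x) by field; rewrite !gt_eqF //; lra.
by rewrite ler_pdivrMr; lra.
Qed.

(** Compares [sel_w] with the weight of [mom_pow_ge] for j = k-1. As 1 + 1/(p-1) is the inverse of 1
    - 1/p and [1 + sel_w] is (p-1)/(p-k), Bernoulli's inequality for (1 - 1/p)^(k-1) is enough. *)
Lemma sel_w_ge p : 0 <= (1 + sift_inv_pred D0 p) ^+ k.-1 - 1 <= sel_w p.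
Proof.
rewrite subr_ge0 exprn_ege1 ?lerDl ?sift_inv_pred_ge0 //=.
rewrite /sel_w /sift_inv_pred; case: ifP => [/sifted_gt|_]; last by rewrite addr0 expr1n subrr.
have k1 : k.-1%:R = k%:R - 1 :> R by rewrite -[in RHS](prednK (ltnW k_gt1)) -natr1 addrK.
have := k_gt1R => x1 yx.
have y0 : 0 < p%:R :> R by lra.
have z0 : 0 <= (p%:R : R)^-1 <= 1.
  by rewrite invr_ge0 ltW //= invf_le1 //; lra.
have H := bernoulli_le k.-1 z0; rewrite k1 in H.
have -> : 1 + (p%:R - 1)^-1 = (1 - (p%:R)^-1)^-1 :> R by field; rewrite !gt_eqF //; lra.
rewrite exprVn lerBlDr; set u := (1 - _) ^+ _ in H *.
set x : R := k%:R in x1 yx H *; set y : R := p%:R in y0 yx H *.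
clearbody u x y => {z0 k1}.
have H2 : (y - x) / (y - 1) <= u.
  apply: le_trans H; rewrite ler_pdivrMr; last by lra.
  have -> : (1 - (x - 1) / y) * (y - 1) = y - x + (x - 1) / y by field; rewrite gt_eqF.
  by rewrite lerDl divr_ge0 //; lra.
have -> : (x - 1) / (y - x) + 1 = ((y - x) / (y - 1))^-1 by field; rewrite !gt_eqF //; lra.
rewrite lef_pV2 // posrE; first apply: lt_le_trans H2.
all: rewrite divr_gt0 //; lra.
Qed.

Local Notation W := (primorial D0).
Local Notation mom := (mom (@logp N)).
(** A bound for the product of 1 + k^2/(p(p-k)) over the primes p > D0; it tends to 1 as [D0]
    grows. *)
Definition sel_corr : R := (1 - k%:R ^+ 2 / (D0%:R - k%:R))^-1.
(** The shift of [mom_mul_le] in dimension [k], from the shift [W + 1] of [mom_sift_inv_le]. *)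
Definition sel_C : R := k%:R * (W%:R + 1 + 1).

Lemma mom_sift_mul_le (m : nat) s : 0 <= s ->
  mom (fun p => m%:R * sift_inv D0 p) 0 s <=
  dens D0 ^+ m / (m`!)%:R * (s + m%:R * (W%:R + 1 + 1)) ^+ m.
Proof.
apply: (mom_mul_le (@logp_ge0 N)) => //; first exact: sift_inv_ge0.
- exact: ltW (dens_gt0 D0).
- by rewrite addr_ge0 ?ler0n.
- by move=> t t0; apply: mom_sift_inv_le.
Qed.

Hypothesis kD2 : k%:R ^+ 2 < D0%:R - k%:R :> R.

Lemma sel_corr_ge0 : 0 <= sel_corr.
Proof.
rewrite /sel_corr invr_ge0 subr_ge0 ler_pdivrMr ?mul1r ?ltW //.
by apply: le_lt_trans kD2; rewrite exprn_ge0 ?ler0n.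
Qed.

(** k/(p-k) = k/p + k^2/(p(p-k)). The second, summable part is removed at the cost of [sel_corr],
    and the first is a sum of dimension [k]. *)
Lemma mom_sel_h_le0 s : 0 <= s ->
  mom sel_h 0 s <= (sel_corr * dens D0 ^+ k) / (k`!)%:R * (s + sel_C) ^+ k.
Proof.
move=> s0.
pose c p : R := if sifted D0 p then k%:R ^+ 2 / (p%:R * (p%:R - k%:R)) else 0.
have c0 p : 0 <= c p.
  rewrite /c; case: ifP => // /sifted_gt; have := k_gt1R => *.
  by rewrite divr_ge0 ?exprn_ge0 ?ler0n // mulr_ge0 //; lra.
have kb0 p : 0 <= k%:R * sift_inv D0 p by rewrite mulr_ge0 ?ler0n ?sift_inv_ge0.
have -> : mom sel_h 0 s = mom (fun p => c p + k%:R * sift_inv D0 p) 0 s.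
  apply: eq_mom => p; rewrite /sel_h /c /sift_inv; case: ifP => [/sifted_gt|_]; last by rewrite mulr0 addr0.
  have := k_gt1R; move: (k%:R) (p%:R) => x y *; field.
  by rewrite !gt_eqF //; lra.
apply: le_trans (mom_removal (@logp_ge0 N) s c0 kb0) _.
rewrite -!mulrA; apply: ler_pM.
- by rewrite -sum_wt sumr_ge0 // => A _; rewrite wt_ge0.
- exact: mom_ge0.
- rewrite /sel_corr -[leRHS]mulr1 ler_pdivlMl; last first.
    rewrite subr_gt0 ltr_pdivrMr ?mul1r //.
    by apply: le_lt_trans kD2; rewrite exprn_ge0 ?ler0n.
  rewrite mulrC.
  apply: le_trans (prod_1D_bound (index_enum _) xpredT c0).
  apply: ler_wpM2l; first by rewrite -sum_wt sumr_ge0 // => A _; rewrite wt_ge0.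
  by rewrite lerB // sum_sift_corr_le // (leq_trans _ kD) // mul2n -addnn -addn1 leq_add2l ltnW.
- by rewrite mulrA; apply: mom_sift_mul_le.
Qed.

Lemma sel_C_ge0 : 0 <= sel_C.
Proof. by rewrite mulr_ge0 ?addr_ge0 ?ler0n. Qed.

(** The square of [gpy] combines the moments of order 0, 1, 2 of [sel_h]; in dimension [k] the
    moment of order n brings n!/(n+k)!, so the bracket is the integral I. *)
Lemma sel_form_le L be : 0 <= L -> 0 <= be ->
  \sum_D \sum_(E : {set 'I_N}) sel_lam L be D * sel_lam L be E * wt sel_g (D :|: E) <=
  sel_corr * dens D0 ^+ k * (L + (sel_C + 2)) ^+ (k + 2) *
   (1 / (k`!)%:R + 4 * be / ((k + 1)`!)%:R + 8 * be ^+ 2 / ((k + 2)`!)%:R).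
Proof.
move=> L0 be0; rewrite selberg_form_diag; first last.
- exact: sel_h_g.
- by move=> p; rewrite gt_eqF // sel_g_gt0.
rewrite sum_gpy_sq; set K := sel_corr * dens D0 ^+ k.
have K0 : 0 <= K by rewrite mulr_ge0 ?sel_corr_ge0 // exprn_ge0 // ltW // dens_gt0.
have C0 := sel_C_ge0.
have M n := @mom_raise_le R 'I_N (@logp N) (@logp_ge0 N) sel_h k K sel_C sel_h_ge0 K0 C0 mom_sel_h_le0 n L L0.
set X := L + (sel_C + 2).
have LX : L <= X by rewrite lerDl addr_ge0.
have X0 : 0 <= X by apply: le_trans LX.
have up (n m : nat) : (n <= 2)%N -> (m + n = 2)%N ->
    L ^+ m * mom sel_h n L <= K * (n`!)%:R / ((n + k)`!)%:R * X ^+ (k + 2).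
  move=> n2 mn; have -> : X ^+ (k + 2) = X ^+ m * X ^+ (n + k).
    by rewrite -exprD; congr (_ ^+ _); lia.
  rewrite mulrCA; apply: ler_pM; rewrite ?exprn_ge0 ?mom_ge0 //; first exact: sel_h_ge0.
    by rewrite lerXn2r.
  apply: le_trans (M n) _; apply: ler_wpM2l; first by rewrite divr_ge0 ?ler0n // mulr_ge0 ?ler0n.
  rewrite lerXn2r ?nnegrE ?addr_ge0 ?ler0n // /X !lerD2l.
  by rewrite (ler_nat R n 2).
have u0 := up 0%N 2%N isT erefl; have u1 := up 1%N 1%N isT erefl; have u2 := up 2%N 0%N isT erefl.
move: u0 u1 u2; rewrite expr1 expr0 mul1r fact0 add0n add1n add2n addn1 addn2.
set Y := X ^+ _; rewrite (_ : 1`! = 1%N) // (_ : 2`! = 2%N) // => u0 u1 u2.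
have b1 := ler_wpM2l (mulr_ge0 (ler0n R 4) be0) u1.
have b2 := ler_wpM2l (mulr_ge0 (ler0n R 4) (exprn_ge0 2 be0)) u2.
rewrite -[4 * be * L * _]mulrA; apply: le_trans (lerD (lerD u0 b1) b2) _.
rewrite le_eqVlt; apply/orP; left; apply/eqP.
by move: (k`!%:R^-1) (k.+1`!%:R^-1) (k.+2`!%:R^-1) => x y z; ring.
Qed.

(** Two factors [dens D0] come from the squared inner sum and [k.-1] from [sel_w]. The moments of
    order 2, 3, 4 in dimension k-1 make the bracket the integral J. *)
Lemma sel_form_ge L be : 0 <= L -> 0 <= be -> (D0 < N)%N -> exp L < N%:R ->
  dens D0 ^+ k.+1 * L ^+ (k + 3) *
   (2 / ((k + 1)`!)%:R + 12 * be / ((k + 2)`!)%:R + 24 * be ^+ 2 / ((k + 3)`!)%:R) <=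
  \sum_D \sum_(E : {set 'I_N}) sel_lam L be D * sel_lam L be E * wt sel_g' (D :|: E).
Proof.
move=> L0 be0 DN LN; have d0 : 0 <= dens D0 by apply/ltW/dens_gt0.
have low s : 0 <= s <= L -> dens D0 * s <= mom (sift_inv_pred D0) 0 s.
  move=> /andP[s0 sL]; apply: mom_sift_inv_pred_ge => //.
  by apply: le_lt_trans LN; apply: ler_exp.
have bp := @sift_inv_pred_ge0 N D0.
apply: le_trans (selberg_form_ge (@logp_ge0 N) _ _ sel_h_g' bp sel_w_ge0 d0 L0 be0 sel_w_g' low);
  [|by move=> p; rewrite gt_eqF // sel_g_gt0|by move=> p; rewrite gt_eqF // sel_g'_gt0].
have a0 p : 0 <= (1 + sift_inv_pred D0 p) ^+ k.-1 - 1 by have /andP[] := sel_w_ge p.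
have dk0 : 0 <= dens D0 ^+ k.-1 by rewrite exprn_ge0.
have M n : dens D0 ^+ k.-1 * (n`!)%:R / ((n + k.-1)`!)%:R * L ^+ (n + k.-1) <= mom sel_w n L.
  apply: le_trans (@mom_le _ _ (@logp N) _ _ n L sel_w_ge); apply: (mom_raise_ge a0 dk0 (L := L)); last by rewrite L0 lexx.
  exact: (mom_pow_ge (@logp_ge0 N) bp d0 low).
have up (n m : nat) : (m + n = 4)%N ->
    dens D0 ^+ k.-1 * (n`!)%:R / ((n + k.-1)`!)%:R * L ^+ (k + 3) <= L ^+ m * mom sel_w n L.
  move=> mn; have -> : L ^+ (k + 3) = L ^+ m * L ^+ (n + k.-1).
    by rewrite -exprD; congr (_ ^+ _); lia.
  by rewrite mulrCA ler_wpM2l ?exprn_ge0.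
have u2 := up 2%N 2%N erefl; have u3 := up 3%N 1%N erefl; have u4 := up 4%N 0%N erefl.
move: u2 u3 u4; rewrite expr1 expr0 mul1r.
have -> : (2 + k.-1 = k + 1)%N by lia.
have -> : (3 + k.-1 = k + 2)%N by lia.
have -> : (4 + k.-1 = k + 3)%N by lia.
rewrite (_ : 2`! = 2%N) // (_ : 3`! = 6%N) // (_ : 4`! = 24%N) // => u2 u3 u4.
have b3 := ler_wpM2l (mulr_ge0 (ler0n R 2) be0) u3.
have b4 := ler_wpM2l (exprn_ge0 2 be0) u4.
have := lerD (lerD u2 b3) b4; rewrite ![2 * be * (_ * _)]mulrA => H.
have := ler_wpM2l (exprn_ge0 2 d0) H; apply: le_trans.
have -> : dens D0 ^+ k.+1 = dens D0 ^+ 2 * dens D0 ^+ k.-1 by rewrite -exprD; congr (_ ^+ _); lia.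
rewrite le_eqVlt; apply/orP; left; apply/eqP.
move: (((k + 1)`!)%:R^-1) (((k + 2)`!)%:R^-1) (((k + 3)`!)%:R^-1) (dens D0 ^+ k.-1) (L ^+ _) => x y z u w.
by ring.
Qed.

Lemma sel_lam_abs L be D : 0 <= L -> 0 <= be ->
  `|sel_lam L be D| <= 2 ^+ #|D| *
     ((1 + 2 * be) * L * ((sel_corr * dens D0 ^+ k) / (k`!)%:R * (L + sel_C) ^+ k)).
Proof.
move=> L0 be0.
apply: le_trans (selberg_abs (@logp_ge0 N) D sel_g_gt0 sel_h_ge0 sel_hg_le2 L0 be0) _.
rewrite ler_wpM2l ?exprn_ge0 //; apply: ler_wpM2l; last exact: mom_sel_h_le0.
by rewrite mulr_ge0 ?addr_ge0 ?mulr_ge0.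
Qed.

Lemma sel_lam_eq0 L be D :
  ~~ (sifted_set D0 D && (lg (@logp N) D <= L)) -> sel_lam L be D = 0.
Proof.
rewrite negb_and -ltNge orbC => H; apply: (selberg_eq0 (@logp_ge0 N)).
case/orP: H => [-> //|/forall_inPn[p pD np]]; apply/orP; right.
by apply/exists_inP; exists p => //; rewrite /sel_h (negPf np).
Qed.

End Weights.

(** * Arithmetic progressions *)

Section BigRmax.
Variables (I : eqType) (r : seq I) (P : pred I) (F : I -> R).

Lemma bigRmax_ge i : i \in r -> P i -> F i <= \big[Rmax/0]_(j <- r | P j) F j.
Proof.
elim: r => // j s IH; rewrite inE big_cons => /orP[/eqP <- Pi|is_ Pi].
  by rewrite Pi; apply/RleP/Rmax_l.
case: ifP => _; last exact: IH.
by apply: le_trans (IH is_ Pi) _; apply/RleP/Rmax_r.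
Qed.

Lemma bigRmax_le B : 0 <= B -> (forall i, P i -> F i <= B) ->
  \big[Rmax/0]_(j <- r | P j) F j <= B.
Proof.
move=> B0 FB; elim/big_ind: _ => // x y xB yB.
by apply/RleP/Rmax_lub; apply/RleP.
Qed.

Lemma bigRmax_ge0 : 0 <= \big[Rmax/0]_(j <- r | P j) F j.
Proof.
elim: r => [|j s IH]; first by rewrite big_nil.
rewrite big_cons; case: ifP => // _; apply: le_trans IH _; apply/RleP/Rmax_r.
Qed.

End BigRmax.

Section Devs.

Lemma liouville_norm n : `|liouville n| = 1.
Proof. by rewrite /liouville -exprnP normrX normrN1 expr1n. Qed.

Lemma liouvilleP n : liouville n = 1 \/ liouville n = -1.
Proof.
rewrite /liouville -exprnP -signr_odd; case: odd; [right|left]; rewrite ?expr1 ?expr0 //.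
Qed.

Lemma sum_nat_diff (P : pred nat) (F : nat -> R) (a b c : nat) : (a <= b)%N -> (b <= c)%N ->
  \sum_(b <= i < c | P i) F i = \sum_(a <= i < c | P i) F i - \sum_(a <= i < b | P i) F i.
Proof. by move=> ab bc; rewrite (big_cat_nat ab bc) /= [X in _ = X - _]addrC addrK. Qed.

Lemma count_class (m c y : nat) : (c < m)%N ->
  (\sum_(0 <= n < y) ((n %% m)%N == c : nat) = (y + (m.-1 - c)) %/ m)%N.
Proof.
move=> cm; have m0 : (0 < m)%N by apply: leq_trans cm.
elim: y => [|y IH].
  by rewrite big_geq // add0n divn_small //; lia.
rewrite big_nat_recr //= IH addSn divnS // addnC; congr (_ + _)%N.
have -> : (y + (m.-1 - c)).+1 = (y + (m - c))%N by lia.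
congr nat_of_bool; apply/eqP/idP => [yc|].
  by rewrite /dvdn -modnDml yc subnKC ?modnn // ltnW.
rewrite /dvdn => /eqP H; rewrite -[RHS](modn_small cm); apply/eqP.
by rewrite -(eqn_modDr (m - c)) H subnKC ?modnn // ltnW.
Qed.

Lemma count_class_bounds (m c y : nat) : (c < m)%N ->
  y%:R / m%:R - 1 <= \sum_(0 <= n < y | (n %% m)%N == c) (1 : R) <= y%:R / m%:R + 1.
Proof.
move=> cm; have m0 : (0 < m)%N by apply: leq_trans cm.
have mp : 0 < m%:R :> R by rewrite ltr0n.
have -> : \sum_(0 <= n < y | (n %% m)%N == c) (1 : R) = ((y + (m.-1 - c)) %/ m)%:R.
  rewrite -(count_class y cm) natr_sum big_mkcond; apply: eq_bigr => n _.
  by case: eqP.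
set z := (y + (m.-1 - c))%N.
have h1 : (z %/ m * m <= z)%N by apply: leq_trunc_div.
have h2 : (z < (z %/ m).+1 * m)%N by apply: ltn_ceil.
apply/andP; split.
  rewrite lerBlDr ler_pdivrMr // natr1 -natrM ler_nat.
  by apply: leq_trans (ltnW h2); rewrite leq_addr.
have -> : y%:R / m%:R + 1 = (y + m)%:R / m%:R :> R by rewrite natrD mulrDl mulfV ?gt_eqF.
by rewrite ler_pdivlMr // -natrM ler_nat; apply: leq_trans h1 _; rewrite /z; lia.
Qed.

Lemma count_class_shift (N m c : nat) : (c < m)%N ->
  `|\sum_(N.+1 <= n < (N + N).+1 | (n %% m)%N == c) (1 : R) - N%:R / m%:R| <= 2.
Proof.
move=> cm; have /andP[a1 a2] := count_class_bounds N.+1 cm.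
have /andP[b1 b2] := count_class_bounds (N + N).+1 cm.
rewrite (@sum_nat_diff _ _ 0) // ?ltnS ?leq_addr //.
have eN : (N + N).+1%:R / m%:R = N%:R / m%:R + N.+1%:R / m%:R :> R.
  by rewrite -mulrDl -natrD addnS.
rewrite eN in b1 b2; move: a1 a2 b1 b2; set u := N%:R / _; set w := N.+1%:R / _.
move: (\sum_(0 <= n < N.+1 | _) _) (\sum_(0 <= n < (N + N).+1 | _) _) u w => x y u w *.
by rewrite ler_norml; apply/andP; split; lra.
Qed.

(** Carries a class in (N, 2N] to one in (M, M+N]. Since n > N, the subtraction [n - N] does not
    truncate; with M = N + r a negative [r] is handled too. *)
Lemma shift_class (F : nat -> R) (N M m c c' : nat) : (c < m)%N -> (c' < m)%N ->
  (c' + N = c + M %[mod m])%N ->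
  \sum_(N.+1 <= n < (N + N).+1 | (n %% m)%N == c) F (n - N + M)%N =
  \sum_(M.+1 <= j < (M + N).+1 | (j %% m)%N == c') F j.
Proof.
move=> cm cm' e.
rewrite -{1}[N.+1]add0n big_addn -{1}[M.+1]add0n big_addn !subSS !addKn.
apply: eq_big => [i|i _]; last by congr F; lia.
have s : (i + N.+1 + M = i + M.+1 + N)%N by lia.
apply/eqP/eqP => H.
  rewrite -[RHS](modn_small cm'); apply/eqP; rewrite -(eqn_modDr N) e -s eqn_modDr.
  by rewrite H modn_small.
rewrite -[RHS](modn_small cm); apply/eqP; rewrite -(eqn_modDr M) -e s eqn_modDr.
by rewrite H modn_small.
Qed.

Lemma liouvDev_ge N m y a : (y <= N)%N -> (a < m)%N -> `|lambda_ap y m a| <= liouvDev N m.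
Proof.
move=> yN am; have yN1 : (y < N.+1)%N by [].
apply: le_trans (@bigRmax_ge _ _ xpredT
  (fun y : 'I_N.+1 => \big[Rmax/0]_(a < m) Rabs (lambda_ap y m a)) (Ordinal yN1) _ isT);
  last exact: mem_index_enum.
apply: le_trans (@bigRmax_ge _ _ xpredT (fun a : 'I_m => Rabs (lambda_ap y m a)) (Ordinal am) _ isT);
  last exact: mem_index_enum.
by rewrite RabsE.
Qed.

Lemma liouvDev_ge0 N m : 0 <= liouvDev N m.
Proof. exact: bigRmax_ge0. Qed.

Lemma liouvDev_le N m : liouvDev N m <= N%:R / m%:R + 2.
Proof.
have B0 : 0 <= N%:R / m%:R + 2 :> R by rewrite addr_ge0 ?divr_ge0 ?ler0n.
apply: bigRmax_le => // y _; apply: bigRmax_le => // a _; rewrite RabsE /lambda_ap.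
apply: le_trans (ler_norm_sum _ _ _) _.
have m0 : (0 < m)%N by apply: leq_ltn_trans (ltn_ord a).
apply: (@le_trans _ _ (\sum_(0 <= n < y.+1 | (n %% m)%N == a) (1 : R))).
  rewrite [leRHS](@big_cat_nat _ _ _ 1%N) //=.
  rewrite -[leLHS]add0r lerD ?sumr_ge0 //.
  by apply: ler_sum => n _; rewrite liouville_norm.
have /andP[_] := count_class_bounds y.+1 (ltn_ord a); move=> /le_trans; apply.
rewrite -natr1 mulrDl mul1r -addrA lerD //.
  by rewrite ler_wpM2r ?invr_ge0 ?ler0n // ler_nat -ltnS.
have : (m%:R : R)^-1 <= 1 by rewrite invf_le1 ?ltr0n // ler1n.
lra.
Qed.

Lemma liouville_class (N m c : nat) (r : int) : (c < m)%N -> (`|r| <= N)%N ->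
  `|\sum_(N.+1 <= n < (N + N).+1 | (n %% m)%N == c) liouville `|(n%:Z + r)%R|%N| <=
  2 * liouvDev (N + N + `|r|) m.
Proof.
move=> cm rN; have m0 : (0 < m)%N by apply: leq_ltn_trans cm.
(* [|r| <= N] makes [M] equal to N + r, and [N * m.-1] stands for -N modulo [m]. Both ends [M] and
   [M + N] are at most 2N + |r|, so the maximum over y in (B) covers them together. *)
pose M := `|(N%:Z + r)%R|%N; pose c' := ((c + M + N * m.-1) %% m)%N.
have cm' : (c' < m)%N by rewrite ltn_pmod.
have e : (c' + N = c + M %[mod m])%N.
  rewrite /c' modnDml -addnA -mulnSr prednK // addnC modnMDl //.
have -> : \sum_(N.+1 <= n < (N + N).+1 | (n %% m)%N == c) liouville `|(n%:Z + r)%R|%N =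
   \sum_(N.+1 <= n < (N + N).+1 | (n %% m)%N == c) liouville (n - N + M)%N.
  rewrite big_nat_cond [RHS]big_nat_cond; apply: eq_bigr => n /andP[/andP[Nn _] _].
  by congr liouville; rewrite /M; lia.
rewrite (shift_class liouville cm cm' e).
rewrite (@sum_nat_diff _ _ 1) // ?ltnS ?leq_addr // -!/(lambda_ap _ _ _).
apply: le_trans (ler_normB _ _) _.
have b1 : `|lambda_ap (M + N) m c'| <= liouvDev (N + N + `|r|) m by apply: liouvDev_ge => //; rewrite /M; lia.
have b2 : `|lambda_ap M m c'| <= liouvDev (N + N + `|r|) m by apply: liouvDev_ge => //; rewrite /M; lia.
lra.
Qed.

Definition logprime (n : nat) : R := if prime n then ln n%:R else 0.

Lemma theta_apE N q a : theta_ap N q a = \sum_(0 <= p < N.+1 | (p %% q)%N == a) logprime p.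
Proof.
rewrite /theta_ap big_mkcond [RHS]big_mkcond; apply: eq_bigr => p _.
by rewrite /logprime INRE; case: prime; case: eqP.
Qed.

Lemma primeDev_ge0 N m : 0 <= primeDev N m.
Proof. exact: bigRmax_ge0. Qed.

Lemma primeDev_ge N m a : (a < m)%N -> coprime a m ->
  `|theta_ap N m a - N%:R / (totient m)%:R| <= primeDev N m.
Proof.
move=> am cam.
apply: le_trans (@bigRmax_ge _ _ (fun a : 'I_m => coprime a m)
  (fun a : 'I_m => Rabs (theta_ap N m a - INR N / INR (totient m))) (Ordinal am) _ cam);
  last exact: mem_index_enum.
by rewrite RabsE !INRE.
Qed.

(** (A) has no maximum over initial segments, so the two ends of the interval are charged
    separately, at 2N + h and N + h. *)
Lemma prime_class (N m c h : nat) : (c < m)%N -> coprime (c + h) m ->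
  `|\sum_(N.+1 <= n < (N + N).+1 | (n %% m)%N == c) logprime (n + h) - N%:R / (totient m)%:R|
   <= primeDev (N + N + h) m + primeDev (N + h) m.
Proof.
move=> cm cop; have m0 : (0 < m)%N by apply: leq_ltn_trans cm.
pose M := (N + h)%N; pose c' := ((c + h) %% m)%N.
have cm' : (c' < m)%N by rewrite ltn_pmod.
have e : (c' + N = c + M %[mod m])%N by rewrite /c' modnDml /M; congr (_ %% _)%N; lia.
have -> : \sum_(N.+1 <= n < (N + N).+1 | (n %% m)%N == c) logprime (n + h) =
   \sum_(N.+1 <= n < (N + N).+1 | (n %% m)%N == c) logprime (n - N + M)%N.
  rewrite big_nat_cond [RHS]big_nat_cond; apply: eq_bigr => n /andP[/andP[Nn _] _].
  by congr logprime; rewrite /M; lia.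
rewrite (shift_class logprime cm cm' e).
rewrite (@sum_nat_diff _ _ 0) // ?ltnS ?leq_addr // -!theta_apE.
have cop' : coprime c' m by rewrite /c' coprime_modl.
have b1 := primeDev_ge (M + N) cm' cop'; have b2 := primeDev_ge M cm' cop'.
have eM : (M + N = N + N + h)%N by rewrite /M; lia.
rewrite -/M -eM.
have -> : N%:R / (totient m)%:R = (M + N)%:R / (totient m)%:R - M%:R / (totient m)%:R :> R.
  by rewrite natrD mulrDl [X in X - _]addrC addrK.
set x := theta_ap _ _ _ in b1 *; set y := theta_ap _ _ _ in b2 *.
set z := _ / _ in b1 *; set w := _ / _ in b2 *.
have -> : x - y - (z - w) = (x - z) - (y - w) by ring.
by apply: le_trans (ler_normB _ _) _; rewrite lerD.
Qed.

Lemma primeDev_le N m : (0 < N)%N ->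
  primeDev N m <= (N%:R / m%:R + 2) * ln N%:R + N%:R / (totient m)%:R.
Proof.
move=> N0; have lN : 0 <= ln N%:R by rewrite ln_ge0 // ler1n.
have B1 : 0 <= (N%:R / m%:R + 2) * ln N%:R by rewrite mulr_ge0 // addr_ge0 ?divr_ge0 ?ler0n.
have B2 : 0 <= N%:R / (totient m)%:R :> R by rewrite divr_ge0 ?ler0n.
apply: bigRmax_le => [|a cam]; first by rewrite addr_ge0.
rewrite RabsE !INRE; apply: le_trans (ler_normB _ _) _; apply: lerD; last by rewrite ger0_norm.
have m0 : (0 < m)%N by apply: leq_ltn_trans (ltn_ord a).
rewrite theta_apE; apply: le_trans (ler_norm_sum _ _ _) _.
apply: (@le_trans _ _ (\sum_(0 <= n < N.+1 | (n %% m)%N == a) 1 * ln N%:R)).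
  rewrite big_nat_cond [leRHS]big_nat_cond; apply: ler_sum => n /andP[/andP[_ nN] _].
  rewrite mul1r /logprime; case: ifP => [pn|_]; last by rewrite normr0.
  have n0 := prime_gt0 pn; rewrite ger0_norm ?ln_ge0 ?ler1n //.
  by rewrite ler_ln ?ltr0n // ler_nat -ltnS.
rewrite -big_distrl /= ler_wpM2r //.
have /andP[_] := count_class_bounds N.+1 (ltn_ord a); move=> /le_trans; apply.
rewrite -natr1 mulrDl mul1r -addrA lerD2l.
have : (m%:R : R)^-1 <= 1 by rewrite invf_le1 ?ltr0n // ler1n.
lra.
Qed.

Lemma qbound_ge (m N : nat) (e : R) : m%:R <= Rpower N%:R e -> (m <= qbound N e)%N.
Proof.
rewrite /qbound INRE; set x := Rpower _ _ => mx.
have [_ b2] := base_Int_part x.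
have H : Z.lt (Z.of_nat m) (Z.add (Int_part x) 1).
  apply: lt_IZR; rewrite plus_IZR -INR_IZR_INZ INRE.
  apply/RltP; apply: le_lt_trans mx _.
  have b3 : -1 < IZR (Int_part x) - x by apply/RltP.
  suff : x < IZR (Int_part x) + (1 : R) by [].
  by move: (IZR _) b3 => z; lra.
lia.
Qed.

End Devs.

Lemma totient_qprod N (U : {set 'I_N}) : prime_set U ->
  totient (qprod U) = (\prod_(p in U) (p : nat).-1)%N.
Proof.
move=> /forall_inP PU; rewrite /qprod -!big_enum /=.
have : {subset enum U <= U} by move=> p; rewrite mem_enum.
elim: (enum U) (enum_uniq (mem U)) => [|p s IH] /=; first by rewrite !big_nil.
move=> /andP[ps us] sub; rewrite !big_cons totient_coprime.
  rewrite totient_prime ?PU ?sub ?mem_head // IH // => r rs; rewrite sub // inE rs orbT //.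
rewrite prime_coprime ?PU ?sub ?mem_head //.
rewrite Euclid_dvd_prod ?PU ?sub ?mem_head // big_has; apply/hasPn => r rs.
rewrite dvdn_prime2 ?PU ?sub ?mem_head ?inE ?rs ?orbT //.
by apply: contra ps => /eqP /val_inj ->.
Qed.

(** The class in which the sieve starts, built prime by prime: at [p], [v] is the negative of a
    residue [a] missed by [H], so [p] divides no [v + h]. *)
Lemma admissible_residue (H : seq nat) D : admissible H ->
  exists2 v, (v < primorial D)%N & forall h, h \in H -> coprime (v + h) (primorial D).
Proof.
move=> adm; elim: D => [|D [v vW cv]].
  by exists 0%N; rewrite ?primorial_gt0 // => h _; rewrite /primorial big_mkcond big_ord1 /= coprimen1.
rewrite primorialS; case: ifP => pD; last first.
  by exists v; rewrite ?muln1 // => h hH; rewrite muln1 cv.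
set W := primorial D in vW cv *; have cop : coprime W D.+1.
  by rewrite coprime_sym coprime_primorial.
have [a Ha] := adm _ pD.
pose x := chinese W D.+1 v (D.+1 - a); exists (x %% (W * D.+1))%N.
  by rewrite ltn_pmod // muln_gt0 primorial_gt0.
move=> h hH; rewrite coprimeMr; apply/andP; split.
  rewrite -coprime_modl -modnDml modn_dvdm ?dvdn_mulr // chinese_modl // modnDml coprime_modl.
  exact: cv.
rewrite coprime_sym prime_coprime // dvdn_modD ?dvdn_mull //.
apply: contra (Ha h hH); rewrite /dvdn -modnDml chinese_modr // modnDml => /eqP e.
rewrite -[X in _ == X](modn_small (ltn_ord a)) -(eqn_modDl (D.+1 - a)) e.
by rewrite subnK ?modnn // ltnW.
Qed.

(** * The weighted sums *)

Section Estimates.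
Variables (N D0 : nat) (H : seq nat) (v : nat) (L be : R).
Local Notation k := (size H).
Local Notation W := (primorial D0).
Implicit Types (U D E : {set 'I_N}).
Hypotheses (k_gt1 : (1 < k)%N) (kD : (2 * k <= D0)%N) (uH : uniq H).
Hypothesis HD : forall h, h \in H -> (h <= D0)%N.
Hypothesis vW : (v < W)%N.
Hypothesis cv : forall h, h \in H -> coprime (v + h) W.
Variable Lam : R.
Hypothesis lamB : forall D, `|sel_lam D0 k L be D| <= 2 ^+ #|D| * Lam.

Definition sweight (n : nat) : R := (\sum_(D : {set 'I_N} | hits H D n) sel_lam D0 k L be D) ^+ 2.
Definition ssum (a : nat -> R) : R :=
  \sum_(N.+1 <= n < (N + N).+1 | (n %% W)%N == v) a n * sweight n.
Definition sform (g : 'I_N -> R) : R := \sum_(D : {set 'I_N}) \sum_(E : {set 'I_N})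
  sel_lam D0 k L be D * sel_lam D0 k L be E * wt g (D :|: E).
(** [e q] bounds the discrepancy in a single class modulo [q]. *)
Definition serr (e : nat -> R) : R :=
  Lam ^+ 2 * \sum_(U : {set 'I_N} | sifted_set D0 U && (lg (@logp N) U <= 2 * L))
     (16 * k)%:R ^+ #|U| * e (W * qprod U)%N.

Lemma ssum_est (a : nat -> R) (g : 'I_N -> R) (X : R) (e : nat -> R) :
  (forall q, 0 <= e q) ->
  (forall U, sifted_set D0 U ->
    `|\sum_(N.+1 <= n < (N + N).+1 | ((n %% W)%N == v) && hits H U n) a n - X * wt g U|
     <= k%:R ^+ #|U| * e (W * qprod U)%N) ->
  `|ssum a - X * sform g| <= serr e.
Proof.
move=> e0 Ha; rewrite /ssum /sweight sieve_expand.
apply: (@sieve_error _ D0 (sel_lam D0 k L be)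
  (fun U => \sum_(N.+1 <= n < (N + N).+1 | ((n %% W)%N == v) && hits H U n) a n)
  g X L Lam (fun U => e (W * qprod U)%N) k) => //.
- by move=> D; apply: sel_lam_eq0.
- by move=> U SU _; apply: Ha.
Qed.

Lemma wt_sel_g U : sifted_set D0 U -> wt (sel_g D0 k) U = k%:R ^+ #|U| / (qprod U)%:R.
Proof.
move=> SU; rewrite /qprod natr_prod -prodfV -prodr_const -big_split /=.
by apply: eq_bigr => p /(forall_inP SU) sp; rewrite /sel_g sp.
Qed.

Lemma wt_sel_g' U : sifted_set D0 U ->
  wt (sel_g' D0 k) U = (k.-1)%:R ^+ #|U| / (totient (qprod U))%:R.
Proof.
move=> SU; rewrite totient_qprod ?(sifted_prime_set SU) // natr_prod -prodfV -prodr_const -big_split /=.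
apply: eq_bigr => p /(forall_inP SU) sp; rewrite /sel_g' sp.
have pr (n : nat) : (0 < n)%N -> n.-1%:R = n%:R - 1 :> R.
  by move=> n0; rewrite -[in RHS](prednK n0) -natr1 addrK.
by rewrite (pr k (ltnW k_gt1)) (pr p) //; case/andP: sp => /prime_gt0.
Qed.

Lemma ssum_one :
  `|ssum (fun=> 1) - N%:R / W%:R *
     sform (sel_g D0 k)|
  <= serr (fun=> 2).
Proof.
apply: ssum_est => // U SU; rewrite wt_sel_g //.
have -> : N%:R / W%:R * (k%:R ^+ #|U| / (qprod U)%:R) = k%:R ^+ #|U| * (N%:R / (W * qprod U)%:R) :> R.
  by rewrite natrM invfM; ring.
by apply: class_sum => // c cm _ _; apply: count_class_shift.
Qed.

(** The main term is 0, so the general estimate is applied with [X = 0] and a dummy density. *)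
Lemma ssum_liouville (r : int) : (`|r| <= N)%N ->
  `|ssum (fun n => liouville `|(n%:Z + r)%R|%N)| <=
  serr (fun q => 2 * liouvDev (N + N + `|r|) q).
Proof.
move=> rN.
have := @ssum_est (fun n => liouville `|(n%:Z + r)%R|%N) (fun=> 1) 0
  (fun q => 2 * liouvDev (N + N + `|r|) q).
rewrite mul0r subr0; apply => [q|U SU]; first by rewrite mulr_ge0 ?liouvDev_ge0.
rewrite mul0r subr0 -[X in `|X|]subr0 -[X in _ - X](mulr0 (k%:R ^+ #|U|)).
by apply: class_sum => // c cm _ _; rewrite subr0; apply: liouville_class.
Qed.

(** When [n + h] is prime, [h] cannot be the element hit by a sieving prime. This leaves k-1 classes
    modulo each p, out of the p-1 reduced ones for [n + h], whence [sel_g']. *)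
Lemma ssum_prime h : h \in H ->
  `|ssum (fun n => logprime (n + h)) - N%:R / (totient W)%:R *
     sform (sel_g' D0 k)|
  <= serr (fun q => primeDev (N + N + h) q + primeDev (N + h) q).
Proof.
move=> hH; apply: ssum_est => [q|U SU]; first by rewrite addr_ge0 ?primeDev_ge0.
have sz : size (rem h H) = k.-1 by rewrite size_rem.
have PU := sifted_prime_set SU.
(* A prime dividing both [c + h] and [c + h'] would divide their difference, while [h] and [h'] are
   distinct and at most [D0 < p]. Hence the selected classes are prime to the modulus. *)
have notboth (p : 'I_N) c h' : p \in U -> h' \in rem h H -> (p %| c + h')%N -> ~~ (p %| c + h)%N.
  move=> /(forall_inP SU) /andP[pp Dp]; rewrite mem_rem_uniq // inE => /andP[nh h'H] d'.
  apply/negP => d; case/negP: nh.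
  have hp : (h < p)%N by apply: leq_ltn_trans (HD hH) Dp.
  have hp' : (h' < p)%N by apply: leq_ltn_trans (HD h'H) Dp.
  have : c + h' == c + h %[mod p] by move: d d'; rewrite /dvdn => /eqP -> /eqP ->.
  by rewrite eqn_modDl !modn_small.
(* A prime [n + h] exceeds N, whereas every [p] in [U] is below N; so [p] does not divide it. *)
have -> : \sum_(N.+1 <= n < (N + N).+1 | ((n %% W)%N == v) && hits H U n) logprime (n + h) =
  \sum_(N.+1 <= n < (N + N).+1 | ((n %% W)%N == v) && hits (rem h H) U n) logprime (n + h).
  rewrite big_nat_cond big_mkcond [RHS]big_nat_cond [RHS]big_mkcond; apply: eq_bigr => n _.
  case: (boolP (N.+1 <= n < _)%N) => //= /andP[Nn _]; case: eqP => //= _.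
  rewrite /logprime; case: (boolP (prime (n + h))) => pn; last by rewrite !if_same.
  have -> // : hits H U n = hits (rem h H) U n.
  apply: eq_forallb_in => p pU; apply/hasP/hasP => -[h' h'H d]; last by exists h' => //; apply: mem_rem h'H.
  exists h' => //; rewrite mem_rem_uniq // inE h'H andbT; apply/eqP => hh; rewrite hh in d.
  have /andP[pp _] := forall_inP SU _ pU.
  move: d; rewrite dvdn_prime2 // => /eqP e; have := ltn_ord p; rewrite e; lia.
rewrite wt_sel_g' //.
have cWq : coprime W (qprod U).
  rewrite coprime_sym; apply: coprime_qprod => p /(forall_inP SU) /andP[pp].
  by rewrite coprime_primorial.
have -> : N%:R / (totient W)%:R * ((k.-1)%:R ^+ #|U| / (totient (qprod U))%:R) =
   (size (rem h H))%:R ^+ #|U| * (N%:R / (totient (W * qprod U))%:R) :> R.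
  by rewrite sz totient_coprime // natrM invfM; ring.
apply: le_trans (_ : (size (rem h H))%:R ^+ #|U| *
   (primeDev (N + N + h) (W * qprod U) + primeDev (N + h) (W * qprod U)) <= _); last first.
  by rewrite ler_wpM2r ?addr_ge0 ?primeDev_ge0 // sz lerXn2r ?nnegrE ?ler0n // ler_nat leq_pred.
apply: class_sum => //; first exact: rem_uniq.
- by move=> h' /mem_rem /HD.
move=> c cm cW hc; apply: prime_class => //; rewrite coprimeMr; apply/andP; split.
  rewrite -coprime_modl -modnDml cW coprime_modl; exact: cv.
rewrite coprime_sym; apply: coprime_qprod => p pU.
have /andP[pp _] := forall_inP SU _ pU.
rewrite prime_coprime //; have /hasP[h' h'H] := forall_inP hc _ pU.
exact: notboth.
Qed.

End Estimates.

(** * Size of the error terms under a level of distribution *)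

Ltac nneg := repeat first [ assumption | done | (apply: ltW; assumption) | apply: ler0n
  | apply: exprn_ge0 | apply: mulr_ge0 | apply: addr_ge0 | rewrite invr_ge0 ].

(** The value of [ln] outside its domain, which lets [1 <= ln N] exclude N = 0. *)
Lemma ln_R0 : ln 0 = 0.
Proof. by rewrite /ln; case: Rlt_dec => // h; case: (Rlt_irrefl _ h). Qed.

(** The M-th power of y <= exp y at y = x/(M+1); dividing by M+1 covers M = 0 as well. *)
Lemma pow_le_exp (M : nat) (x : R) : 0 <= x -> x ^+ M <= M.+1%:R ^+ M * exp x.
Proof.
move=> x0; have M0 : 0 < M.+1%:R :> R by rewrite ltr0n.
have expX n (y : R) : exp (n%:R * y) = exp y ^+ n.
  elim: n => [|n IH]; first by rewrite mul0r expr0; apply: exp_0.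
  by rewrite -natr1 mulrDl mul1r expD IH exprSr.
have y0 : 0 <= x / M.+1%:R by rewrite divr_ge0 // ltW.
have h : x / M.+1%:R <= exp (x / M.+1%:R).
  move: (x / M.+1%:R) y0 => y y0.
  have : 1 + y <= exp y by apply/RleP; apply: exp_ineq1_le.
  lra.
have -> : exp x = exp (x / M.+1%:R) ^+ M.+1.
  by rewrite -expX mulrC divfK // gt_eqF.
have {1}-> : x = M.+1%:R * (x / M.+1%:R) by rewrite mulrC divfK // gt_eqF.
rewrite exprMn; apply: ler_wpM2l; first by nneg.
apply: (@le_trans _ _ (exp (x / M.+1%:R) ^+ M)).
  by rewrite lerXn2r ?nnegrE ?(ltW (expR_gt0 _)).
by rewrite ler_weXn2l // exp_ge1.
Qed.

Lemma shift_pow_le (L C l : R) n : 0 <= C -> 0 <= L <= l -> 1 <= l ->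
  (L + C) ^+ n <= (1 + C) ^+ n * l ^+ n.
Proof.
move=> C0 /andP[L0 Ll] l1; rewrite -exprMn lerXn2r ?nnegrE ?addr_ge0 //; last by nra.
by rewrite mulr_ge0 //; lra.
Qed.

Section Level.
Variables (dev : nat -> nat -> R) (theta theta0 : R) (A : nat).
Hypotheses (A_gt0 : (0 < A)%N) (th : theta0 < theta).
Hypothesis lev : forall eps B : R, (0 < eps)%R -> (0 < B)%R ->
  exists C : R, exists N0 : nat, forall N : nat, (N0 <= N)%N -> (2 <= N)%N ->
    (\sum_(1 <= q < (qbound N (theta - eps)).+1) dev N q
       <= C * INR N / Rpower (ln (INR N)) B)%R.

(** [eps = theta - theta0] makes the range of moduli exactly N^theta0, and an absolute value makes
    the constant nonnegative. *)
Lemma level_sum : exists2 C : R, 0 <= C & exists N0 : nat, forall N : nat,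
  (N0 <= N)%N -> 1 <= ln N%:R ->
  \sum_(1 <= q < (qbound N theta0).+1) dev N q <= C * N%:R / ln N%:R ^+ A.
Proof.
have e0 : 0 < theta - theta0 by rewrite subr_gt0.
have A0 : 0 < A%:R :> R by rewrite ltr0n.
have [C [N0 HN]] := lev e0 A0; exists `|C|; first exact: normr_ge0.
exists N0 => N NN0 lN; have l0 : 0 < ln N%:R by lra.
have N2 : (2 <= N)%N.
  case: N NN0 lN l0 => [|[|N]] // _; last by rewrite ln_R1; lra.
  by rewrite ln_R0; lra.
have := HN N NN0 N2.
have -> : theta - (theta - theta0) = theta0 by ring.
have -> : A%:R = INR A by rewrite INRE.
rewrite Rpower_pow ?RpowE ?INRE => [/le_trans|]; last by apply/RltP.
apply; rewrite ler_wpM2r ?invr_ge0 ?exprn_ge0 ?(ltW l0) // ler_wpM2r ?ler0n //.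
exact: ler_norm.
Qed.
End Level.

Section ErrorSums.
Variables (D0 : nat) (H : seq nat) (be : R).
Local Notation k := (size H).
Local Notation W := (primorial D0).
Hypothesis be0 : 0 <= be.
Hypothesis kD2 : k%:R ^+ 2 < D0%:R - k%:R :> R.

(** The factor common to the bounds for all coefficients in [sel_lam_abs], of size (log N)^(k+1). *)
Definition Lam (L : R) : R := (1 + 2 * be) * L *
  ((sel_corr D0 k * dens D0 ^+ k) / (k`!)%:R * (L + sel_C D0 k) ^+ k).

Lemma Lam_ge0 L : 0 <= L -> 0 <= Lam L.
Proof.
move=> L0; have C0 := sel_C_ge0 D0 k; have c0 := sel_corr_ge0 kD2.
have d0 := ltW (dens_gt0 D0).
by rewrite /Lam; nneg.
Qed.

Lemma Lam_le : exists2 K : R, 0 <= K & forall L l : R, 0 <= L <= l -> 1 <= l ->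
  Lam L <= K * l ^+ k.+1.
Proof.
have C0 := sel_C_ge0 D0 k; have c0 := sel_corr_ge0 kD2; have d0 := ltW (dens_gt0 D0).
set K0 := (sel_corr D0 k * dens D0 ^+ k) / (k`!)%:R.
have K00 : 0 <= K0 by rewrite /K0; nneg.
exists ((1 + 2 * be) * K0 * (1 + sel_C D0 k) ^+ k).
  by nneg.
move=> L l Ll l1; have := shift_pow_le k C0 Ll l1; case/andP: Ll => L0 Ll H1.
have be1 : 0 <= 1 + 2 * be by nneg.
rewrite /Lam -/K0 exprS.
have -> : (1 + 2 * be) * K0 * (1 + sel_C D0 k) ^+ k * (l * l ^+ k) =
  (1 + 2 * be) * l * (K0 * ((1 + sel_C D0 k) ^+ k * l ^+ k)) by ring.
by apply: ler_pM; rewrite ?ler_wpM2l //; nneg.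
Qed.

Lemma mom_sift_poly (m : nat) : exists2 K : R, 0 <= K & forall N (L l : R), 0 <= L <= l -> 1 <= l ->
  mom (@logp N) (fun p => m%:R * sift_inv D0 p) 0 (2 * L) <= K * l ^+ m.
Proof.
have d0 := ltW (dens_gt0 D0); set C : R := m%:R * (W%:R + 1 + 1).
have C0 : 0 <= C by rewrite mulr_ge0 ?addr_ge0 ?ler0n.
exists (dens D0 ^+ m / (m`!)%:R * (2 * (1 + C)) ^+ m).
  by nneg.
move=> N L l /andP[L0 Ll] l1; apply: le_trans (mom_sift_mul_le _ _ _ _) _; first by rewrite mulr_ge0.
rewrite -[leRHS]mulrA; apply: ler_wpM2l; first by nneg.
rewrite -/C.
clearbody C; rewrite -exprMn lerXn2r ?nnegrE; [|by nneg|by nneg; lra|].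
  by [].
have : 0 <= C * (l - 1) by rewrite mulr_ge0 // subr_ge0.
have : 0 <= C * l by rewrite mulr_ge0 //; lra.
by lra.
Qed.

(* The power of [log N] to be saved in (A) and (B): it absorbs [Lam ^ 2] and the divisor-type
   sum of [weighted_error_le]. *)
Definition errA : nat := (k.+1 * 2 + (k.+1 * 2 + 1 + ((16 * k) ^ 2 * 2)))%N.

Lemma serr_le (K3 K4 : R) : 0 <= K3 -> 0 <= K4 ->
  exists2 K : R, 0 <= K & forall (N : nat) (L : R) (e : nat -> R),
  1 <= ln N%:R -> 0 <= L <= ln N%:R -> (forall q, 0 <= e q) ->
  \sum_(U : {set 'I_N} | sifted_set D0 U && (lg (@logp N) U <= 2 * L)) e (W * qprod U)%N <=
    K4 * N%:R / ln N%:R ^+ errA ->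
  (forall U : {set 'I_N}, sifted_set D0 U -> lg (@logp N) U <= 2 * L ->
     e (W * qprod U)%N <= 2 ^+ #|U| * (K3 * N%:R * ln N%:R) / (qprod U)%:R) ->
  serr N D0 H L (Lam L) e <= K * N%:R.
Proof.
move=> K30 K40; have [K1 K10 HK1] := Lam_le.
set m := ((16 * k) ^ 2 * 2)%N; have [K2 K20 HK2] := mom_sift_poly m.
exists (K1 ^+ 2 * (K4 + K3 * K2)); first by rewrite mulr_ge0 ?exprn_ge0 // addr_ge0 // mulr_ge0.
move=> N L e l1 Ll e0 S1 S2; set l := ln N%:R in l1 Ll S1 S2 *.
have L0 : 0 <= L by case/andP: Ll.
have l0 : 0 < l by lra.
(* The balance in [weighted_error_le]: against [Lam ^ 2] of size l^(2(k+1)), l^B times the saving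
   l^(-errA) and l * l^m / l^B both leave a bounded multiple of N. *)
set B := (k.+1 * 2 + 1 + m)%N.
have lB0 : 0 < l ^+ B by rewrite exprn_gt0.
have Z20 : 0 <= K3 * N%:R * l by rewrite !mulr_ge0 ?ler0n // ltW.
have := @weighted_error_le N D0 (fun U => e (W * qprod U)%N) (16 * k) 2 (2 * L) (l ^+ B)
  (K4 * N%:R / l ^+ errA) (K3 * N%:R * l) lB0 Z20 (fun U => e0 _) S1 S2.
rewrite -/m => H1; have := HK2 N L l Ll l1 => H2.
have H3 := HK1 L l Ll l1; have Lam0 := Lam_ge0 L0.
have H4 : Lam L ^+ 2 <= K1 ^+ 2 * l ^+ (k.+1 * 2).
  by rewrite exprM -exprMn lerXn2r ?nnegrE // mulr_ge0 // exprn_ge0 // ltW.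
rewrite /serr.
apply: le_trans (ler_wpM2l (exprn_ge0 2 Lam0) H1) _.
have X0 : 0 <= K3 * N%:R * l / l ^+ B by rewrite divr_ge0 // ltW.
have := lerD (lexx (l ^+ B * (K4 * N%:R / l ^+ errA))) (ler_wpM2l X0 H2) => H5.
apply: le_trans (ler_wpM2l (exprn_ge0 2 Lam0) H5) _.
have Y0 : 0 <= l ^+ B * (K4 * N%:R / l ^+ errA) + K3 * N%:R * l / l ^+ B * (K2 * l ^+ m).
  by nneg.
apply: le_trans (ler_wpM2r Y0 H4) _.
have -> : errA = (k.+1 * 2 + B)%N by [].
rewrite le_eqVlt; apply/orP; left; apply/eqP; rewrite /B !exprD expr1.
have ln0 n : l ^+ n != 0 by rewrite expf_neq0 // gt_eqF.
have lne : l != 0 by rewrite gt_eqF.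
move: (l ^+ (k.+1 * 2)) (l ^+ m) (ln0 (k.+1 * 2)%N) (ln0 m) lne => u w u0 w0 lne.
by field; rewrite u0 w0 lne.
Qed.

(** No equidistribution is involved: there are at most about N^theta0 moduli up to logarithms, and
    [theta0 < 1] leaves a power of N to absorb the latter. *)
Lemma serr_one_le (theta0 : R) : theta0 < 1 ->
  exists2 K : R, 0 <= K & forall (N : nat) (L : R),
  1 <= ln N%:R -> 0 <= L <= ln N%:R -> exp (2 * L) <= exp (theta0 * ln N%:R) ->
  serr N D0 H L (Lam L) (fun=> 2) <= K * N%:R.
Proof.
move=> th1; have [K1 K10 HK1] := Lam_le.
set m := (16 * k)%N; have [K2 K20 HK2] := mom_sift_poly m.
set M := (k.+1 * 2 + m)%N; set d := 1 - theta0; have d0 : 0 < d by rewrite /d; lra.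
exists (K1 ^+ 2 * 2 * K2 * (M.+1%:R ^+ M / d ^+ M)).
  by nneg.
move=> N L l1 Ll LN.
have N0 : 0 < N%:R :> R.
  rewrite ltr0n lt0n; apply/eqP => N0; move: l1; rewrite N0 ln_R0; lra.
set l := ln N%:R in l1 Ll LN *.
have L0 : 0 <= L by case/andP: Ll.
have l0 : 0 < l by lra.
have H2 := HK2 N L l Ll l1.
have H3 := HK1 L l Ll l1; have Lam0 := Lam_ge0 L0.
have H4 : Lam L ^+ 2 <= K1 ^+ 2 * l ^+ (k.+1 * 2).
  by rewrite exprM -exprMn lerXn2r ?nnegrE // mulr_ge0 // exprn_ge0 // ltW.
(* Rankin's trick: each term is multiplied by e^(2L) / [qprod U], which is at least 1. *)
have H5 : \sum_(U : {set 'I_N} | sifted_set D0 U && (lg (@logp N) U <= 2 * L))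
     m%:R ^+ #|U| * 2 <= 2 * exp (2 * L) * (K2 * l ^+ m).
  apply: le_trans (ler_wpM2l _ H2); last by rewrite mulr_ge0 // ltW // expR_gt0.
  rewrite -mom_sift_inv_set big_distrr /=; apply: ler_sum => U /andP[SU LU].
  have PU := sifted_prime_set SU; rewrite lg_le_qprod // in LU.
  have q0 : 0 < (qprod U)%:R :> R by rewrite ltr0n qprod_gt0.
  rewrite [leRHS](_ : _ = m%:R ^+ #|U| * 2 * (exp (2 * L) / (qprod U)%:R)); last by ring.
  by rewrite ler_peMr ?mulr_ge0 ?exprn_ge0 ?ler0n // ler_pdivlMr // mul1r.
rewrite /serr -/m.
apply: le_trans (ler_wpM2l (exprn_ge0 2 Lam0) H5) _.
have Y0 : 0 <= 2 * exp (2 * L) * (K2 * l ^+ m).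
  by rewrite !mulr_ge0 ?exprn_ge0 // ltW // expR_gt0.
apply: le_trans (ler_wpM2r Y0 H4) _.
have E := @pow_le_exp M (d * l) (mulr_ge0 (ltW d0) (ltW l0)).
have eN : exp (theta0 * l) * exp (d * l) = N%:R.
  by rewrite -expD -mulrDl /d addrC subrK mul1r lnK.
apply: (@le_trans _ _ (K1 ^+ 2 * 2 * K2 * (l ^+ M * exp (theta0 * l)))).
  rewrite [leLHS](_ : _ = K1 ^+ 2 * 2 * K2 * (l ^+ M * exp (2 * L))); last by rewrite /M exprD; ring.
  apply: ler_wpM2l; first by nneg.
  by apply: ler_wpM2l => //; nneg.
rewrite -[leRHS]mulrA ler_wpM2l ?mulr_ge0 ?exprn_ge0 // -eN.
rewrite exprMn in E.
have -> : M.+1%:R ^+ M / d ^+ M * (exp (theta0 * l) * exp (d * l)) =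
   (M.+1%:R ^+ M * exp (d * l) / d ^+ M) * exp (theta0 * l) by ring.
rewrite ler_wpM2r ?(ltW (expR_gt0 _)) // ler_pdivlMr ?exprn_gt0 //.
by rewrite mulrC.
Qed.

End ErrorSums.

Lemma sum_dev_le (N D0 Q : nat) (t : R) (dev : nat -> R) : (forall q, 0 <= dev q) ->
  (forall U : {set 'I_N}, sifted_set D0 U -> lg (@logp N) U <= t ->
     (primorial D0 * qprod U <= Q)%N) ->
  \sum_(U : {set 'I_N} | sifted_set D0 U && (lg (@logp N) U <= t)) dev (primorial D0 * qprod U)%N
  <= \sum_(1 <= q < Q.+1) dev q.
Proof.
move=> dev0 UQ; rewrite big_geq_mkord.
have W0 := primorial_gt0 D0.
apply: le_trans (ler_sum_inj (P := fun U : {set 'I_N} => sifted_set D0 U && (lg (@logp N) U <= t))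
   (f := fun U => inord (primorial D0 * qprod U) : 'I_Q.+1) (G := fun q : 'I_Q.+1 => dev q) _ _ _).
- by apply: ler_sum => U /andP[SU LU]; rewrite inordK // ltnS UQ.
- move=> U V /andP[SU LU] /andP[SV LV] /(congr1 (@nat_of_ord _)).
  rewrite !inordK ?ltnS ?UQ // => /eqP; rewrite eqn_pmul2l // => /eqP.
  by apply: qprod_inj; apply: (@sifted_prime_set _ D0).
- move=> U /andP[SU LU]; rewrite inordK ?ltnS ?UQ //.
  by rewrite muln_gt0 W0 qprod_gt0 ?(sifted_prime_set SU).
- by move=> q _.
Qed.

Section LevelSet.
Variables (dev : nat -> nat -> R) (theta theta0 : R) (A D0 : nat).
Local Notation W := (primorial D0).
Hypotheses (dev_ge0 : forall N q, 0 <= dev N q) (A_gt0 : (0 < A)%N) (th : theta0 < theta).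
Hypothesis th0 : 0 <= theta0.
Hypothesis lev : forall eps B : R, (0 < eps)%R -> (0 < B)%R ->
  exists C : R, exists N0 : nat, forall N : nat, (N0 <= N)%N -> (2 <= N)%N ->
    (\sum_(1 <= q < (qbound N (theta - eps)).+1) dev N q
       <= C * INR N / Rpower (ln (INR N)) B)%R.

(** [L] is fixed by N while the deviations are taken at shifted ends N' such as 2N + h. The value of
    2L is the one for which W d stays below N^theta0. *)
Lemma level_set : exists2 C : R, 0 <= C & exists N0 : nat, forall (N N' : nat) (L : R),
  (N0 <= N)%N -> 1 <= ln N%:R -> (N <= N' <= 3 * N)%N ->
  2 * L = theta0 * ln N%:R - ln W%:R ->
  \sum_(U : {set 'I_N} | sifted_set D0 U && (lg (@logp N) U <= 2 * L)) dev N' (W * qprod U)%N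
  <= C * N%:R / ln N%:R ^+ A.
Proof.
have [C C0 [N0 HN]] := level_sum A_gt0 th lev.
exists (3 * C); first by rewrite mulr_ge0.
exists N0 => N N' L NN0 l1 /andP[NN' N'3] eL.
have W0 : 0 < W%:R :> R by rewrite ltr0n primorial_gt0.
have N0' : 0 < N%:R :> R.
  rewrite ltr0n lt0n; apply/eqP => Nz; move: l1; rewrite Nz ln_R0; lra.
have l0 : 0 < ln N%:R by lra.
have ll : ln N%:R <= ln N'%:R by rewrite ler_ln // ler_nat.
have l1' : 1 <= ln N'%:R by lra.
apply: le_trans (sum_dev_le (Q := qbound N' theta0) (dev_ge0 N') _) _.
  move=> U SU LU; apply: qbound_ge; rewrite /Rpower natrM.
  have PU := sifted_prime_set SU; rewrite lg_le_qprod // eL in LU.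
  apply: (@le_trans _ _ (W%:R * exp (theta0 * ln N%:R - ln W%:R))).
    by rewrite ler_wpM2l // ltW.
  rewrite -{1}(lnK W0) -expD addrC subrK; apply: ler_exp.
  by rewrite -[X in _ <= X]/(theta0 * ln N'%:R) ler_wpM2l.
apply: le_trans (HN N' (leq_trans NN0 NN') l1') _.
have lA : ln N%:R ^+ A <= ln N'%:R ^+ A by rewrite lerXn2r ?nnegrE //; lra.
have p1 : 0 < ln N%:R ^+ A by rewrite exprn_gt0.
have p2 : 0 < ln N'%:R ^+ A by rewrite exprn_gt0 //; lra.
apply: ler_pM; [by nneg|by nneg| |by rewrite lef_pV2 ?posrE].
by rewrite [3 * C]mulrC -mulrA ler_wpM2l // -natrM ler_nat.
Qed.

End LevelSet.

(** 2(3x + 2) <= 10x for x = N/q >= 1. The factors [2 ^+ u] and [ln N] give it the shape required by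
    [serr_le]. *)
Lemma liouvDev_pt (N N' W q u : nat) : (0 < W)%N -> (0 < q)%N -> (q <= N)%N -> (N' <= 3 * N)%N ->
  1 <= ln N%:R ->
  2 * liouvDev N' (W * q) <= 2 ^+ u * (10 * N%:R * ln N%:R) / q%:R.
Proof.
move=> W0 q0 qN N'3 l1; have qp : 0 < q%:R :> R by rewrite ltr0n.
have H := liouvDev_le N' (W * q).
have a1 : N'%:R / (W * q)%:R <= 3 * (N%:R / q%:R) :> R.
  rewrite natrM invfM mulrA mulrA; apply: ler_wpM2r; first by rewrite invr_ge0 ltW.
  apply: (@le_trans _ _ (N'%:R * 1)); last by rewrite mulr1 -natrM ler_nat.
  by rewrite ler_wpM2l ?ler0n // invf_le1 ?ler1n ?ltr0n.
have a2 : 1 <= N%:R / q%:R :> R by rewrite ler_pdivlMr // mul1r ler_nat.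
have a3 : 1 <= 2 ^+ u :> R by rewrite exprn_ege1 // ler1n.
have a4 : N%:R / q%:R <= 2 ^+ u * (N%:R / q%:R * ln N%:R).
  rewrite mulrCA ler_peMr //; first by lra.
  by rewrite -[leLHS]mulr1 ler_pM.
have -> : 2 ^+ u * (10 * N%:R * ln N%:R) / q%:R = 10 * (2 ^+ u * (N%:R / q%:R * ln N%:R)) by ring.
move: (N%:R / q%:R) (2 ^+ u * _) a1 a2 a4 => x y; lra.
Qed.

(** 18 is 5 * 3 + 3: the progression has at most 5N/q terms of size at most 3 log N, and the main
    term is at most 3N/phi(q), where q <= 2^#|U| phi(q) because p <= 2(p-1). *)
Lemma primeDev_pt (N N' D0 : nat) (U : {set 'I_N}) : sifted_set D0 U -> (qprod U <= N)%N ->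
  (N' <= 3 * N)%N -> (0 < N')%N -> 1 <= ln N%:R ->
  primeDev N' (primorial D0 * qprod U) <= 2 ^+ #|U| * (18 * N%:R * ln N%:R) / (qprod U)%:R.
Proof.
set W := primorial D0; set q := qprod U; move=> SU qN N'3 N'0 l1.
have PU := sifted_prime_set SU.
have W0 : (0 < W)%N by apply: primorial_gt0.
have q0 : (0 < q)%N by apply: qprod_gt0.
have N0 : (0 < N)%N by lia.
have qp : 0 < q%:R :> R by rewrite ltr0n.
have H := primeDev_le (W * q) N'0.
have a1 : N'%:R / (W * q)%:R <= 3 * (N%:R / q%:R) :> R.
  rewrite natrM invfM mulrA mulrA; apply: ler_wpM2r; first by rewrite invr_ge0 ltW.
  apply: (@le_trans _ _ (N'%:R * 1)); last by rewrite mulr1 -natrM ler_nat.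
  by rewrite ler_wpM2l ?ler0n // invf_le1 ?ler1n ?ltr0n.
have a2 : 1 <= N%:R / q%:R :> R by rewrite ler_pdivlMr // mul1r ler_nat.
have a3 : 1 <= 2 ^+ #|U| :> R by rewrite exprn_ege1 // ler1n.
have lN' : ln N'%:R <= 3 * ln N%:R.
  apply: (@le_trans _ _ (ln (3 * N)%:R)); first by rewrite ler_ln ?ltr0n // ler_nat.
  rewrite natrM lnM ?ltr0n //; have := @ln_le_sub1 3%:R; rewrite ltr0n => /(_ isT); lra.
have lN'0 : 0 <= ln N'%:R by rewrite ln_ge0 // ler1n.
have cWq : coprime W q.
  rewrite coprime_sym; apply: coprime_qprod => p /(forall_inP SU) /andP[pp].
  by rewrite coprime_primorial.
have phi : q%:R <= 2 ^+ #|U| * (totient (W * q))%:R :> R.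
  rewrite -natrX -natrM ler_nat totient_coprime //.
  apply: (@leq_trans (2 ^ #|U| * totient q)); last first.
    by rewrite leq_mul2l leq_pmull ?orbT // totient_gt0.
  rewrite totient_qprod // -prod_nat_const -big_split /=.
  apply: leq_prod => p /(forall_inP PU) /prime_gt1; lia.
have tp : 0 < (totient (W * q))%:R :> R by rewrite ltr0n totient_gt0 muln_gt0 W0 q0.
have a5 : N'%:R / (totient (W * q))%:R <= 2 ^+ #|U| * (3 * (N%:R / q%:R)) :> R.
  rewrite ler_pdivrMr //; apply: (@le_trans _ _ (3 * (N%:R / q%:R) * q%:R)).
    by rewrite -mulrA divfK ?gt_eqF // -natrM ler_nat.
  rewrite [leRHS](_ : _ = 3 * (N%:R / q%:R) * (2 ^+ #|U| * (totient (W * q))%:R)); last by ring.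
  by rewrite ler_wpM2l // mulr_ge0 //; lra.
have -> : 2 ^+ #|U| * (18 * N%:R * ln N%:R) / q%:R =
   18 * (2 ^+ #|U| * (N%:R / q%:R * ln N%:R)) by ring.
apply: le_trans H _; move: (N%:R / q%:R) a1 a2 a5 => x a1 x1 a5.
set T := 2 ^+ #|U| in a3 a5 *; set l := ln N%:R in l1 lN' *; clearbody T.
have b1 : (N'%:R / (W * q)%:R + 2) * ln N'%:R <= (5 * x) * (3 * l).
  by apply: ler_pM => //; [rewrite addr_ge0 ?divr_ge0 ?ler0n | lra].
have b2 : x * l <= T * (x * l) by rewrite ler_peMl // mulr_ge0; lra.
have b3 : T * x <= T * (x * l) by rewrite ler_wpM2l ?ler_peMr; lra.
move: a5 b1 b2 b3; rewrite mulrCA; lra.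
Qed.

(** Bernoulli's inequality for 1 - C/(L+C); it makes the shifts of [L] harmless. *)
Lemma pow_ratio (C rho : R) (n : nat) : 0 <= C -> 1 < rho ->
  exists X : R, forall L, X <= L -> 0 < L -> (L + C) ^+ n <= rho * L ^+ n.
Proof.
move=> C0 r1; exists (n%:R * C * rho / (rho - 1)) => L XL L0.
have M0 : 0 < L + C by lra.
have z01 : 0 <= C / (L + C) <= 1.
  by rewrite divr_ge0 ?(ltW M0) //= ler_pdivrMr // mul1r lerDr ltW.
have B := bernoulli_le n z01.
have e : L = (L + C) * (1 - C / (L + C)) by field; rewrite gt_eqF.
rewrite {2}e exprMn mulrCA ler_peMr ?exprn_ge0 ?(ltW M0) //.
have nz : n%:R * (C / (L + C)) <= 1 - rho^-1.
  rewrite mulrA ler_pdivrMr //.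
  have -> : (1 - rho^-1) = (rho - 1) / rho by field; rewrite gt_eqF //; lra.
  rewrite mulrAC ler_pdivlMr; last by lra.
  rewrite ler_pdivrMr in XL; last by lra.
  have : 0 <= C * (rho - 1) by rewrite mulr_ge0 //; lra.
  by lra.
have r0 : 0 < rho by lra.
apply: (@le_trans _ _ (rho * rho^-1)); first by rewrite mulfV // gt_eqF.
by rewrite ler_wpM2l ?(ltW r0) //; lra.
Qed.

(** The multiplicative losses (the shift of [L], the factor [Delta], the constant in [h]) are each
    charged to [rho], the additive errors to [eta]; what remains is an inequality between
    constants. *)
Lemma asym_ineq (k : nat) (theta0 I J Delta C K1 K2 h L rho eta : R) :
  0 < L -> 0 < theta0 -> 0 <= I -> 0 <= Delta -> 0 <= C -> 0 <= K2 -> 0 <= h -> 0 < rho ->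
  (L + C) ^+ (k + 2) <= rho * L ^+ (k + 2) -> Delta <= rho ->
  K1 <= eta * L ^+ (k + 3) -> K2 <= eta * L ^+ (k + 2) -> h <= rho * L / theta0 ->
  eta + rho / theta0 * (rho ^+ 2 * I + eta) < k%:R * J ->
  K1 + h * (Delta * (L + C) ^+ (k + 2) * I + K2) < k%:R * J * L ^+ (k + 3).
Proof.
move=> L0 th0 I0 D0 C0 K20 h0 r0 H1 H2 H3 H4 H5 key.
set X := L ^+ (k + 2) in H1 H4; have X0 : 0 < X by rewrite exprn_gt0.
have eX : L ^+ (k + 3) = L * X by rewrite addnS exprS.
rewrite eX in H3 *; set Y := (L + C) ^+ (k + 2) in H1 *.
have Y0 : 0 <= Y by rewrite exprn_ge0 //; lra.
have b1 : Delta * Y * I + K2 <= (rho ^+ 2 * I + eta) * X.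
  rewrite mulrDl lerD //.
  have -> : rho ^+ 2 * I * X = rho * (rho * X) * I by ring.
  by rewrite ler_wpM2r // ler_pM.
have b2 : h * (Delta * Y * I + K2) <= rho * L / theta0 * ((rho ^+ 2 * I + eta) * X).
  by apply: ler_pM => //; rewrite addr_ge0 // !mulr_ge0.
apply: (@le_lt_trans _ _ ((eta + rho / theta0 * (rho ^+ 2 * I + eta)) * (L * X))).
  have := lerD H3 b2; move=> /le_trans; apply; rewrite le_eqVlt; apply/orP; left; apply/eqP; ring.
by rewrite ltr_pM2r // mulr_gt0.
Qed.

(** * Positivity of the sieve sum *)

Lemma ln_eventually (X : R) : exists N1 : nat, forall N : nat, (N1 <= N)%N -> X <= ln N%:R.
Proof.
have e0 := ltW (expR_gt0 X).
exists (Num.bound (exp X)) => N NN; rewrite -[leLHS]expK ler_ln ?expR_gt0 //.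
by apply: le_trans (ltW (archi_boundP e0)) _; rewrite ler_nat.
Qed.

Lemma sum_bounds (a b c d e f : nat) : let N := (a + b + c + d + e + f + 2)%N in
  [/\ a <= N, b <= N, c <= N & d <= N]%N /\ [/\ e < N, f <= N & 1 < N]%N.
Proof. by move=> N; rewrite /N; do !split; lia. Qed.

(** [sel_corr D0 k <= rho] means k^2/(D0-k) <= 1 - 1/rho, whence the bound k^2 rho/(rho-1). The
    parameter [s] makes [D0] exceed the elements of the tuple. *)
Lemma choose_level (k s : nat) (rho : R) : 1 < rho ->
  exists D0 : nat, [/\ (2 * k <= D0)%N, (s <= D0)%N, k%:R ^+ 2 < D0%:R - k%:R :> R
    & sel_corr D0 k <= rho].
Proof.
move=> r1; have rho0 : 0 < rho by lra.
have r10 : 0 < rho - 1 by lra.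
have x0 : 0 <= k%:R ^+ 2 * (rho / (rho - 1)) :> R by nneg.
pose y := Num.bound (k%:R ^+ 2 * (rho / (rho - 1))).
have Dk : k%:R ^+ 2 * (rho / (rho - 1)) < (2 * k + s + y + 1)%:R - k%:R :> R.
  apply: lt_le_trans (archi_boundP x0) _; rewrite lerBrDr -natrD ler_nat -/y.
  by clearbody y; clear; lia.
exists (2 * k + s + y + 1)%N; set D0 := (_ + _ + _ + 1)%N in Dk *.
have kD : (2 * k <= D0)%N by rewrite /D0; clear; lia.
have sD : (s <= D0)%N by rewrite /D0; clear; lia.
clearbody D0; clear y.
have kD2 : k%:R ^+ 2 < D0%:R - k%:R :> R.
  apply: le_lt_trans Dk; rewrite ler_peMr ?exprn_ge0 ?ler0n // ler_pdivlMr; lra.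
have Dk0 : 0 < D0%:R - k%:R :> R by apply: le_lt_trans kD2; rewrite exprn_ge0 ?ler0n.
split=> //.
rewrite /sel_corr -[leRHS]invrK lef_pV2 ?posrE ?invr_gt0 //; last first.
  by rewrite subr_gt0 ltr_pdivrMr // mul1r.
rewrite lerBrDr -lerBrDl ler_pdivrMr //.
have -> : 1 - rho^-1 = (rho - 1) / rho by field; rewrite gt_eqF.
move: (ltW Dk); rewrite mulrA ler_pdivrMr // => Dk'.
by rewrite mulrAC ler_pdivlMr // [leRHS]mulrC.
Qed.

Lemma sum5_ge (x a b c d : R) : 0 <= a -> 0 <= b -> 0 <= c -> 0 <= d -> x <= a ->
  let X := 1 + a + b + c + d in [/\ 1 <= X, x <= X, b <= X, c <= X & d <= X].
Proof. by move=> a0 b0 c0 d0 xa X; rewrite /X; split; lra. Qed.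

Lemma sumr_const_seq (s : seq nat) (x : R) : \sum_(h <- s) x = (size s)%:R * x.
Proof.
elim: s => [|h s IH]; first by rewrite big_nil mul0r.
by rewrite big_cons IH /= -natr1 mulrDl mul1r addrC.
Qed.

Lemma log_range (theta0 l w X : R) : 0 < theta0 -> theta0 < 1 -> 0 <= w -> 1 <= X ->
  1 + (2 * X + w) / theta0 <= l ->
  [/\ 1 <= l, X <= (theta0 * l - w) / 2, (theta0 * l - w) / 2 < l & theta0 * l <= l].
Proof.
move=> th0 th1 w0 X1 lX; have q0 : 0 <= (2 * X + w) / theta0.
  by rewrite divr_ge0 ?(ltW th0) //; lra.
have l1 : 1 <= l by lra.
have tl : theta0 * l <= l by rewrite ler_piMl //; lra.
have : (2 * X + w) / theta0 <= l by lra.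
rewrite ler_pdivrMr // mulrC => ?.
by split; lra.
Qed.

(** The cancellation of the sieve densities: d N/phi(W) is N/W, so after division by N [dk]/W both
    main terms are free of [W]. *)
Lemma sieve_algebra (k Nr Wr tW d dk X Y I J K1 KL KP hf corr T1 T2 s1 sl Sp : R) :
  0 < Nr -> 0 < Wr -> 0 < tW -> d = tW / Wr -> 0 < dk -> 0 <= k -> 0 <= hf ->
  T1 <= corr * dk * X * I -> d * dk * Y * J <= T2 ->
  `|s1 - Nr / Wr * T1| <= K1 * Nr -> `|sl| <= KL * Nr ->
  k * (Nr / tW * T2 - KP * Nr) <= Sp ->
  k * KP / (dk / Wr) + hf * (corr * X * I + (K1 + KL) / (dk / Wr)) < k * J * Y ->
  0 < Sp - hf * (s1 + sl).
Proof.
move=> N0 W0 t0 -> dk0 k0 hf0 H1 H2 H3 H4 H5 key.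
have P0 : 0 < Nr * (dk / Wr) by rewrite mulr_gt0 // divr_gt0.
move: key; rewrite -(ltr_pM2l P0).
have -> : Nr * (dk / Wr) * (k * KP / (dk / Wr) + hf * (corr * X * I + (K1 + KL) / (dk / Wr))) =
   k * (KP * Nr) + hf * (Nr / Wr * (corr * dk * X * I) + K1 * Nr + KL * Nr).
  by field; rewrite !gt_eqF.
have -> : Nr * (dk / Wr) * (k * J * Y) = k * (Nr / tW * (tW / Wr * dk * Y * J)).
  by field; rewrite !gt_eqF.
have a1 : k * (Nr / tW * (tW / Wr * dk * Y * J)) <= k * (Nr / tW * T2).
  by rewrite !ler_wpM2l // divr_ge0 // ltW.
have a2 : Nr / Wr * T1 <= Nr / Wr * (corr * dk * X * I).
  by rewrite ler_wpM2l // divr_ge0 // ltW.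
have a3 : s1 - Nr / Wr * T1 <= K1 * Nr by apply: le_trans H3; apply: ler_norm.
have a4 : sl <= KL * Nr by apply: le_trans H4; apply: ler_norm.
have a5 : hf * (s1 + sl) <= hf * (Nr / Wr * (corr * dk * X * I) + K1 * Nr + KL * Nr).
  by rewrite ler_wpM2l //; lra.
move: a1 a5 H5; rewrite [k * (_ - _)]mulrBr.
move: (k * (KP * Nr)) (hf * (_ + _ + _)) (hf * _) (k * (Nr / tW * T2)) (k * _) => x y z t u *.
lra.
Qed.

(** All constants depend on [D0] only, which is fixed before [N] is chosen. *)
Lemma sieve_positive (H : seq nat) (theta theta0 be rho eta : R) (r : int) (N0 : nat) :
  let k := size H in
  (1 < k)%N -> uniq H -> admissible H -> 0 <= be -> 0 < theta0 -> theta0 < 1 ->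
  theta0 < theta -> condA theta -> condB theta -> 1 < rho -> 0 < eta ->
  eta + rho / theta0 * (rho ^+ 2 *
    (1 / (k`!)%:R + 4 * be / ((k + 1)`!)%:R + 8 * be ^+ 2 / ((k + 2)`!)%:R) + eta) <
  k%:R * (2 / ((k + 1)`!)%:R + 12 * be / ((k + 2)`!)%:R + 24 * be ^+ 2 / ((k + 3)`!)%:R) ->
  exists2 N : nat, (N0 <= N)%N & exists2 n : nat, (N < n <= N + N)%N &
    (forall h, h \in H -> (n + h <= 3 * N)%N) /\
    ln (3 * N)%:R / 2 * (1 + liouville `|(n%:Z + r)%R|%N) < \sum_(h <- H) logprime (n + h).
Proof.
move=> k k1 uH adm be0 th0 th1 tht cA cB r1 eta0 key.
set I := 1 / (k`!)%:R + _ + _ in key; set J := 2 / _ + _ + _ in key.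
have I0 : 0 <= I by rewrite /I; nneg.
have [D0 [kD sD kD2 corr_le]] := choose_level k (\sum_(h <- H) h)%N r1.
have HD h : h \in H -> (h <= D0)%N.
  by move=> hH; apply: leq_trans sD; rewrite (big_rem h) //= leq_addr.
have rho0 : 0 < rho by rewrite (lt_trans _ r1).
have corr0 := sel_corr_ge0 kD2.
have [v vW cv] := admissible_residue D0 adm.
set W := primorial D0 in vW cv.
have W0 : 0 < W%:R :> R by rewrite ltr0n primorial_gt0.
have errA0 : (0 < errA H)%N by rewrite /errA addn_gt0 muln_gt0.
have [CA CA0 [NA HA]] := @level_set primeDev theta theta0 (errA H) D0 primeDev_ge0 errA0 tht (ltW th0) cA.
have [CB CB0 [NB HB]] := @level_set liouvDev theta theta0 (errA H) D0 liouvDev_ge0 errA0 tht (ltW th0) cB.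
have [K1 K10 HK1] := serr_one_le be0 kD2 th1.
have [KL KL0 HKL] := @serr_le D0 H be be0 kD2 10 (2 * CB) (ler0n _ 10) (mulr_ge0 (ler0n _ 2) CB0).
have [KP KP0 HKP] := @serr_le D0 H be be0 kD2 36 (2 * CA) (ler0n _ 36) (mulr_ge0 (ler0n _ 2) CA0).
set C := sel_C D0 k + 2; have C0 : 0 <= C by rewrite addr_ge0 // sel_C_ge0.
have [X1 HX1] := @pow_ratio C rho (k + 2) C0 r1.
have d0 := dens_gt0 D0; set P := dens D0 ^+ k / W%:R.
have P0 : 0 < P by rewrite divr_gt0 // exprn_gt0.
set E1 := k%:R * KP / P; set E2 := (K1 + KL) / P.
have E10 : 0 <= E1 by rewrite /E1; nneg.
have E20 : 0 <= E2 by rewrite /E2; nneg.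
(* Chosen so that log(3N)/2 is exactly (L + [c1])/theta0. *)
set c1 := (ln W%:R + theta0 * ln 3) / 2.
have lW0 : 0 <= ln W%:R by rewrite ln_ge0 // ler1n primorial_gt0.
have l30 : 0 <= ln 3 :> R by rewrite ln_ge0 // ler1n.
have c10 : 0 <= c1 by rewrite /c1; nneg.
(* A threshold for [L]: [X1] serves the shift [C], [E1 / eta] and [E2 / eta] the sieve errors,
   [c1 / (rho - 1)] the constant in log(3N). *)
pose X := 1 + `|X1| + E1 / eta + E2 / eta + c1 / (rho - 1).
have r10 : 0 < rho - 1 by rewrite subr_gt0.
have Xa : 0 <= E1 / eta by rewrite divr_ge0 // ltW.
have Xb : 0 <= E2 / eta by rewrite divr_ge0 // ltW.
have Xc : 0 <= c1 / (rho - 1) by rewrite divr_ge0 // ltW.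
have Xd := normr_ge0 X1.
have [N1 HN1] := ln_eventually (1 + (2 * X + ln W%:R) / theta0).
pose N := (N0 + NA + NB + N1 + D0 + `|r| + 2)%N.
have [[N_0 N_A N_B N_1] [N_D rN N_2]] := sum_bounds N0 NA NB N1 D0 `|r|; rewrite -/N in N_0 N_A N_B N_1 N_D rN N_2.
clearbody N; exists N => //.
set l := ln N%:R.
have lX : 1 + (2 * X + ln W%:R) / theta0 <= l by exact: HN1.
have [X1' X1L E1L E2L c1L] : [/\ 1 <= X, X1 <= X, E1 / eta <= X, E2 / eta <= X & c1 / (rho - 1) <= X].
  exact: sum5_ge Xd Xa Xb Xc (ler_norm X1).
have [l1 XL Ll tl] := log_range th0 th1 lW0 X1' lX.
have l0 : 0 < l by apply: lt_le_trans l1.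
have Np : 0 < N%:R :> R by rewrite ltr0n (ltn_trans _ N_2).
pose L := (theta0 * l - ln W%:R) / 2.
have eL : 2 * L = theta0 * l - ln W%:R by rewrite /L mulrC divfK // pnatr_eq0.
rewrite -/L in XL Ll.
have L1 : 1 <= L by apply: le_trans XL.
have L0 : 0 < L by apply: lt_le_trans L1.
have Lr : 0 <= L <= l by rewrite !ltW.
have expLN : exp L < N%:R.
  by rewrite -(lnK Np); apply/RltP/exp_increasing; apply/RltP.
have exp2L : exp (2 * L) <= exp (theta0 * l) by rewrite eL; apply: ler_exp; rewrite gerBl.
have lamB (D : {set 'I_N}) : `|sel_lam D0 k L be D| <= 2 ^+ #|D| * Lam D0 H be L.
  by apply: sel_lam_abs => //; apply: ltW.
have qN (U : {set 'I_N}) : sifted_set D0 U -> lg (@logp N) U <= 2 * L -> (qprod U <= N)%N.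
  move=> SU; rewrite lg_le_qprod ?(sifted_prime_set SU) // => LU.
  rewrite -(ler_nat R); apply: (le_trans LU); apply: (le_trans exp2L).
  by rewrite -[leRHS](lnK Np); apply: ler_exp.
have q0 (U : {set 'I_N}) : sifted_set D0 U -> (0 < qprod U)%N.
  by move=> SU; apply/qprod_gt0/(sifted_prime_set SU).
have S1 := @ssum_one N D0 H v L be uH HD vW (Lam D0 H be L) lamB.
have SL := @ssum_liouville N D0 H v L be uH HD vW (Lam D0 H be L) lamB r rN.
have e1 := HK1 N L l1 Lr exp2L.
have eLi : serr N D0 H L (Lam D0 H be L) (fun q => 2 * liouvDev (N + N + `|r|) q) <= KL * N%:R.
  apply: HKL => // [q||U SU LU]; first by rewrite mulr_ge0 ?liouvDev_ge0.
    rewrite -big_distrr /= -!mulrA; apply: ler_wpM2l => //; rewrite mulrA.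
    by apply: HB => //; clear -rN; lia.
  apply: liouvDev_pt => //; rewrite ?primorial_gt0 ?q0 ?qN //; clear -rN; lia.
have eP h : h \in H -> serr N D0 H L (Lam D0 H be L)
    (fun q => primeDev (N + N + h) q + primeDev (N + h) q) <= KP * N%:R.
  move=> hH; have hD := HD h hH.
  apply: HKP => // [q||U SU LU]; first by rewrite addr_ge0 ?primeDev_ge0.
    rewrite big_split /= (_ : 2 * CA = CA + CA); last by ring.
    rewrite (mulrDl CA CA) (mulrDl (CA * _)).
    by apply: lerD; apply: HA => //; clear -hD N_D; lia.
  have -> : 2 ^+ #|U| * (36 * N%:R * l) / (qprod U)%:R =
    2 ^+ #|U| * (18 * N%:R * l) / (qprod U)%:R + 2 ^+ #|U| * (18 * N%:R * l) / (qprod U)%:R by ring.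
  by apply: lerD; apply: primeDev_pt; rewrite ?qN //; clear -hD N_D; lia.
set w := sweight N D0 H L be.
set s := fun a => ssum N D0 H v L be a.
set hf := ln (3 * N)%:R / 2.
have eh : hf = (L + c1) / theta0.
  rewrite /hf natrM lnM ?ltr0n // -/l /c1 /L; last by rewrite -(ltr_nat R).
  by field; rewrite gt_eqF.
have hf0 : 0 <= hf by rewrite eh divr_ge0 ?(ltW th0) // addr_ge0 // ltW.
have pos : 0 < \sum_(h <- H) s (fun n => logprime (n + h)) -
    hf * (s (fun=> 1) + s (fun n => liouville `|(n%:Z + r)%R|%N)).
  set T1 := sform D0 H L be (sel_g D0 k) in S1.
  pose T2 := @sform N D0 H L be (sel_g' D0 k).
  have T1le : T1 <= sel_corr D0 k * dens D0 ^+ k * (L + C) ^+ (k + 2) * I.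
    by apply: sel_form_le => //; apply: ltW.
  have T2ge : dens D0 ^+ k.+1 * L ^+ (k + 3) * J <= T2.
    by apply: sel_form_ge => //; apply: ltW.
  clearbody I J.
  have tW0 : 0 < (totient W)%:R :> R by rewrite ltr0n totient_gt0 primorial_gt0.
  have A4 : k%:R * (N%:R / (totient W)%:R * T2 - KP * N%:R) <= \sum_(h <- H) s (fun n => logprime (n + h)).
    rewrite -sumr_const_seq.
    rewrite big_seq [leRHS]big_seq; apply: ler_sum => h hH.
    have SP := @ssum_prime N D0 H v L be k1 kD uH HD vW cv (Lam D0 H be L) lamB h hH.
    have := le_trans SP (eP h hH); rewrite ler_norml -/W -/T2 => /andP[b1 _].
    by rewrite lerBlDr -lerBlDl -opprB lerNl.
  have eL3 : E1 <= eta * L ^+ (k + 3).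
    rewrite mulrC -ler_pdivrMr //; apply: (@le_trans _ _ L); first exact: le_trans XL.
    by rewrite addnS exprS ler_peMr ?(ltW L0) // exprn_ege1.
  have eL2 : E2 <= eta * L ^+ (k + 2).
    rewrite mulrC -ler_pdivrMr //; apply: (@le_trans _ _ L); first exact: le_trans XL.
    by rewrite addnS exprS ler_peMr ?(ltW L0) // exprn_ege1.
  have hfr : hf <= rho * L / theta0.
    rewrite eh ler_pM2r ?invr_gt0 //.
    have : c1 / (rho - 1) <= L by apply: le_trans XL.
    by rewrite ler_pdivrMr // [L * _]mulrC mulrBl mul1r lerBrDl.
  have LX1 : X1 <= L by apply: le_trans XL.
  have fin := asym_ineq L0 th0 I0 corr0 C0 E20 hf0 rho0 (HX1 L LX1 L0) corr_le eL3 eL2 hfr key.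
  have dk0 : 0 < dens D0 ^+ k by rewrite exprn_gt0.
  rewrite exprS in T2ge.
  exact: (sieve_algebra (corr := sel_corr D0 k) (I := I) (J := J) Np W0 tW0 (erefl (dens D0)) dk0
    (ler0n _ k) hf0 T1le T2ge (le_trans S1 e1) (le_trans SL eLi) A4 fin).
have eD : \sum_(h <- H) s (fun n => logprime (n + h)) -
    hf * (s (fun=> 1) + s (fun n => liouville `|(n%:Z + r)%R|%N)) =
  \sum_(N.+1 <= n < (N + N).+1 | (n %% W)%N == v)
    w n * (\sum_(h <- H) logprime (n + h) - hf * (1 + liouville `|(n%:Z + r)%R|%N)).
  rewrite /s /ssum exchange_big -big_split big_distrr -sumrB /=; apply: eq_bigr => n _.
  by rewrite -/w -big_distrl /=; ring.
rewrite eD in pos.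
(* Were every bracket nonpositive, the sum would be too, since the weights are squares. *)
case: (boolP (has (fun n => hf * (1 + liouville `|(n%:Z + r)%R|%N) < \sum_(h <- H) logprime (n + h))
   (index_iota N.+1 (N + N).+1))) => [/hasP[n]|/hasPn no].
  rewrite mem_index_iota ltnS => nN big; exists n => //; split=> // h /HD hD.
  by clear -nN hD N_D; lia.
exfalso; move: pos; apply/negP; rewrite -leNgt.
rewrite big_seq_cond; apply: sumr_le0 => n /andP[nN _].
rewrite mulr_ge0_le0 ?subr_le0 //; first by rewrite /w sqr_ge0.
by rewrite leNgt; apply: no.
Qed.

Lemma sum_logprime_gt0 (s : seq nat) (n : nat) : 0 < \sum_(h <- s) logprime (n + h) ->
  exists2 h, h \in s & prime (n + h).
Proof.
move=> pos; apply/hasP; apply: contraTT pos => /hasPn no.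
rewrite -leNgt big_seq big1 // => h /no np; by rewrite /logprime (negPf np).
Qed.

(* The coefficients [be] in [key_gap2] to [key_gap5] approximate the optimal (Bessel) weights;
   [rho] and [eta] leave room for the lower order terms. *)
Definition key_gap (k : nat) (theta0 be : R) : bool :=
  let rho : R := 1001 / 1000 in let eta : R := 1 / 1000 * (1 / 100) in
  eta + rho / theta0 * (rho ^+ 2 *
    (1 / (k`!)%:R + 4 * be / ((k + 1)`!)%:R + 8 * be ^+ 2 / ((k + 2)`!)%:R) + eta) <
  k%:R * (2 / ((k + 1)`!)%:R + 12 * be / ((k + 2)`!)%:R + 24 * be ^+ 2 / ((k + 3)`!)%:R).

Lemma key_gap2 : key_gap 2 (729 / 1000) (3 / 5).
Proof.
rewrite /key_gap -[(2 + 1)%N]/3%N -[(2 + 2)%N]/4%N -[(2 + 3)%N]/5%N !factS fact0 !natrM.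
lra.
Qed.

Lemma key_gap3 : key_gap 3 (616 / 1000) (3 / 2).
Proof.
rewrite /key_gap -[(3 + 1)%N]/4%N -[(3 + 2)%N]/5%N -[(3 + 3)%N]/6%N !factS fact0 !natrM.
lra.
Qed.

Lemma key_gap4 : key_gap 4 (554 / 1000) 3.
Proof.
rewrite /key_gap -[(4 + 1)%N]/5%N -[(4 + 2)%N]/6%N -[(4 + 3)%N]/7%N !factS fact0 !natrM.
lra.
Qed.

Lemma key_gap5 : key_gap 5 (515 / 1000) 4.
Proof.
rewrite /key_gap -[(5 + 1)%N]/6%N -[(5 + 2)%N]/7%N -[(5 + 3)%N]/8%N !factS fact0 !natrM.
lra.
Qed.

Theorem theorem5 (theta0 : R) (k : nat)
  (Hpair : (theta0 = (729 / 1000)%R /\ k = 2%N) \/ (theta0 = (616 / 1000)%R /\ k = 3%N)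
        \/ (theta0 = (554 / 1000)%R /\ k = 4%N) \/ (theta0 = (515 / 1000)%R /\ k = 5%N))
  (theta : R) (Htheta : (theta0 < theta)%R) (HA : condA theta) (HB : condB theta)
  (H : seq nat) (Hsize : size H = k) (Hsorted : sorted ltn H)
  (Hadm : admissible H)
  (r : int) (Hr0 : r <> 0%R) (HrH : forall h : nat, h \in H -> r <> (h%:Z)%R) :
  forall M : int, exists n : int, (M < n)%R /\
    ((exists h1 h2 : nat, [/\ h1 \in H, h2 \in H, h1 <> h2,
                            primez (n + h1%:Z)%R & primez (n + h2%:Z)%R])
     \/ ((exists h : nat, h \in H /\ primez (n + h%:Z)%R)
         /\ liouville (absz (n + r)%R) = (-1)%R)).
Proof.
move=> M.
have uH : uniq H by apply: sorted_uniq Hsorted; [exact: ltn_trans | exact: ltnn].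
have [be [be0 k1 th0 th1 key]] :
    exists be : R, [/\ 0 <= be, (1 < k)%N, 0 < theta0, theta0 < 1 & key_gap k theta0 be].
  case: Hpair => [[-> ->]|[[-> ->]|[[-> ->]|[-> ->]]]].
  - by exists (3 / 5); split; rewrite ?key_gap2 //; lra.
  - by exists (3 / 2); split; rewrite ?key_gap3 //; lra.
  - by exists 3; split; rewrite ?key_gap4 //; lra.
  - by exists 4; split; rewrite ?key_gap5 //; lra.
rewrite -Hsize in k1 key.
have rho1 : 1 < 1001 / 1000 :> R by lra.
have eta0 : 0 < 1 / 1000 * (1 / 100) :> R by lra.
(* The lower bound [|M|] for N forces n > M. *)
have [N MN [n /andP[Nn nN] [n3 big]]] :=
  @sieve_positive H theta theta0 be _ _ r `|M|%N k1 uH Hadm be0 th0 th1 Htheta HA HB rho1 eta0 key.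
exists n%:Z; split; first by clear -MN Nn; lia.
have pz h : prime (n + h) -> primez (n%:Z + h%:Z)%R.
  by move=> ph; rewrite /primez -PoszD /= ph andbT ltz_nat prime_gt0.
have l3 : 0 <= ln (3 * N)%:R.
  by rewrite ln_ge0 // ler1n; clear -Nn nN; lia.
case: (liouvilleP `|(n%:Z + r)%R|%N) => lam; rewrite lam in big *; [left|right; split=> //].
- have {}big : ln (3 * N)%:R < \sum_(h <- H) logprime (n + h) by move: big; lra.
  have [h1 h1H p1] := sum_logprime_gt0 (le_lt_trans l3 big).
  (* One prime accounts for at most log(3N), so the remaining terms still have a positive sum and
     contain a second prime. *)
  have : 0 < \sum_(h <- rem h1 H) logprime (n + h).
    have : logprime (n + h1) <= ln (3 * N)%:R.
      by rewrite /logprime p1 ler_ln ?ltr0n ?prime_gt0 // ler_nat n3.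
    move: big; rewrite (big_rem h1) //=; lra.
  case/sum_logprime_gt0 => h2; rewrite mem_rem_uniq // inE => /andP[/eqP ne h2H] p2.
  by exists h1, h2; split; rewrite ?pz //; apply/nesym.
- have : 0 < \sum_(h <- H) logprime (n + h) by move: big; rewrite subrr mulr0.
  by case/sum_logprime_gt0 => h hH ph; exists h; rewrite hH pz.
Qed.
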